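(* For any pyramid $\mathcal P$, there exist $A=(a_n)_{n=1}^N\in\mathcal A$ and a sequence $\{\mathcal P_n\}_{n=1}^N$ of pyramids of finite observable diameter such that $$\mathcal P=\mathcal X^{1-\|A\|_1}+\sum_{n=1}^N\mathcal P_n^{a_n}.$$
   Context: An mm-space is a triple $(X,d_X,\mu_X)$ where $(X,d_X)$ is a complete separable metric space and $\mu_X$ is a Borel probability measure on it; $\mathcal X$ denotes the set of mm-isomorphism classes of mm-spaces (mm-isomorphism: an isometry between supports of the measures pushing one measure to the other). $Y\prec X$ means there is a 1-Lipschitz map $f:X\to Y$ with $f_*\mu_X=\mu_Y$. The box distance $\square(X,Y)$ is the infimum of $\max\{\operatorname{dis}(S),1-\pi(S)\}$ over couplings $\pi$ of $\mu_X,\mu_Y$ and Borel $S\subset X\times Y$, with $\operatorname{dis}(S)=\sup\{|d_X(x,x')-d_Y(y,y')|:(x,y),(x',y')\in S\}$. A pyramid is a nonempty subset $\mathcal P\subset\mathcal X$ closed in the box topology, closed downward under $\prec$, and directed with respect to $\prec$. $\mathcal X$ itself is a pyramid. Let $\overline{\mathbb N}=\mathbb N\cup\{\infty\}$, $[N]=\{1,\dots,N\}$ for finite $N$ and $[\infty]=\mathbb N$. For a countable index set $I$, a family $(a_i)_{i\in I}$ with $a_i\in(0,1]$, $\sum_i a_i=1$, and pyramids $\mathcal P_i$, the direct sum $\sum_{i\in I}\mathcal P_i^{a_i}$ is the set of $X\in\mathcal X$ for which there exist $X_i\in\mathcal P_i$ and 1-Lipschitz maps $f_i:X_i\to X$ with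 $\mu_X=\sum_i a_i(f_i)_*\mu_{X_i}$. $\mathcal A$ is the set consisting of the one-term sequence $(0)$ together with all sequences $A=(a_n)_{n=1}^N$, $N\in\overline{\mathbb N}$, with $a_n\in(0,1]$, $a_n\ge a_{n+1}$ for all $n$, and $\|A\|_1:=\sum_n a_n\le 1$ (for $A=(0)$, $\|A\|_1=0$ and the sum over $n$ is empty). For $A\in\mathcal A$ and pyramids $\mathcal P_n$, the notation $\mathcal X^{1-\|A\|_1}+\sum_{n=1}^N\mathcal P_n^{a_n}$ means: $\mathcal X$ if $\|A\|_1=0$; the direct sum $\sum_{n=0}^N\mathcal P_n^{a_n}$ with $a_0:=1-\|A\|_1$ and $\mathcal P_0:=\mathcal X$ if $0<\|A\|_1<1$; and $\sum_{n=1}^N\mathcal P_n^{a_n}$ if $\|A\|_1=1$. For an mm-space $X$ and $0<\kappa<1$: $\operatorname{diam}(\mu;1-\kappa)=\inf\{\operatorname{diam}A: A\text{ Borel},\ \mu(A)\ge1-\kappa\}$ ($\operatorname{diam}\emptyset=0$), $\operatorname{ObsDiam}(X;-\kappa)=\sup\{\operatorname{diam}(f_*\mu_X;1-\kappa): f:X\to\mathbb R\text{ 1-Lipschitz}\}$, and for a pyramid $\operatorname{ObsDiam}(\mathcal P;-\kappa)=\sup_{X\in\mathcal P}\operatorname{ObsDiam}(X;-\kappa)$. A pyramid has finite observable diameter if $\operatorname{ObsDiam}(\mathcal P;-\kappa)<\infty$ for every $0<\kappa<1$. *)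

(* Defs.v *)
From HB Require Import structures.
From mathcomp Require Import all_boot all_order all_algebra.
From mathcomp Require Import all_classical all_reals all_analysis.
From mathcomp Require Import Rstruct Rstruct_topology.

Set Implicit Arguments.
Unset Strict Implicit.
Unset Printing Implicit Defensive.
Import Order.TTheory GRing.Theory Num.Theory.
Local Open Scope classical_set_scope.
Local Open Scope ring_scope.

Notation R := Rdefinitions.R.

Definition dball (T : Type) (d : T -> T -> R) (x : T) (e : R) : set T :=
  [set y | d x y < e].

Definition dopen (T : Type) (d : T -> T -> R) (U : set T) : Prop :=
  forall x, U x -> exists2 e : R, 0 < e & dball d x e `<=` U.

Definition is_metric (T : Type) (d : T -> T -> R) : Prop :=
  [/\ forall x y, d x y = 0 <-> x = y,
      forall x y, d x y = d y x &
      forall x y z, d x z <= d x y + d y z].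

Definition dcomplete (T : Type) (d : T -> T -> R) : Prop :=
  forall u : nat -> T,
    (forall e : R, 0 < e -> exists N : nat, forall m n : nat,
        (N <= m)%N -> (N <= n)%N -> d (u m) (u n) < e) ->
    exists x : T, forall e : R, 0 < e ->
      exists N : nat, forall n : nat, (N <= n)%N -> d (u n) x < e.

Definition dseparable (T : Type) (d : T -> T -> R) : Prop :=
  exists s : nat -> T, forall (x : T) (e : R), 0 < e -> exists n : nat, d x (s n) < e.

(* mm-spaces.  Every mm-isomorphism class has a representative with    *)
(* supp mu = X (the support with the restricted metric), so we work    *)
(* with fully supported representatives.                 *)

Record mmspace := MMSpace {
  mm_disp : measure_display;
  mm_car : measurableType mm_disp;
  mm_dist : mm_car -> mm_car -> R;
  mm_metric : is_metric mm_dist;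
  mm_complete : dcomplete mm_dist;
  mm_separable : dseparable mm_dist;
  mm_borel : @measurable _ mm_car = <<s dopen mm_dist >>;
  mm_mu : probability mm_car R;
  mm_fullsupp : forall (x : mm_car) (e : R), 0 < e -> (0 < mm_mu (dball mm_dist x e))%E
}.

Definition lip1 (X Y : mmspace) (f : mm_car X -> mm_car Y) : Prop :=
  forall x x', mm_dist (f x) (f x') <= mm_dist x x'.

Definition pushes (X Y : mmspace) (f : mm_car X -> mm_car Y) : Prop :=
  measurable_fun setT f /\
  forall B : set (mm_car Y), measurable B -> mm_mu X (f @^-1` B) = mm_mu Y B.

Definition dominated (Y X : mmspace) : Prop :=
  exists f : mm_car X -> mm_car Y, lip1 f /\ pushes f.

Definition coupling (X Y : mmspace) (pi : probability (mm_car X * mm_car Y)%type R) : Prop :=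
  (forall A : set (mm_car X), measurable A -> pi (A `*` setT) = mm_mu X A) /\
  (forall B : set (mm_car Y), measurable B -> pi (setT `*` B) = mm_mu Y B).

Definition dis (X Y : mmspace) (S : set (mm_car X * mm_car Y)) : \bar R :=
  ereal_sup [set (`|mm_dist p.1 q.1 - mm_dist p.2 q.2|)%:E
            | p in S & q in S] .

Definition box (X Y : mmspace) : \bar R :=
  ereal_inf [set r | exists (pi : probability (mm_car X * mm_car Y)%type R)
                       (S : set (mm_car X * mm_car Y)),
                   [/\ coupling pi, measurable S & r = maxe (dis S) (1 - pi S)%E]].

Definition box_closed (P : mmspace -> Prop) : Prop :=
  forall X : mmspace,
    (forall e : R, 0 < e -> exists Y : mmspace, P Y /\ (box Y X < e%:E)%E) -> P X.

Definition pyramid (P : mmspace -> Prop) : Prop :=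
  [/\ exists X, P X,
      box_closed P,
      (forall X Y, P X -> dominated Y X -> P Y) &
      (forall X Y, P X -> P Y -> exists Z, [/\ P Z, dominated X Z & dominated Y Z])].

(* diam A = sup |x - y| over A, with diam set0 = 0 (values are >= 0, so *)
(* adding 0 to the set changes nothing for nonempty A) *)
Definition diamR (A : set R) : \bar R :=
  ereal_sup ([set (`|x - y|)%:E | x in A & y in A] `|` [set 0%E]).

Definition partial_diam (nu : set R -> \bar R) (kappa : R) : \bar R :=
  ereal_inf [set diamR A | A in [set A : set (measurableTypeR R) | measurable A /\ ((1 - kappa)%:E <= nu A)%E]].

Definition obsdiam (X : mmspace) (kappa : R) : \bar R :=
  ereal_sup [set partial_diam (pushforward (mm_mu X) f) kappa
            | f in [set f : mm_car X -> measurableTypeR R | measurable_fun setT f /\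
                      (forall x x', `|f x - f x'| <= mm_dist x x')]].

Definition obsdiamP (P : mmspace -> Prop) (kappa : R) : \bar R :=
  ereal_sup [set r | exists X : mmspace, P X /\ r = obsdiam X kappa].

Definition finite_obsdiam (P : mmspace -> Prop) : Prop :=
  forall kappa : R, 0 < kappa < 1 -> (obsdiamP P kappa < +oo)%E.

Definition dsum (D : set nat) (w : nat -> R) (Q : nat -> mmspace -> Prop)
    (X : mmspace) : Prop :=
  exists (Xs : nat -> mmspace) (f : forall i, mm_car (Xs i) -> mm_car X),
    [/\ forall i, D i -> Q i (Xs i),
        forall i, D i -> lip1 (f i) /\ measurable_fun setT (f i) &
        forall B : set (mm_car X), measurable B ->
          mm_mu X B = \esum_(i in D) ((w i)%:E * mm_mu (Xs i) (f i @^-1` B))%E].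

Definition calX : mmspace -> Prop := fun _ => True.

(* The family \mathcal A.  A sequence is encoded by its length         *)
(* N : option nat (None = infinity) and its terms a : nat -> R,        *)
(* indexed from 1; [N] = {1..N} (or all n >= 1 if N = None).           *)

Definition idx (N : option nat) : set nat :=
  [set n | (1 <= n)%N /\ match N with Some m => (n <= m)%N | None => True end].

Definition norm1 (N : option nat) (a : nat -> R) : \bar R :=
  \esum_(n in idx N) (a n)%:E.

Definition inA (N : option nat) (a : nat -> R) : Prop :=
  (N = Some 1%N /\ a 1%N = 0)
  \/
  [/\ N <> Some 0%N,
      (forall n, idx N n -> 0 < a n <= 1),
      (forall n, idx N n -> idx N n.+1 -> a n.+1 <= a n) &
      (norm1 N a <= 1)%E].

Definition Xsum (N : option nat) (a : nat -> R) (P : nat -> mmspace -> Prop)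
    (X : mmspace) : Prop :=
  (norm1 N a = 0%E /\ calX X)
  \/
  ((0 < norm1 N a < 1)%E /\
     dsum ([set 0%N] `|` idx N)
          (fun n => if n == 0%N then 1 - fine (norm1 N a) else a n)
          (fun n => if n == 0%N then calX else P n) X)
  \/
  (norm1 N a = 1%E /\ dsum (idx N) a P X).

(* Main.v *)
(* Choose a chain [X n] in [P] that is increasing for the Lipschitz order and meets every
   box-neighbourhood of every element of [P]. Let L be the ultraproduct of the [X n], with its
   Loeb measure and the ultralimit of the distances, which may be infinite. By saturation, [P] is
   exactly the class of the mm-spaces that are measure preserving 1-Lipschitz images of L
   ([pyr setT]); conversely, box-closedness of [P] and McShane extension show that every such image
   belongs to [P].

   The measurable sets that lie, up to a null set, at infinite distance from their complement form
   a sigma-algebra. Let C_1, C_2, ... be its atoms and a_n their masses; P_n is the pyramid of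
   the images of C_n with its normalized measure ([pyr (C n)]). If the observable diameter of
   P_n were infinite, saturation would give an infinitely distant splitting of C_n, which is an
   atom. The complement of the atoms splits into infinitely distant pieces of arbitrarily
   prescribed masses (Sierpinski), hence maps onto every mm-space. Since different pieces are
   infinitely distant, maps on the pieces glue, and the images of L are the direct sum of the
   images of the pieces.

   The sigma-algebra cannot be replaced by the partition of a limit space into classes of points
   at finite distance: these may all be null although no set is separated from its complement. *)

From HB Require Import structures.
Require Import Defs.
From mathcomp Require Import all_boot all_order all_algebra.
From mathcomp Require Import all_classical all_reals all_analysis.
From mathcomp Require Import Rstruct Rstruct_topology.
From mathcomp Require Import lra.

Set Implicit Arguments.
Unset Strict Implicit.
Unset Printing Implicit Defensive.
Import Order.TTheory GRing.Theory Num.Theory.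
Local Open Scope classical_set_scope.
Local Open Scope ring_scope.

(** An almost 1-Lipschitz map from a member of the chain to [Y] cannot in general be corrected to a
    1-Lipschitz map into [Y], which need not be an injective metric space. Finitely many points of
    [Y] are therefore embedded into a sup-normed space by their distance vectors: the coordinates
    are real functions and extend by McShane's formula. The image obtained in this way is only
    box-close to [Y], and this is where box-closedness of a pyramid enters. In the other direction
    the obstacle is that the chain has no common tightness, so no subsequence need converge.
    Saturation takes the place of compactness: it turns approximations that exist at almost every
    index into one exact object of the ultraproduct. Laws are controlled by upper bounds on
    thickened sets only. Such bounds survive the passage to subsets and to standard parts, and when
    almost no total mass is lost they determine the law in the limit. *)

Section Probability.
Context {disp : measure_display} {T : measurableType disp} (mu : probability T R).
Implicit Types A B : set T.

(** Real-valued masses, so that error estimates are linear inequalities over [R]. *)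
Definition pr A : R := fine (mu A).

Lemma prE A : measurable A -> mu A = (pr A)%:E.
Proof. by move=> mA; rewrite /pr fineK// fin_num_measure. Qed.

Lemma pr_ge0 A : 0 <= pr A.
Proof. by rewrite /pr fine_ge0. Qed.

Lemma pr0 : pr set0 = 0.
Proof. by rewrite /pr measure0. Qed.

Lemma prT : pr setT = 1.
Proof. by rewrite /pr probability_setT. Qed.

Lemma le_pr A B : measurable A -> measurable B -> A `<=` B -> pr A <= pr B.
Proof.
move=> mA mB AB; rewrite -lee_fin -!prE//; apply: le_measure => //; by rewrite inE.
Qed.

Lemma pr_le1 A : measurable A -> pr A <= 1.
Proof. by move=> mA; rewrite -prT; apply: le_pr. Qed.

Lemma prU A B : measurable A -> measurable B -> A `&` B = set0 ->
  pr (A `|` B) = pr A + pr B.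
Proof.
move=> mA mB AB; apply: EFin_inj; rewrite EFinD -!prE//; last exact: measurableU.
by rewrite measureU.
Qed.

Lemma prD A B : measurable A -> measurable B ->
  pr (A `\` B) = pr A - pr (A `&` B).
Proof.
move=> mA mB; have mI := measurableI _ _ mA mB.
have mD := measurableD mA mB.
suff -> : pr A = pr (A `\` B) + pr (A `&` B) by rewrite addrK.
rewrite -prU//; first by rewrite setUC setUIDK.
by rewrite setDE setIACA (setIC (~` B)) setICr setI0.
Qed.

Lemma prC A : measurable A -> pr (~` A) = 1 - pr A.
Proof. by move=> mA; rewrite -setTD prD// prT setTI. Qed.

Lemma prU_le A B : measurable A -> measurable B -> pr (A `|` B) <= pr A + pr B.
Proof.
move=> mA mB; have -> : A `|` B = A `|` (B `\` A) by rewrite setDE setUIr setUCr setIT.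
rewrite prU//; [|exact: measurableD|by rewrite setDE setICA setICr setI0].
by rewrite lerD2l; apply: le_pr => //; exact: measurableD.
Qed.

Lemma pr_subD A B : measurable A -> measurable B -> B `<=` A ->
  pr (A `\` B) = pr A - pr B.
Proof. by move=> mA mB BA; rewrite prD// (setIidr BA). Qed.

Lemma pr_null A B : measurable A -> measurable B -> pr B = 0 -> A `<=` B -> pr A = 0.
Proof.
by move=> mA mB B0 AB; apply/eqP; rewrite eq_le pr_ge0 andbT -B0; exact: le_pr.
Qed.

Lemma pr_bigcup_null (F : nat -> set T) : (forall n, measurable (F n)) ->
  (forall n, pr (F n) = 0) -> pr (\bigcup_n F n) = 0.
Proof.
move=> mF F0; rewrite /pr (_ : mu _ = 0)//; apply/eqP; rewrite eq_le measure_ge0 andbT.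
apply: le_trans (_ : \sum_(n <oo) mu (F n) <= 0)%E.
  by apply: measure_sigma_subadditive => //; exact: bigcupT_measurable.
by rewrite eseries0// => n _ _; rewrite prE// F0.
Qed.

(** Inclusion up to a null set; used in both directions it identifies the masses of sets that agree
    almost everywhere. The Loeb sigma-algebra below is not completed, so exceptional sets are always
    taken measurable. *)
Lemma pr_eqD (A B N : set T) : measurable A -> measurable B -> measurable N ->
  pr N = 0 -> A `\` N `<=` B -> pr A <= pr B.
Proof.
move=> mA mB mN N0 AB; apply: (@le_trans _ _ (pr (B `|` N))).
  apply: le_pr => //; first exact: measurableU.
  by move=> x Ax; have [Nx|Nx] := pselect (N x); [right|left; apply: AB].
by apply: le_trans (prU_le _ _) _ => //; rewrite N0 addr0.
Qed.

Lemma pr_cvg_up (F : nat -> set T) : (forall n, measurable (F n)) ->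
  (forall m n, (m <= n)%N -> F m `<=` F n) ->
  forall e : R, 0 < e -> exists N, forall n, (N <= n)%N -> pr (\bigcup_n F n) - e < pr (F n).
Proof.
move=> mF ndF e e0.
have mU : measurable (\bigcup_n F n) by exact: bigcupT_measurable.
have /fine_cvgP[_] : mu \o F @ \oo --> (pr (\bigcup_n F n))%:E.
  rewrite -prE//; apply: (@nondecreasing_cvg_mu _ _ _ mu F) => //.
  by move=> m n mn; apply/subsetPset/ndF.
move=> /cvgrPdist_lt/(_ _ e0)[N _ HN]; exists N => n Nn.
have := HN _ Nn; rewrite /= -/(pr (F n)) => /(le_lt_trans (ler_norm _)); lra.
Qed.

Lemma pr_cvg_down (F : nat -> set T) : (forall n, measurable (F n)) ->
  (forall m n, (m <= n)%N -> F n `<=` F m) ->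
  forall e : R, 0 < e -> exists N, forall n, (N <= n)%N -> pr (F n) < pr (\bigcap_n F n) + e.
Proof.
move=> mF niF e e0.
have mC n : measurable (~` F n) by exact: measurableC.
have [|N HN] := @pr_cvg_up (fun n => ~` F n) mC _ _ e0.
  by move=> m n mn; apply: subsetC; exact: niF.
exists N => n /HN; rewrite -setC_bigcap !prC//; last exact: bigcapT_measurable.
lra.
Qed.

Lemma pr_bigU (I : choiceType) (r : seq I) (F : I -> set T) : uniq r ->
  (forall i, measurable (F i)) -> (forall i j x, F i x -> F j x -> i = j) ->
  pr (\big[setU/set0]_(i <- r) F i) = \sum_(i <- r) pr (F i).
Proof.
move=> + mF tF; elim: r => [|i r IH]; first by rewrite !big_nil pr0.
move=> /= /andP[ir ur]; rewrite !big_cons prU//; first by rewrite IH.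
  exact: bigsetU_measurable.
apply/seteqP; split=> // x [Fix]; rewrite -bigcup_seq => -[j /= jr Fjx].
by move: ir; rewrite (tF _ _ _ Fix Fjx) jr.
Qed.

Lemma pr_bigU_cond (I : choiceType) (r : seq I) (Q : pred I) (F : I -> set T) : uniq r ->
  (forall i, measurable (F i)) -> (forall i j x, F i x -> F j x -> i = j) ->
  pr (\big[setU/set0]_(i <- r | Q i) F i) = \sum_(i <- r | Q i) pr (F i).
Proof.
move=> ur mF tF; rewrite big_mkcond [RHS]big_mkcond pr_bigU//.
- by apply: eq_bigr => i _; case: ifP => // _; rewrite pr0.
- by move=> i; case: ifP.
- by move=> i j x; case: ifP => // _ Fi; case: ifP => // _; exact: tF.
Qed.

Lemma pr_bigU_le (I : Type) (r : seq I) (P : pred I) (F : I -> set T) :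
  (forall i, measurable (F i)) ->
  pr (\big[setU/set0]_(i <- r | P i) F i) <= \sum_(i <- r | P i) pr (F i).
Proof.
move=> mF; elim: r => [|i r IH]; first by rewrite !big_nil pr0.
rewrite !big_cons; case: ifP => // _; apply: le_trans (prU_le _ _) _ => //.
  exact: bigsetU_measurable.
by rewrite lerD2l.
Qed.

End Probability.

(** * Saturation along a nonprincipal ultrafilter *)

Definition eps (k : nat) : R := k.+1%:R^-1.

Lemma eps_gt0 k : 0 < eps k.
Proof. by rewrite /eps invr_gt0. Qed.

Lemma le_eps j k : (j <= k)%N -> eps k <= eps j.
Proof. by move=> jk; rewrite /eps lef_pV2 ?posrE// ler_nat. Qed.

Lemma half_gt0 (e : R) : 0 < e -> exists2 q : R, 0 < q & q + q = e.
Proof. by move=> e0; exists (e / 2); [rewrite divr_gt0|rewrite -splitr]. Qed.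

Lemma quarter_gt0 (e : R) : 0 < e -> exists2 q : R, 0 < q & q + q + q + q = e.
Proof.
move=> /half_gt0[q /half_gt0[r r0 <-] <-]; exists r => //; by rewrite !addrA.
Qed.

Lemma min_gt0 (a b : R) : 0 < a -> 0 < b -> exists e : R, [/\ 0 < e, e <= a & e <= b].
Proof.
by move=> a0 b0; exists (Num.min a b); rewrite lt_min a0 b0 !ge_min !lexx orbT.
Qed.

Lemma eps_small (e : R) : 0 < e -> exists k, forall j, (k <= j)%N -> eps j < e.
Proof.
move=> e0; have [k _ Hk] := near_infty_natSinv_lt (PosNum e0).
by exists k => j /Hk.
Qed.

Lemma le_eps0 (x : R) : (forall k, x <= eps k) -> x <= 0.
Proof.
move=> H; apply/ler_addgt0Pr => e /eps_small[k /(_ k (leqnn k)) ke].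
by rewrite add0r (le_trans (H k))// ltW.
Qed.

Lemma exists_hyperfilter : exists F : set_system nat, UltraFilter F /\ \oo `<=` F.
Proof. exact: ultraFilterLemma. Qed.

Definition hyper : set_system nat := projT1 (cid exists_hyperfilter).

Global Instance hyper_ultra : UltraFilter hyper.
Proof. exact: (projT2 (cid exists_hyperfilter)).1. Qed.

Global Instance hyper_proper : ProperFilter hyper.
Proof. exact: ultra_proper. Qed.

Lemma hyper_ge k : \forall n \near hyper, (k <= n)%N.
Proof. by apply: (projT2 (cid exists_hyperfilter)).2; exact: nbhs_infty_ge. Qed.

Lemma hyperN (A : nat -> Prop) : ~ (\forall n \near hyper, A n) <->
  \forall n \near hyper, ~ A n.
Proof.
split=> [nA|nA hA]; first by have [] := in_ultra_setVsetC A hyper_ultra.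
by apply: (@filter_not_empty _ hyper); near=> n; near: n; apply: filterS2 hA nA.
Unshelve. all: by end_near. Qed.

Lemma hyperV (A B : nat -> Prop) : (\forall n \near hyper, A n \/ B n) ->
  (\forall n \near hyper, A n) \/ (\forall n \near hyper, B n).
Proof.
move=> AB; have [|/hyperN nA] := pselect (\forall n \near hyper, A n); [by left|right].
by apply: filterS2 AB nA => n [].
Qed.

Lemma hyper_ex (P : nat -> Prop) : (\forall n \near hyper, P n) -> exists n, P n.
Proof. exact: (@filter_ex _ hyper). Qed.

Lemma hyper_and (A B : nat -> Prop) : (\forall n \near hyper, A n) ->
  (\forall n \near hyper, B n) -> \forall n \near hyper, A n /\ B n.
Proof. by move=> hA hB; apply: filterS2 hA hB => n. Qed.

Lemma hyper_forall_ord (m : nat) (P : 'I_m -> nat -> Prop) :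
  (forall i, \forall n \near hyper, P i n) -> \forall n \near hyper, forall i, P i n.
Proof. by move=> H; apply: filter_forall. Qed.

(** An ultrafilter decides a finite disjunction, so a single [j] serves almost all indices. *)
Lemma hyper_exists_lt (m : nat) (P : nat -> nat -> Prop) :
  (\forall n \near hyper, exists2 j, (j < m)%N & P j n) ->
  exists2 j, (j < m)%N & \forall n \near hyper, P j n.
Proof.
elim: m => [|m IH H]; first by move=> /(@filter_ex _ hyper)[n [] ].
have /hyperV[|hm] : \forall n \near hyper, (exists2 j, (j < m)%N & P j n) \/ P m n.
- apply: filterS H => n [j]; rewrite ltnS leq_eqVlt => /orP[/eqP->|jm] Pj; first by right.
  by left; exists j.
- by move=> /IH[j jm Hj]; exists j => //; exact: ltnW.
- by exists m.
Qed.

(* This is the aleph_1-saturation of the ultrapower along [hyper]. *)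
Lemma saturation (D : nat -> Type) (Phi : nat -> forall n, D n -> Prop)
    (d0 : forall n, D n) :
  (forall k, \forall n \near hyper, exists t : D n, forall j, (j <= k)%N -> Phi j n t) ->
  exists t : forall n, D n, forall k, \forall n \near hyper, Phi k n (t n).
Proof.
move=> H.
(* Diagonal choice: with [m = n], the witness at index [n] meets the conditions up to the largest
   [k <= n] for which they can be met together. A fixed [k] is reached at almost every [n] because
   the ultrafilter contains the tails. *)
have E n m : exists t : D n, forall k, (k <= m)%N ->
    (exists t' : D n, forall j, (j <= k)%N -> Phi j n t') ->
    forall j, (j <= k)%N -> Phi j n t.
  elim: m => [|m [t Ht]].
    have [[t Ht]|nt] := pselect (exists t' : D n, forall j, (j <= 0)%N -> Phi j n t').
      by exists t => k; rewrite leqn0 => /eqP-> _.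
    by exists (d0 n) => k; rewrite leqn0 => /eqP-> /nt.
  have [[t' Ht']|nt] := pselect (exists t' : D n, forall j, (j <= m.+1)%N -> Phi j n t').
    by exists t' => k km _ j jk; apply/Ht'/(leq_trans jk).
  exists t => k; rewrite leq_eqVlt => /orP[/eqP->/nt//|]; rewrite ltnS => km.
  exact: Ht.
exists (fun n => projT1 (cid (E n n))) => k.
apply: filterS2 (hyper_ge k) (H k) => n kn Ek.
exact: (projT2 (cid (E n n)) k kn Ek).
Qed.

(** The image of an ultrafilter is again an ultrafilter, and on a compact interval it converges. *)
Lemma hyper_lim (u : nat -> R) (a b : R) : (forall n, a <= u n <= b) ->
  exists2 l : R, a <= l <= b & forall e : R, 0 < e -> \forall n \near hyper, `|u n - l| < e.
Proof.
move=> uab; have UF : UltraFilter (u @ hyper).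
  split; first exact: fmap_proper_filter.
  move=> G GP sub; apply/seteqP; split=> [A GA|//].
  have [//|UnA] := in_ultra_setVsetC (u @^-1` A) hyper_ultra.
  have /sub GnA : (u @ hyper) (~` A) by [].
  have : G (A `&` ~` A) by exact: filterI.
  by rewrite setICr => /filter_ex[].
have := @segment_compact R a b; rewrite compact_ultra => /(_ _ UF)[].
  by apply: (@filterE _ hyper) => n; rewrite /= in_itv/=.
move=> l [] /=; rewrite in_itv/= => lab ul; exists l => // e e0.
have := ul _ (nbhsx_ballx l e e0).
apply: (@filterS _ hyper) => n; rewrite /ball/= distrC.
by [].
Qed.

Definition hlim (u : nat -> R) : R := xget 0 [set l : R |
  forall e : R, 0 < e -> \forall n \near hyper, `|u n - l| < e].

Lemma hlimP (u : nat -> R) (a b : R) : (forall n, a <= u n <= b) ->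
  forall e : R, 0 < e -> \forall n \near hyper, `|u n - hlim u| < e.
Proof.
by move=> /hyper_lim[l _ Hl]; rewrite /hlim; case: xgetP => // /(_ l).
Qed.

Lemma hlim_unique (u : nat -> R) (l l' : R) :
  (forall e : R, 0 < e -> \forall n \near hyper, `|u n - l| < e) ->
  (forall e : R, 0 < e -> \forall n \near hyper, `|u n - l'| < e) -> l = l'.
Proof.
move=> H H'; apply/eqP/negPn/negP => ll'.
have e0 : 0 < `|l - l'| / 2 by rewrite divr_gt0// normr_gt0 subr_eq0.
have [n [h h']] := hyper_ex (hyper_and (H _ e0) (H' _ e0)).
have : `|l - l'| <= `|u n - l| + `|u n - l'|.
  by rewrite (distrC (u n) l); exact: ler_distD.
by lra.
Qed.

Lemma le_hlim (u v : nat -> R) (l l' : R) :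
  (forall e : R, 0 < e -> \forall n \near hyper, `|u n - l| < e) ->
  (forall e : R, 0 < e -> \forall n \near hyper, `|v n - l'| < e) ->
  (\forall n \near hyper, u n <= v n) -> l <= l'.
Proof.
move=> H H' uv; apply/ler_addgt0Pr => e e0.
have e20 : 0 < e / 2 by rewrite divr_gt0.
have [n [h []]] := hyper_ex (hyper_and uv (hyper_and (H _ e20) (H' _ e20))).
by rewrite !ltr_norml => /andP[? ?] /andP[? ?]; lra.
Qed.

(** * Loeb measure *)

Section Loeb.
Variable X : nat -> mmspace.

(** The full product, without identifying sequences that agree at almost every index: internal sets
    do not tell such sequences apart, so the quotient can be avoided. *)
Definition ultraproduct : Type := forall n, mm_car (X n).

HB.instance Definition _ := gen_eqMixin ultraproduct.
HB.instance Definition _ := gen_choiceMixin ultraproduct.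
HB.instance Definition _ := isPointed.Build ultraproduct (fun n => point).

Definition internal (A : forall n, set (mm_car (X n))) : set ultraproduct :=
  [set x | \forall n \near hyper, A n (x n)].

Definition internally_measurable (B : set ultraproduct) : Prop :=
  exists2 A : forall n, set (mm_car (X n)), forall n, measurable (A n) & B = internal A.

Lemma internal_subP A B : internal A `<=` internal B <->
  \forall n \near hyper, A n `<=` B n.
Proof.
split=> [AB|AB x]; last by rewrite /internal/=; apply: filterS2 AB => n; apply.
have [//|/hyperN nAB] := pselect (\forall n \near hyper, A n `<=` B n).
(* If the inclusion fails at almost every index, the counterexamples chosen there form a point of
   [internal A] outside [internal B]. *)
have pickx n : exists x : mm_car (X n), ~ (A n `<=` B n) -> A n x /\ ~ B n x.
  have [?|/existsNP[x /not_implyP H]] := pselect (A n `<=` B n); first by exists point.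
  by exists x.
pose x n := projT1 (cid (pickx n)).
have xP n : ~ (A n `<=` B n) -> A n (x n) /\ ~ B n (x n) := projT2 (cid (pickx n)).
have /AB Bx : internal A x by apply: filterS nAB => n /xP[].
by have [n [/xP[_ nB] /nB]] := hyper_ex (hyper_and nAB Bx).
Qed.

Lemma internal_eq A B : internal A = internal B -> \forall n \near hyper, A n = B n.
Proof.
move=> AB; have /internal_subP h1 : internal A `<=` internal B by rewrite AB.
have /internal_subP h2 : internal B `<=` internal A by rewrite AB.
by apply: filterS2 h1 h2 => n h1 h2; apply/seteqP.
Qed.

Lemma internal0 : internal (fun n => set0) = set0.
Proof. by apply/seteqP; split=> // x /hyper_ex[]. Qed.

Lemma internalT : internal (fun n => setT) = setT.
Proof. by apply/seteqP; split=> // x _; exact: filterE. Qed.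

Lemma internalC A : internal (fun n => ~` A n) = ~` internal A.
Proof. by apply/seteqP; split=> x; [move=> /hyperN | move=> /= H; apply/hyperN]. Qed.

Lemma internalI A B : internal (fun n => A n `&` B n) = internal A `&` internal B.
Proof.
apply/seteqP; split=> x /=; last by move=> [h1 h2]; exact: hyper_and.
by move=> H; split; apply: filterS H => n [].
Qed.

Lemma internalU A B : internal (fun n => A n `|` B n) = internal A `|` internal B.
Proof.
rewrite -[RHS]setCK setCU -!internalC -internalI -internalC.
by congr internal; apply: functional_extensionality_dep => n; rewrite -setCU setCK.
Qed.

Let internally_measurableU : setU_closed internally_measurable.
Proof.
move=> _ _ [A mA ->] [B mB ->]; exists (fun n => A n `|` B n); last by rewrite internalU.
by move=> n; exact: measurableU.
Qed.

Let internally_measurableC : setC_closed internally_measurable.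
Proof.
move=> _ [A mA ->]; exists (fun n => ~` A n); last by rewrite internalC.
by move=> n; exact: measurableC.
Qed.

Let internally_measurable0 : internally_measurable set0.
Proof. by exists (fun n => set0) => //; rewrite internal0. Qed.

HB.instance Definition _ := @isAlgebraOfSets.Build default_measure_display ultraproduct
  internally_measurable internally_measurable0 internally_measurableU internally_measurableC.

Lemma internal_measurable A : (forall n, measurable (A n)) ->
  measurable (internal A : set ultraproduct).
Proof. by move=> mA; exists A. Qed.

(** An internal set comes from many sequences of sets, any two of which agree at almost every index.
    Fixing one of them makes [premeasure] a function of the set alone; [premeasureE] shows that the
    choice does not matter. *)
Definition representative (B : set ultraproduct) : forall n, set (mm_car (X n)) :=
  xget (fun n => set0) [set A | (forall n, measurable (A n)) /\ B = internal A].

Arguments representative : clear implicits.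

Lemma representative_measurable B n : measurable (representative B n).
Proof. by rewrite /representative; case: xgetP => [A _ []|]. Qed.

Lemma representativeK B : measurable B -> internal (representative B) = B.
Proof. by move=> [A mA BA]; rewrite /representative; case: xgetP => [A' _ []|/(_ A)[]]. Qed.

Definition premeasure (B : set ultraproduct) : R :=
  hlim (fun n => pr (mm_mu (X n)) (representative B n)).

Lemma premeasureE (A : forall n, set (mm_car (X n))) : (forall n, measurable (A n)) ->
  forall e : R, 0 < e ->
  \forall n \near hyper, `|pr (mm_mu (X n)) (A n) - premeasure (internal A)| < e.
Proof.
move=> mA e e0.
have /internal_eq := representativeK (internal_measurable mA).
set r := representative _ => rA.
have rb n : 0 <= pr (mm_mu (X n)) (r n) <= 1.
  by rewrite pr_ge0 pr_le1//; exact: representative_measurable.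
by apply: filterS2 rA (hlimP rb e0) => n ->.
Qed.

Lemma premeasure_ge0 B : 0 <= premeasure B.
Proof.
have rb n : 0 <= pr (mm_mu (X n)) (representative B n) <= 1.
  by rewrite pr_ge0 pr_le1//; exact: representative_measurable.
apply: (@le_hlim (fun=> 0) (fun n => pr (mm_mu (X n)) (representative B n))).
- by move=> e e0; apply: filterE => n; rewrite subrr normr0.
- exact: (hlimP rb).
- by apply: filterE => n; exact: pr_ge0.
Qed.

Lemma premeasureU B B' : measurable B -> measurable B' -> B `&` B' = set0 ->
  premeasure (B `|` B') = premeasure B + premeasure B'.
Proof.
move=> [A mA ->] [A' mA' ->]; rewrite -internalI -internalU -internal0 => /internal_eq AA'.
have mU n : measurable (A n `|` A' n) by exact: measurableU.
apply: (@hlim_unique (fun n => pr (mm_mu (X n)) (A n `|` A' n))).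
  exact: premeasureE.
move=> e e0; have e20 : 0 < e / 2 by rewrite divr_gt0.
have := hyper_and (premeasureE mA e20) (premeasureE mA' e20).
apply: filterS2 AA' => n AA'; rewrite prU//.
by rewrite !ltr_norml => -[/andP[? ?] /andP[? ?]]; apply/andP; split; lra.
Qed.

Lemma premeasure0 : premeasure set0 = 0.
Proof.
have := @premeasureU set0 set0 measurable0 measurable0 (setI0 _).
by rewrite setU0 -[X in X = _]addr0 => /addrI.
Qed.

Lemma premeasureT : premeasure setT = 1.
Proof.
rewrite -internalT; apply: (@hlim_unique (fun n => pr (mm_mu (X n)) setT)).
  exact: premeasureE.
by move=> e e0; apply: filterE => n; rewrite prT subrr normr0.
Qed.

(** Countable compactness of the algebra of internal sets: if no term were empty, saturation would
    produce a point in all of them. It is the reason why the finitely additive [premeasure] is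
    sigma-additive. *)
Lemma internal_compact (F : nat -> set ultraproduct) : (forall n, measurable (F n)) ->
  (forall n, F n.+1 `<=` F n) -> \bigcap_n F n = set0 -> exists n, F n = set0.
Proof.
move=> mF niF F0; apply: contrapT => /forallNP F0'.
have rF n := representativeK (mF n).
have niF' m n : (m <= n)%N -> F n `<=` F m.
  move=> /subnK <-; elim: (n - m)%N => [|k IH]; first by rewrite add0n.
  by rewrite addSn => x /niF /IH.
pose Phi k n (t : mm_car (X n)) := representative (F k) n t.
have [k|x Hx] := @saturation (fun n => mm_car (X n)) Phi (fun n => point).
  have /set0P[x Fx] : F k != set0 by apply/eqP/F0'.
  apply: (@filterS _ hyper _ (fun n => forall j, (j <= k)%N -> Phi j n (x n))).
    by move=> n Hn; exists (x n).
  suff : \forall n \near hyper, forall j : 'I_k.+1, Phi j n (x n).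
    by apply: filterS => n Hn j; rewrite -ltnS => jk; exact: (Hn (Ordinal jk)).
  apply: hyper_forall_ord => j; have : F j x by apply: (niF' _ k) => //; rewrite -ltnS.
  by rewrite -rF.
have : (\bigcap_n F n) x by move=> k _; rewrite -rF; exact: Hx.
by rewrite F0.
Qed.

Definition loeb_premeasure (B : set ultraproduct) : \bar R := (premeasure B)%:E.

Lemma loeb_premeasure_sigma_additive : semi_sigma_additive loeb_premeasure.
Proof.
move=> F mF tF mU.
have mUn n : measurable (\big[setU/set0]_(i < n) F i) by exact: bigsetU_measurable.
have fin n : premeasure (\big[setU/set0]_(i < n) F i) = \sum_(0 <= i < n) premeasure (F i).
  elim: n => [|n IH]; first by rewrite big_ord0 big_geq// premeasure0.
  have := mUn n => mUn'.
  rewrite big_ord_recr/= premeasureU// ?IH ?big_nat_recr//=.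
  apply/seteqP; split=> // x; rewrite -bigcup_mkord => -[[j /= jn Fj] Fn].
  by have := tF j n I I (ex_intro _ x (conj Fj Fn)) => jn'; rewrite jn' ltnn in jn.
(* The remainders of the union decrease to the empty set, so one of them is empty: a disjoint
   sequence of internal sets with internal union has only finitely many nonempty terms. *)
have [|||N HN] := @internal_compact (fun n => \bigcup_n F n `\` \big[setU/set0]_(i < n) F i).
- by move=> n; exact: measurableD.
- by move=> n; apply: setDS; rewrite big_ord_recr/=; exact: subsetUl.
- apply/seteqP; split=> // x H; have [[k _ Fk] _] := H 0%N I.
  by have [_] := H k.+1 I; apply; rewrite -bigcup_mkord; exists k => /=.
have HN' n : (N <= n)%N -> \big[setU/set0]_(i < n) F i = \bigcup_n F n.
  move=> Nn; apply/seteqP; split; first exact: bigsetU_bigcup.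
  move=> x Ux; have : (\big[setU/set0]_(i < N) F i) x.
    by apply: contrapT => nx; have : set0 x by rewrite -HN.
  exact: subset_bigsetU.
apply: cvg_near_cst; exists N => // n Nn /=.
by rewrite /loeb_premeasure sumEFin -fin HN'.
Qed.

HB.instance Definition _ := isMeasure.Build _ ultraproduct R loeb_premeasure
  (congr1 EFin premeasure0) (fun B => premeasure_ge0 B) loeb_premeasure_sigma_additive.

End Loeb.

Section LoebMeasure.
Variable X : nat -> mmspace.

Definition loeb_display : measure_display := sigma_display (@measurable _ (ultraproduct X)).

Definition loeb : measurableType loeb_display :=
  g_sigma_algebraType (@measurable _ (ultraproduct X)).

Definition loeb_mu : set loeb -> \bar R := measure_extension (@loeb_premeasure X).

HB.instance Definition _ := Measure.on loeb_mu.

Lemma loeb_mu_internal (A : set (ultraproduct X)) : measurable A ->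
  loeb_mu A = (premeasure A)%:E.
Proof. by move=> mA; rewrite /loeb_mu /measure_extension measurable_mu_extE. Qed.

Let loeb_muT : loeb_mu setT = 1%E.
Proof. by rewrite loeb_mu_internal// premeasureT. Qed.

HB.instance Definition _ := Measure_isProbability.Build _ loeb R loeb_mu loeb_muT.

Definition loeb_prob : probability loeb R := loeb_mu.

Lemma measurable_internal (A : forall n, set (mm_car (X n))) :
  (forall n, measurable (A n)) -> measurable (internal A : set loeb).
Proof. by move=> mA; apply: sub_sigma_algebra; exact: internal_measurable. Qed.

Lemma loeb_internal (A : forall n, set (mm_car (X n))) : (forall n, measurable (A n)) ->
  forall e : R, 0 < e ->
  \forall n \near hyper, `|pr (mm_mu (X n)) (A n) - pr loeb_prob (internal A)| < e.
Proof.
move=> mA e e0; have -> : pr loeb_prob (internal A) = premeasure (internal A).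
  by rewrite /pr /= loeb_mu_internal//; exact: internal_measurable.
exact: premeasureE.
Qed.

(** A countable intersection of internal sets is in general not internal. Saturation, applied to
    measurable subsets of [A k n] of mass above [g - eps k], gives one internal subset that loses no
    mass. *)
Lemma internal_bigcap (A : nat -> forall n, set (mm_car (X n))) :
  (forall k n, measurable (A k n)) ->
  exists J, [/\ forall n, measurable (J n), forall k, internal J `<=` internal (A k) &
    pr loeb_prob (internal J) = pr loeb_prob (\bigcap_k internal (A k))].
Proof.
move=> mA; set g := pr loeb_prob _.
pose Phi k n (t : set (mm_car (X n))) :=
  [/\ measurable t, t `<=` A k n & g - eps k < pr (mm_mu (X n)) t].
pose B k n := \bigcap_(j < k.+1) A j n.
have mB k n : measurable (B k n).
  by apply: bigcap_measurable => [|j _]; [exists 0%N|exact: mA].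
have BE k : \bigcap_k internal (A k) `<=` internal (B k).
  move=> x Hx; rewrite /internal/=.
  suff : \forall n \near hyper, forall j : 'I_k.+1, A j n (x n).
    by apply: filterS => n Hn j /= jk; exact: (Hn (Ordinal jk)).
  by apply: hyper_forall_ord => j; exact: Hx.
have mcap : measurable (\bigcap_k internal (A k) : set loeb).
  by apply: bigcapT_measurable => k; exact: measurable_internal.
have [k|J HJ] := @saturation (fun n => set (mm_car (X n))) Phi (fun n => set0).
  apply: filterS (loeb_internal (mB k) (eps_gt0 k)) => n Hn; exists (B k n) => j jk; split=> //.
    by move=> x; apply; rewrite /= ltnS.
  have : g <= pr loeb_prob (internal (B k)).
    by apply: le_pr => //; exact: measurable_internal.
  by move: Hn (le_eps jk); rewrite ltr_norml => /andP[? ?]; lra.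
(* Saturation yields measurability at almost every index only. Putting the empty set elsewhere does
   not change the internal set. *)
pose J' n := if `[< measurable (J n) >] then J n else set0.
have mJ' n : measurable (J' n) by rewrite /J'; case: ifP => // /asboolP.
have JJ' : \forall n \near hyper, J' n = J n.
  by apply: filterS (HJ 0%N) => n [mJ _ _]; rewrite /J' asboolT.
exists J'; split => // [k|].
  apply/internal_subP; apply: filterS2 JJ' (HJ k) => n -> [] //.
apply/eqP; rewrite eq_le; apply/andP; split.
  apply: le_pr => //; first exact: measurable_internal.
  move=> x Jx k _; have /internal_subP : \forall n \near hyper, J' n `<=` A k n.
    by apply: filterS2 JJ' (HJ k) => n -> [].
  exact.
apply/ler_addgt0Pr => e e0.
have e20 : 0 < e / 2 by rewrite divr_gt0.
have [k /(_ k (leqnn k)) Hk] := eps_small e20.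
have [n [h1 [[_ _ h2] h3]]] :=
  hyper_ex (hyper_and JJ' (hyper_and (HJ k) (loeb_internal mJ' e20))).
move: h2 h3 Hk; rewrite h1 /= ltr_norml => ? /andP[? ?] ?; rewrite -/g; lra.
Qed.

(** The outer measure covers the complement of [E] by countably many internal sets of nearly the
    same total mass. The complement of this cover is a countable intersection of internal sets
    inside [E], to which [internal_bigcap] applies. *)
Lemma loeb_inner (E : set loeb) : measurable E -> forall e : R, 0 < e ->
  exists J : forall n, set (mm_car (X n)), [/\ forall n, measurable (J n), internal J `<=` E &
    pr loeb_prob E - pr loeb_prob (internal J) < e].
Proof.
move=> mE e e0; have mCE : measurable (~` E) by exact: measurableC.
have fin : mu_ext (@loeb_premeasure X) (~` E) \is a fin_num.
  rewrite -[mu_ext _ _]/(loeb_prob (~` E)) prE//.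
have [_ [F [mF CEF] <-] HF] := lb_ereal_inf_adherent e0 fin.
pose A k : forall n, set (mm_car (X n)) := representative (F k).
have FA k : F k = internal (A k) by rewrite representativeK.
have [k n|J [mJ JA prJ]] := @internal_bigcap (fun k n => ~` A k n).
  by apply: measurableC; exact: representative_measurable.
have JE : \bigcap_k internal (fun n => ~` A k n) = ~` \bigcup_k (F k).
  by rewrite setC_bigcup; apply: eq_bigcapr => k _; rewrite internalC -FA.
have mU : measurable (\bigcup_k F k : set loeb).
  by apply: bigcupT_measurable => k; exact: sub_sigma_algebra.
exists J; split => //.
  move=> x Jx; apply: contrapT => /CEF.
  have : (\bigcap_k internal (fun n => ~` A k n)) x by move=> k _; exact: JA.
  by rewrite JE.
rewrite prJ JE prC//.
have : (loeb_prob (\bigcup_k F k) <= \sum_(k <oo) loeb_premeasure (F k))%E.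
  apply: le_trans (_ : \sum_(k <oo) loeb_prob (F k) <= _)%E.
    by apply: measure_sigma_subadditive => // k; exact: sub_sigma_algebra.
  by apply: lee_nneseries => [k _ _|k _] //; rewrite /= loeb_mu_internal.
move=> /le_lt_trans/(_ HF); rewrite -[X in (_ < X + _)%E]/(loeb_prob (~` E)) !prE//.
rewrite -EFinD lte_fin prC//; lra.
Qed.

(** By saturation some internal set lies between the internal sets [J k] that exhaust [E] from
    inside and the complements of the [K k] that exhaust the complement of [E]. *)
Lemma loeb_internal_ae (E : set loeb) : measurable E ->
  exists C : forall n, set (mm_car (X n)), [/\ forall n, measurable (C n),
    pr loeb_prob (E `\` internal C) = 0 & pr loeb_prob (internal C `\` E) = 0].
Proof.
move=> mE; have mCE : measurable (~` E) by exact: measurableC.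
pose J k := projT1 (cid (loeb_inner mE (eps_gt0 k))).
have [mJ JE prJ] : [/\ forall k n, measurable (J k n), forall k, internal (J k) `<=` E &
    forall k, pr loeb_prob E - pr loeb_prob (internal (J k)) < eps k].
  by split=> k; have [] := projT2 (cid (loeb_inner mE (eps_gt0 k))).
pose K k := projT1 (cid (loeb_inner mCE (eps_gt0 k))).
have [mK KE prK] : [/\ forall k n, measurable (K k n), forall k, internal (K k) `<=` ~` E &
    forall k, pr loeb_prob (~` E) - pr loeb_prob (internal (K k)) < eps k].
  by split=> k; have [] := projT2 (cid (loeb_inner mCE (eps_gt0 k))).
pose Phi k n (t : set (mm_car (X n))) := [/\ measurable t, J k n `<=` t & t `<=` ~` K k n].
have [k|C HC] := @saturation (fun n => set (mm_car (X n))) Phi (fun n => set0).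
  have : \forall n \near hyper, forall (i j : 'I_k.+1), J i n `<=` ~` K j n.
    apply: hyper_forall_ord => i; apply: hyper_forall_ord => j.
    by apply/internal_subP; rewrite internalC => x /JE Ex /KE.
  apply: filterS => n Hn; exists (\bigcup_(j < k.+1) J j n) => i ik; split.
  - by apply: bigcup_measurable => j _; exact: mJ.
  - by move=> x Jx; exists i.
  - by move=> x [j /= jk Jx]; exact: (Hn (Ordinal jk) (Ordinal (ik : (i < k.+1)%N))).
pose C' n := if `[< measurable (C n) >] then C n else set0.
have mC' n : measurable (C' n) by rewrite /C'; case: ifP => // /asboolP.
have CC' : \forall n \near hyper, C' n = C n.
  by apply: filterS (HC 0%N) => n [mJ' _ _]; rewrite /C' asboolT.
have JC k : internal (J k) `<=` internal C'.
  by apply/internal_subP; apply: filterS2 CC' (HC k) => n -> [].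
have CK k : internal C' `<=` ~` internal (K k).
  by rewrite -internalC; apply/internal_subP; apply: filterS2 CC' (HC k) => n -> [].
have mIC : measurable (internal C' : set loeb) by exact: measurable_internal.
have small (A : set loeb) : measurable A ->
    (forall k, pr loeb_prob A <= eps k) -> pr loeb_prob A = 0.
  by move=> mA H; apply/eqP; rewrite eq_le pr_ge0 andbT le_eps0.
exists C'; split => //; apply: small; try exact: measurableD; move=> k.
  apply: le_trans (ltW (prJ k)); rewrite -pr_subD//; last exact: measurable_internal.
  apply: le_pr; [exact: measurableD|apply: measurableD => //; exact: measurable_internal|].
  by apply: setDS; exact: JC.
apply: le_trans (ltW (prK k)); rewrite -pr_subD//; last exact: measurable_internal.
apply: le_pr; [exact: measurableD|apply: measurableD => //; exact: measurable_internal|].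
by move=> x [Cx nEx]; split => //; exact: (CK k).
Qed.

End LoebMeasure.

(** * Metric and mm-spaces *)

(** Dynkin's pi-lambda argument for the restriction of [P] to [C]. The restriction is not
    normalized, and the factor [c] stands for its mass. *)
Lemma law_unique d1 d2 (T : measurableType d1) (S : measurableType d2)
    (P : probability T R) (Q : probability S R) (C : set T) (F : T -> S) (c : R)
    (G : set (set S)) :
  measurable C -> (forall B, measurable B -> measurable (F @^-1` B)) ->
  measurable = <<s G >> -> setI_closed G -> G setT ->
  (forall U, G U -> pr P (C `&` F @^-1` U) = c * pr Q U) ->
  forall B, measurable B -> pr P (C `&` F @^-1` B) = c * pr Q B.
Proof.
move=> mC mF mG GI GT H.
have mCF B : measurable B -> measurable (C `&` F @^-1` B).
  by move=> mB; apply: measurableI => //; exact: mF.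
suff : <<s G >> `<=` [set B | measurable B /\ pr P (C `&` F @^-1` B) = c * pr Q B].
  by rewrite -mG => sub B /sub[].
apply: lambda_system_subset => //; last first.
  by move=> U GU; split; [rewrite mG; exact: sub_sigma_algebra|exact: H].
split => //; first by split => //; exact: H.
- move=> A B BA [mA hA] [mB hB]; split; first exact: measurableD.
  rewrite (_ : F @^-1` (A `\` B) = F @^-1` A `\` F @^-1` B)// setDE setIA -setDE prD; [|exact: mCF|exact: mF].
  have -> : (C `&` F @^-1` A) `&` F @^-1` B = C `&` F @^-1` B.
    by rewrite -setIA (setIidr (preimage_subset BA)).
  by rewrite hA hB pr_subD// mulrBr.
- move=> A ndA HA.
  have mA n : measurable (A n) := (HA n).1.
  have mU : measurable (\bigcup_n A n) by exact: bigcupT_measurable.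
  split => //; rewrite preimage_bigcup setI_bigcupr.
  have ndA' m n : (m <= n)%N -> A m `<=` A n by move=> mn; apply/subsetPset/ndA.
  have ndCF m n : (m <= n)%N -> C `&` F @^-1` A m `<=` C `&` F @^-1` A n.
    by move=> /ndA' mn; apply: setIS; exact: preimage_subset.
  have h1 := @pr_cvg_up _ _ P (fun n => C `&` F @^-1` A n) (fun n => mCF _ (mA n)) ndCF.
  have h2 := @pr_cvg_up _ _ Q A mA ndA'.
  set p := pr P _ in h1 *; set q := pr Q _ in h2 *.
  have pn n : c * pr Q (A n) <= p.
    rewrite -(HA n).2; apply: le_pr; [exact: mCF|by apply: bigcupT_measurable => k; exact: mCF|].
    by apply: (bigcup_sup (i := n)).
  have qn n : pr Q (A n) <= q by apply: le_pr => //; exact: bigcup_sup.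
  have close e : 0 < e -> exists n, p - e < c * pr Q (A n) /\ q - e < pr Q (A n).
    move=> e0; have [N1 H1] := h1 e e0; have [N2 H2] := h2 e e0.
    exists (maxn N1 N2); split; last by apply: H2; rewrite leq_maxr.
    by rewrite -(HA _).2; apply: H1; rewrite leq_maxl.
  apply/eqP; rewrite -subr_eq0 -normr_le0; apply/ler_addgt0Pr => e e0; rewrite add0r.
  have c1 : 0 < 1 + `|c| by rewrite ltr_pwDl.
  have [n [n1 n2]] := close (e / (1 + `|c|)) (divr_gt0 e0 c1).
  have := pn n; have := qn n; set x := pr Q (A n) in n1 n2 * => qx px.
  have h3 : `|c * x - c * q| <= `|c| * (e / (1 + `|c|)).
    by rewrite -mulrBr normrM ler_wpM2l// ler_norml; apply/andP; split; lra.
  have h4 : `|p - c * x| <= e / (1 + `|c|) by rewrite ler_norml; apply/andP; split; lra.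
  apply: le_trans (_ : `|p - c * x| + `|c * x - c * q| <= _).
    by rewrite (le_trans _ (ler_normD _ _))// addrA subrK.
  apply: le_trans (lerD h4 h3) _; rewrite -[X in X + _]mul1r -mulrDl mulrC divfK// gt_eqF.
Qed.

Section Metric.
Variables (V : Type) (d : V -> V -> R).
Hypothesis hd : is_metric d.

Lemma met_xx x : d x x = 0.
Proof. by case: hd => /(_ x x)[_ ->]. Qed.

Lemma met_sym x y : d x y = d y x.
Proof. by case: hd. Qed.

Lemma met_tri y x z : d x z <= d x y + d y z.
Proof. by case: hd. Qed.

Lemma met_ge0 x y : 0 <= d x y.
Proof. by have := met_tri y x x; rewrite met_xx (met_sym y x); lra. Qed.

Lemma met_dist x y z : `|d x z - d y z| <= d x y.
Proof.
rewrite ler_norml; have := met_tri y x z; have := met_tri x y z.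
by rewrite (met_sym y x) => ? ?; apply/andP; split; lra.
Qed.

Lemma dopen_dball x e : dopen d (dball d x e).
Proof.
move=> y /= xy; exists (e - d x y); first by rewrite subr_gt0.
by move=> z; rewrite /dball/= => yz; have := met_tri y x z; lra.
Qed.

Lemma dopenT : dopen d setT.
Proof. by move=> x _; exists 1. Qed.

Lemma dopenI U U' : dopen d U -> dopen d U' -> dopen d (U `&` U').
Proof.
move=> oU oU' x [/oU[e e0 He] /oU'[e' e'0 He']]; exists (Num.min e e').
  by rewrite lt_min e0.
by move=> y; rewrite /dball/= lt_min => /andP[h h']; split; [exact: He|exact: He'].
Qed.

Lemma dopen_bigcup (I : Type) (D : set I) (U : I -> set V) :
  (forall i, dopen d (U i)) -> dopen d (\bigcup_(i in D) U i).
Proof.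
move=> oU x [i Di /oU[e e0 He]]; exists e => //.
by apply: subset_trans He _ => y; exists i.
Qed.

Variable s : nat -> V.
Hypothesis dense_s : forall (x : V) (e : R), 0 < e -> exists n : nat, d x (s n) < e.

Lemma dopen_as_balls U : dopen d U -> U = \bigcup_n \bigcup_k
  (if `[< dball d (s n) (eps k) `<=` U >] then dball d (s n) (eps k) else set0).
Proof.
move=> oU; apply/seteqP; split=> [x Ux|x [n _ [k _]]]; last first.
  by case: ifP => // /asboolP; apply.
have [e e0 He] := oU x Ux.
have e20 : 0 < e / 2 by rewrite divr_gt0.
have [k /(_ k (leqnn k)) ke] := eps_small e20.
have [n xn] := dense_s x (eps_gt0 k).
exists n => //; exists k => //; rewrite asboolT.
  by rewrite /dball/= met_sym.
move=> y; rewrite /dball/= => ny; apply: He; rewrite /dball/=.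
by have := met_tri (s n) x y; lra.
Qed.

Lemma measurable_preimage_dopen disp (T : measurableType disp) (f : T -> V) :
  (forall n k, measurable (f @^-1` dball d (s n) (eps k))) ->
  forall U, dopen d U -> measurable (f @^-1` U).
Proof.
move=> mf U /dopen_as_balls ->; rewrite preimage_bigcup; apply: bigcupT_measurable => n.
rewrite preimage_bigcup; apply: bigcupT_measurable => k.
by case: ifP => // _; rewrite preimage_set0.
Qed.

End Metric.

Section MmSpace.
Variable Y : mmspace.
Local Notation d := (@mm_dist Y).

Lemma mm_xx x : d x x = 0. Proof. exact: (met_xx (mm_metric Y)). Qed.
Lemma mm_sym x y : d x y = d y x. Proof. exact: (met_sym (mm_metric Y)). Qed.
Lemma mm_tri y x z : d x z <= d x y + d y z. Proof. exact: (met_tri (mm_metric Y)). Qed.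
Lemma mm_tri_l y x z : d x z <= d y x + d y z.
Proof. by rewrite (mm_sym y x); exact: mm_tri. Qed.
Lemma mm_tri_r y x z : d x z <= d x y + d z y.
Proof. by rewrite (mm_sym z y); exact: mm_tri. Qed.
Lemma mm_tri_lr y x z : d x z <= d y x + d z y.
Proof. by rewrite (mm_sym y x) (mm_sym z y); exact: mm_tri. Qed.
Lemma mm_ge0 x y : 0 <= d x y. Proof. exact: (met_ge0 (mm_metric Y)). Qed.

Lemma measurable_dopen U : dopen d U -> measurable U.
Proof. by move=> oU; rewrite mm_borel; exact: sub_sigma_algebra. Qed.

Lemma measurable_dball x e : measurable (dball d x e).
Proof. by apply/measurable_dopen/dopen_dball; exact: mm_metric. Qed.

Definition mm_dense : nat -> mm_car Y := projT1 (cid (mm_separable Y)).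

Lemma mm_denseP x (e : R) : 0 < e -> exists n, d x (mm_dense n) < e.
Proof. exact: (projT2 (cid (mm_separable Y))). Qed.

Lemma measurable_into_dopen disp (T : measurableType disp) (f : T -> mm_car Y) :
  (forall U, dopen d U -> measurable (f @^-1` U)) ->
  forall B, measurable B -> measurable (f @^-1` B).
Proof.
move=> mf B mB; rewrite -[X in measurable X]setTI.
apply: (@measurability _ _ _ _ _ _ (dopen d)) => //; first exact: mm_borel.
by move=> _ [U oU <-]; rewrite setTI; exact: mf.
Qed.

Lemma measurable_into disp (T : measurableType disp) (f : T -> mm_car Y) :
  (forall y e, measurable (f @^-1` dball d y e)) ->
  forall B, measurable B -> measurable (f @^-1` B).
Proof.
move=> mf; apply: measurable_into_dopen => U.
by apply: (measurable_preimage_dopen (mm_metric Y) mm_denseP) => n k; exact: mf.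
Qed.

Definition thicken (K : set (mm_car Y)) (e : R) : set (mm_car Y) :=
  \bigcup_(y in K) dball d y e.

Lemma dopen_thicken K e : dopen d (thicken K e).
Proof. by apply: dopen_bigcup => y; apply: dopen_dball; exact: mm_metric. Qed.

Lemma measurable_thicken K e : measurable (thicken K e).
Proof. exact/measurable_dopen/dopen_thicken. Qed.

Lemma thicken_thicken K e e' : thicken (thicken K e) e' `<=` thicken K (e + e').
Proof.
move=> z [y [x Kx xy] yz]; exists x => //; move: xy yz; rewrite /dball/=.
by have := mm_tri y x z; lra.
Qed.

Lemma bigcap_thicken K : dopen d (~` K) -> \bigcap_k thicken K (eps k) = K.
Proof.
move=> cK; apply/seteqP; split=> x Hx; last first.
  by move=> k _; exists x => //; rewrite /dball/= mm_xx eps_gt0.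
apply: contrapT => /cK[e e0 He]; have [k /(_ k (leqnn k)) ke] := eps_small e0.
have [y Ky] := Hx k I; rewrite /dball/= => yx; have : (~` K) y; last exact.
by apply: He; rewrite /dball/= mm_sym; lra.
Qed.

Lemma law_unique_dopen disp (T : measurableType disp) (P : probability T R)
    (C : set T) (F : T -> mm_car Y) (c : R) :
  measurable C -> (forall B, measurable B -> measurable (F @^-1` B)) ->
  (forall U, dopen d U -> pr P (C `&` F @^-1` U) = c * pr (mm_mu Y) U) ->
  forall B, measurable B -> pr P (C `&` F @^-1` B) = c * pr (mm_mu Y) B.
Proof.
move=> mC mF H.
apply: (law_unique mC mF (@mm_borel Y)) => //; last exact: dopenT.
exact: dopenI.
Qed.

(** Upper bounds on closed sets suffice. Passing to complements gives lower bounds on open sets,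
    because the total masses agree; and an open set is the increasing union of the closed sets
    [K k], which gives the upper bound there. *)
Lemma law_unique_closed disp (T : measurableType disp) (P : probability T R)
    (C : set T) (F : T -> mm_car Y) :
  measurable C -> (forall B, measurable B -> measurable (F @^-1` B)) ->
  (forall K, dopen d (~` K) -> pr P (C `&` F @^-1` K) <= pr P C * pr (mm_mu Y) K) ->
  forall B, measurable B -> pr P (C `&` F @^-1` B) = pr P C * pr (mm_mu Y) B.
Proof.
move=> mC mF H; apply: law_unique_dopen => // U oU.
have mU := measurable_dopen oU.
have mCF B : measurable B -> measurable (C `&` F @^-1` B).
  by move=> mB; apply: measurableI => //; exact: mF.
apply/eqP; rewrite eq_le; apply/andP; split; last first.
  have := H (~` U); rewrite setCK => /(_ oU); rewrite prC//.
  rewrite preimage_setC -setDE prD//; last exact: mF.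
  lra.
pose K k := ~` thicken (~` U) (eps k).
have cK k : dopen d (~` K k) by rewrite setCK; exact: dopen_thicken.
have mK k : measurable (K k) by rewrite -[K k]setCK; apply/measurableC/measurable_dopen/cK.
have UK : \bigcup_k K k = U.
  by rewrite -[LHS]setCK setC_bigcup -[RHS]setCK; congr (~` _);
    rewrite -[RHS]bigcap_thicken ?setCK//; apply: eq_bigcapr => k _; rewrite setCK.
have KU k : K k `<=` U by rewrite -UK; exact: bigcup_sup.
apply/ler_addgt0Pr => e e0.
have [||N /(_ N (leqnn N))] := @pr_cvg_up _ _ P (fun k => C `&` F @^-1` K k) _ _ e e0.
- by move=> k; exact: mCF.
- move=> m n mn; apply: setIS => x /= Kx [y Uy yx]; apply: Kx; exists y => //.
  by move: yx; rewrite /dball/= => /lt_le_trans; apply; exact: le_eps.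
rewrite -setI_bigcupr -preimage_bigcup UK => h.
have h2 : pr P C * pr (mm_mu Y) (K N) <= pr P C * pr (mm_mu Y) U.
  by apply: ler_wpM2l; [exact: pr_ge0|exact: le_pr].
have := H _ (cK N); lra.
Qed.

End MmSpace.

(** * The pyramid of images of an ultraproduct *)

Section Cells.
Variable Y : mmspace.
Local Notation d := (@mm_dist Y).
Local Notation s := (mm_dense Y).

(** Balls around the dense sequence made disjoint. For positive [e] they partition the space, and
    finitely many of them carry nearly all of its mass ([cells_tight]). *)
Definition cell (e : R) (j : nat) : set (mm_car Y) :=
  dball d (s j) e `\` \bigcup_(i < j) dball d (s i) e.

Lemma measurable_cell e j : measurable (cell e j).
Proof.
apply: measurableD; first exact: measurable_dball.
by apply: bigcup_measurable => i _; exact: measurable_dball.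
Qed.

Lemma cell_dist e j y : cell e j y -> d (s j) y < e.
Proof. by case. Qed.

Lemma cell_inj e i j y : cell e i y -> cell e j y -> i = j.
Proof.
move=> [iy ni] [jy nj]; case: (ltngtP i j) => // ij; exfalso.
  by apply: nj; exists i.
by apply: ni; exists j.
Qed.

Lemma bigcup_cell e M : \bigcup_(j < M) cell e j = \bigcup_(j < M) dball d (s j) e.
Proof.
apply/seteqP; split=> [y [j jM [jy _]]|y [j jM jy]]; first by exists j.
have : exists i, `[< dball d (s i) e y >] by exists j; exact/asboolP.
move=> /ex_minnP[i /asboolP iy Hi]; exists i => /=.
  by rewrite (leq_ltn_trans _ jM)// Hi//; exact/asboolP.
split => // -[l /= li ly]; have := Hi l; rewrite asboolT// => /(_ isT).
by rewrite leqNgt li.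
Qed.

Lemma cell_cover e y : 0 < e -> exists j, cell e j y.
Proof.
move=> e0; have [j yj] := mm_denseP y e0.
have : (\bigcup_(j < j.+1) cell e j) y.
  by rewrite bigcup_cell; exists j => //=; rewrite /dball/= mm_sym.
by move=> [i _]; exists i.
Qed.

Lemma measurable_cells e M : measurable (\bigcup_(j < M) cell e j).
Proof. by apply: bigcup_measurable => j _; exact: measurable_cell. Qed.

Lemma cells_tight (e t : R) : 0 < e -> 0 < t ->
  exists M, 1 - t < pr (mm_mu Y) (\bigcup_(j < M) cell e j).
Proof.
move=> e0 t0.
have nd m n : (m <= n)%N -> \bigcup_(j < m) cell e j `<=` \bigcup_(j < n) cell e j.
  by move=> mn y [j /= jm cj]; exists j => //=; exact: leq_trans jm mn.
have [M /(_ M (leqnn M))] := pr_cvg_up (mm_mu Y) (measurable_cells e) nd t0.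
have -> : \bigcup_M \bigcup_(j < M) cell e j = setT.
  apply/seteqP; split=> // y _; have [j yj] := cell_cover y e0.
  by exists j.+1 => //; exists j => /=.
by rewrite prT; exists M.
Qed.

End Cells.

Section Pyramid.
Variable X : nat -> mmspace.
Local Notation L := (loeb X).
Local Notation lam := (loeb_prob X).

(* [far r x y] says that the ultralimit of the distances is at least [r]. *)
Definition far (r : R) (x y : L) : Prop :=
  \forall n \near hyper, r <= mm_dist (x n) (y n).

(** The third condition says that [F] is 1-Lipschitz off [N] for the ultralimit distance;
    quantifying over all [r] below [mm_dist (F x) (F y)] avoids introducing this possibly infinite
    distance. The law is not divided by the mass of [C], so that a null [C] makes sense too. *)
Definition pyr (C : set L) (Y : mmspace) : Prop :=
  exists (F : L -> mm_car Y) (N : set L), [/\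
    forall B, measurable B -> measurable (F @^-1` B),
    measurable N /\ pr lam N = 0,
    (forall x y, (C `\` N) x -> (C `\` N) y ->
      forall r, r < mm_dist (F x) (F y) -> far r x y) &
    forall B, measurable B -> pr lam (C `&` F @^-1` B) = pr lam C * pr (mm_mu Y) B].

Lemma far_sym r x y : far r x y -> far r y x.
Proof. by rewrite /far; apply: filterS => n; rewrite mm_sym. Qed.

Lemma far_le r r' x y : r' <= r -> far r x y -> far r' x y.
Proof. by move=> rr; rewrite /far; apply: filterS => n; exact: le_trans. Qed.

Variables (Y : mmspace) (C : forall n, set (mm_car (X n))).
Arguments C : clear implicits.
Hypothesis mC : forall n, measurable (C n).
Local Notation c := (pr lam (internal C)).
Local Notation dY := (@mm_dist Y).

(** A one-sided Prokhorov-type condition. The upper bound on the law is stable under shrinking [S],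
    and together with the nearly full mass of [S] it is enough for [law_unique_closed] in the
    limit. *)
Definition approximates (e : R) n (f : mm_car (X n) -> mm_car Y) (S : set (mm_car (X n))) :=
  [/\ S `<=` C n, pr (mm_mu (X n)) (C n) - e <= pr (mm_mu (X n)) S,
    (forall x y, S x -> S y -> dY (f x) (f y) <= mm_dist x y + e) &
    (forall K, measurable K ->
      pr (mm_mu (X n)) (S `&` f @^-1` K) <= c * pr (mm_mu Y) (thicken K e) + e)].

Definition measurable_pair n (t : (mm_car (X n) -> mm_car Y) * set (mm_car (X n))) :=
  (forall B, measurable B -> measurable (t.1 @^-1` B)) /\ measurable t.2.

Lemma approximates_le e e' n f S : e' <= e -> approximates e' f S -> @approximates e n f S.
Proof.
move=> ee [SC pS Sf lf]; split => //.
- by lra.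
- by move=> x y Sx Sy; have := Sf x y Sx Sy; lra.
- move=> K mK; have := lf K mK.
  have : c * pr (mm_mu Y) (thicken K e') <= c * pr (mm_mu Y) (thicken K e).
    apply: ler_wpM2l; first exact: pr_ge0.
    apply: le_pr; [exact: measurable_thicken|exact: measurable_thicken|].
    by move=> y [z Kz zy]; exists z => //; move: zy; rewrite /dball/=; lra.
  by lra.
Qed.

Lemma saturated_approximation :
  (forall k, \forall n \near hyper, exists f S, measurable_pair (f, S) /\
     @approximates (eps k) n f S) ->
  exists (f : forall n, mm_car (X n) -> mm_car Y) (S : forall n, set (mm_car (X n))),
    [/\ forall n B, measurable B -> measurable (f n @^-1` B),
        forall n, measurable (S n) &
        forall e : R, 0 < e -> \forall n \near hyper, approximates e (f n) (S n)].
Proof.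
move=> H.
(* Measurability is part of the type, so the saturated sequence has it at every index and not merely
   at almost every one. *)
pose D n := {t : (mm_car (X n) -> mm_car Y) * set (mm_car (X n)) | measurable_pair t}.
have mdef n : measurable_pair ((fun _ : mm_car (X n) => mm_dense Y 0), set0).
  by split => //= B mB; rewrite preimage_cst; case: ifP.
pose Phi k n (t : D n) := approximates (eps k) (sval t).1 (sval t).2.
have [k|t Ht] := @saturation D Phi (fun n => exist _ _ (mdef n)).
  apply: filterS (H k) => n [f [S [mfS af]]]; exists (exist _ _ mfS) => j jk.
  by apply: approximates_le af; exact: le_eps.
exists (fun n => (sval (t n)).1), (fun n => (sval (t n)).2); split.
- by move=> n; have [] := svalP (t n).
- by move=> n; have [] := svalP (t n).
- move=> e /eps_small[k /(_ k (leqnn k)) ke]; apply: filterS (Ht k) => n.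
  by apply: approximates_le; exact: ltW.
Qed.

End Pyramid.

(** * Standard parts of internal maps *)

Section StandardPart.
Variables (X : nat -> mmspace) (Y : mmspace) (C : forall n, set (mm_car (X n))).
Arguments C : clear implicits.
Hypothesis mC : forall n, measurable (C n).
Local Notation L := (loeb X).
Local Notation lam := (loeb_prob X).
Local Notation c := (pr lam (internal C)).
Local Notation d := (@mm_dist Y).
Local Notation s := (mm_dense Y).

Variables (f : forall n, mm_car (X n) -> mm_car Y) (S : forall n, set (mm_car (X n))).
Arguments f : clear implicits.
Arguments S : clear implicits.
Hypothesis mf : forall n B, measurable B -> measurable (f n @^-1` B).
Hypothesis mS : forall n, measurable (S n).
Hypothesis fS : forall e : R, 0 < e -> \forall n \near hyper, approximates C e (f n) (S n).

(** A point is in [E k j] when its image stays, along the ultrafilter, in one fixed cell of radius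
    [eps k]. [G] is thus the set of points with nearstandard image, described by countably many
    internal sets and hence measurable. *)
Let E k j : set L := internal (fun n => S n `&` f n @^-1` cell (eps k) j).
Let G : set L := \bigcap_k \bigcup_j E k j.
Let conv (x : L) y := forall e : R, 0 < e -> \forall n \near hyper, d (f n (x n)) y < e.

Let mSf n B : measurable B -> measurable (S n `&` f n @^-1` B).
Proof. by move=> mB; apply: measurableI => //; exact: mf. Qed.

Let mE k j : measurable (E k j).
Proof. by apply: measurable_internal => n; apply: mSf; exact: measurable_cell. Qed.

Let mU k : measurable (\bigcup_j E k j).
Proof. exact: bigcupT_measurable. Qed.

Let mG : measurable G.
Proof. exact: bigcapT_measurable. Qed.

Let mIC : measurable (internal C : set L).
Proof. exact: measurable_internal. Qed.

Let GS x : G x -> \forall n \near hyper, S n (x n).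
Proof. by move=> /(_ 0%N I)[j _]; apply: filterS => n []. Qed.

Let SC : internal S `<=` internal C.
Proof. by apply/internal_subP; apply: filterS (fS ltr01) => n []. Qed.

(** With [q] half of [eps k], finitely many balls of radius [q] carry nearly all mass of [Y]. The
    complement [K] of the balls of radius [eps k] with the same centres stays disjoint from them
    after thickening by [e <= q], so the law bound leaves little mass of [S n] to be sent into
    [K]. *)
Let full k : pr lam (internal C `\` \bigcup_j E k j) = 0.
Proof.
apply/eqP; rewrite eq_le pr_ge0 andbT; apply/ler_addgt0Pr => t t0; rewrite add0r.
have [q q0 qk] := half_gt0 (eps_gt0 k).
have [t2 t20 t2t] := half_gt0 t0.
have [t' t'0 tt'] := quarter_gt0 t20.
have [M HM] := cells_tight Y q0 t'0.
pose K := ~` (\bigcup_(j < M) cell (eps k) j : set (mm_car Y)).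
have mK : measurable K by apply: measurableC; exact: measurable_cells.
pose A n := S n `&` f n @^-1` (~` K).
have mA n : measurable (A n) by apply: mSf; exact: measurableC.
have AE : internal A `<=` \bigcup_j E k j.
  move=> x Ax.
  have : \forall n \near hyper, exists2 j, (j < M)%N & (S n `&` f n @^-1` cell (eps k) j) (x n).
    by apply: filterS Ax => n [Sx]; rewrite /K setCK => -[j /= jM fj]; exists j.
  by move=> /hyper_exists_lt[j _ Hj]; exists j.
have mD : measurable (internal C `\` \bigcup_j E k j : set L) by exact: measurableD.
have mIA : measurable (internal A : set L) by exact: measurable_internal.
apply: le_trans (_ : pr lam (internal C `\` internal A) <= _).
  by apply: le_pr => //; [exact: measurableD|exact: setDS].
rewrite prD// (setIidr _); last first.
  by apply: subset_trans SC; apply/internal_subP; apply: filterE => n x [].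
have [e [e0 e1 e2]] := min_gt0 t'0 q0.
have [n [[_ pS _ lawS] [h1 h2]]] := hyper_ex (hyper_and (fS e0)
  (hyper_and (loeb_internal mC t'0) (loeb_internal mA t'0))).
have := lawS K mK.
have thK : pr (mm_mu Y) (thicken K e) <= t'.
  have : pr (mm_mu Y) (thicken K e) <= pr (mm_mu Y) (~` \bigcup_(j < M) cell q j).
    apply: le_pr; [exact: measurable_thicken|by apply: measurableC; exact: measurable_cells|].
    move=> y [z Kz zy]; rewrite bigcup_cell => -[j /= jM sy]; apply: Kz; rewrite bigcup_cell.
    exists j => //; move: zy sy; rewrite /dball/=.
    by have := mm_tri y (s j) z; rewrite (mm_sym z y); lra.
  by rewrite prC; [lra|exact: measurable_cells].
have c1 : c * pr (mm_mu Y) (thicken K e) <= t'.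
  by rewrite -[leRHS]mul1r ler_pM// ?pr_ge0// pr_le1.
have -> : pr (mm_mu (X n)) (S n `&` f n @^-1` K) = pr (mm_mu (X n)) (S n) - pr (mm_mu (X n)) (A n).
  have -> : S n `&` f n @^-1` K = S n `\` A n.
    apply/seteqP; split=> [x [Sx Kx]|x [Sx /not_andP[//|/= nK]]]; first by split => // -[].
    by split => //; apply: contrapT.
  by rewrite pr_subD// => x [].
by move: h1 h2; rewrite !ltr_norml => /andP[? ?] /andP[? ?]; lra.
Qed.

Let Gnull : pr lam (internal C `\` G) = 0.
Proof.
have -> : internal C `\` G = \bigcup_k (internal C `\` \bigcup_j E k j).
  by rewrite /G setDE setC_bigcap setI_bigcupr.
by apply: pr_bigcup_null => [k|k]; [exact: measurableD|exact: full].
Qed.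

Let Elim k j x : E k j x -> \forall n \near hyper, d (s j) (f n (x n)) < eps k.
Proof. by apply: filterS => n [_ /cell_dist]. Qed.

(** The centres of the cells that contain the image at the scales [eps k] form a Cauchy sequence;
    its limit is the standard part. *)
Let conv_ex x : G x -> exists y, conv x y.
Proof.
move=> Gx; have /choice[j Ej] : forall k, exists j, E k j x by
  move=> k; have [j _] := Gx k I; exists j.
have Hj k := Elim (Ej k).
have jj k l : d (s (j k)) (s (j l)) < eps k + eps l.
  have [n [h1 h2]] := hyper_ex (hyper_and (Hj k) (Hj l)).
  by have := mm_tri (f n (x n)) (s (j k)) (s (j l)); rewrite (mm_sym (f n (x n))); lra.
have [e e0|y Hy] := @mm_complete Y (fun k => s (j k)).
  have [q q0 qe] := half_gt0 e0; have [N HN] := eps_small q0.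
  by exists N => m n Nm Nn; have := jj m n; have := HN m Nm; have := HN n Nn; lra.
exists y => e e0; have [q q0 qe] := half_gt0 e0.
have [N HN] := Hy _ q0; have [N' HN'] := eps_small q0.
have /= h1 := HN (maxn N N') (leq_maxl _ _); have h2 := HN' (maxn N N') (leq_maxr _ _).
apply: filterS (Hj (maxn N N')) => n.
by have := mm_tri_l (s (j (maxn N N'))) (f n (x n)) y; lra.
Qed.

Let F (x : L) : mm_car Y :=
  if pselect (G x) is left Gx then projT1 (cid (conv_ex Gx)) else s 0.

Let F_conv x : G x -> conv x (F x).
Proof. by rewrite /F; case: pselect => // Gx _; exact: (projT2 (cid (conv_ex Gx))). Qed.

Let F_out x : ~ G x -> F x = s 0.
Proof. by rewrite /F; case: pselect. Qed.

Let F_near x k j : G x -> E k j x -> d (F x) (s j) <= eps k.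
Proof.
move=> Gx /Elim Hj; apply/ler_addgt0Pr => e e0.
have [n [h1 h2]] := hyper_ex (hyper_and Hj (F_conv Gx e0)).
by have := mm_tri_lr (f n (x n)) (F x) (s j); lra.
Qed.

Let mF B : measurable B -> measurable (F @^-1` B).
Proof.
apply: measurable_into => y r.
(* A point of [G] has its standard part in the ball exactly when some cell of radius [eps k]
   containing its image has its centre closer to [y] than [r - eps k]. The last term accounts for
   the default value of [F] off [G]. *)
have -> : F @^-1` dball d y r =
  (G `&` \bigcup_k \bigcup_(j in [set j | d y (s j) + eps k < r]) E k j) `|`
  (if d y (s 0) < r then ~` G else set0).
  apply/seteqP; split=> [x|x].
    rewrite /dball/= => yx; have [Gx|nG] := pselect (G x); [left|right]; last first.
      by move: yx; rewrite F_out// => ->.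
    split => //; have r0 : 0 < r - d y (F x) by rewrite subr_gt0.
    have [q q0 qr] := half_gt0 r0; have [k /(_ k (leqnn k)) kq] := eps_small q0.
    have [j _ Ej] := Gx k I; exists k => //; exists j => //=.
    by have := F_near Gx Ej; have := mm_tri (F x) y (s j); lra.
  move=> [[Gx [k _ [j /= yj Ej]]]|]; rewrite /dball/=.
    by have := F_near Gx Ej; have := mm_tri_r (s j) y (F x); lra.
  by case: ifP => // yr nG; rewrite F_out.
apply: measurableU; last by case: ifP => // _; exact: measurableC.
apply: measurableI => //; apply: bigcupT_measurable => k.
by apply: bigcup_measurable => j _; exact: mE.
Qed.

Let mCF B : measurable B -> measurable (internal C `&` F @^-1` B : set L).
Proof. by move=> mB; apply: measurableI => //; exact: mF. Qed.

Let lawF B : measurable B ->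
  pr lam (internal C `&` F @^-1` B) = c * pr (mm_mu Y) B.
Proof.
apply: (law_unique_closed mIC mF) => K cK.
have mK : measurable K by rewrite -[K]setCK; apply/measurableC/measurable_dopen.
pose A k n := S n `&` f n @^-1` thicken K (eps k).
have mA k n : measurable (A k n) by apply: mSf; exact: measurable_thicken.
have c0 : 0 <= c by exact: pr_ge0.
have c1 : c <= 1 by exact: pr_le1.
have le1 k : pr lam (internal C `&` F @^-1` K) <= pr lam (internal (A k)).
  apply: (@pr_eqD _ _ lam _ _ (internal C `\` G : set L)) => //; [exact: mCF|exact: measurable_internal|exact: measurableD|].
  move=> x [[Cx Kx] nCG]; have Gx : G x by apply: contrapT => nG; apply: nCG.
  rewrite /internal/=; apply: filterS2 (GS Gx) (F_conv Gx (eps_gt0 k)) => n Sx h.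
  by split => //; exists (F x) => //; rewrite /dball/= mm_sym.
(* Two thickenings: the first because a standard part in [K] only puts the image at finite index
   near [K], the second from the law bound of [approximates]. *)
have le2 k : pr lam (internal (A k)) <= c * pr (mm_mu Y) (thicken K (eps k + eps k)) + eps k.
  apply/ler_addgt0Pr => e e0.
  have [n [[_ _ _ lawS] h]] := hyper_ex (hyper_and (fS (eps_gt0 k)) (loeb_internal (mA k) e0)).
  have : pr (mm_mu (X n)) (A k n) <= _ := lawS _ (measurable_thicken K (eps k)).
  have : c * pr (mm_mu Y) (thicken (thicken K (eps k)) (eps k)) <=
         c * pr (mm_mu Y) (thicken K (eps k + eps k)).
    apply: ler_wpM2l => //; apply: le_pr; [exact: measurable_thicken|exact: measurable_thicken|].
    exact: thicken_thicken.
  by move: h; rewrite ltr_norml => /andP[? ?]; lra.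
apply/ler_addgt0Pr => e e0; have [q q0 qe] := half_gt0 e0.
have mth k : measurable (thicken K (eps k)) by exact: measurable_thicken.
have nith m n : (m <= n)%N -> thicken K (eps n) `<=` thicken K (eps m).
  by move=> /le_eps mn x [y Ky]; rewrite /dball/= => yx; exists y => //; rewrite /dball/=; lra.
have [N /(_ N (leqnn N))] := pr_cvg_down (mm_mu Y) mth nith q0.
rewrite bigcap_thicken// => hN.
have [r r0 rN] := half_gt0 (eps_gt0 N).
have [e' [e'0 e'r e'q]] := min_gt0 r0 q0.
have [k /(_ k (leqnn k)) kr] := eps_small e'0.
have h3 : pr (mm_mu Y) (thicken K (eps k + eps k)) <= pr (mm_mu Y) (thicken K (eps N)).
  apply: le_pr; [exact: measurable_thicken|exact: measurable_thicken|].
  by move=> x [y Ky]; rewrite /dball/= => yx; exists y => //; rewrite /dball/=; lra.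
have := le1 k; have := le2 k.
set th := pr (mm_mu Y) _ in h3 *; set mk := pr (mm_mu Y) K in hN *.
have h4 : c * th <= c * (mk + q) by apply: ler_wpM2l => //; lra.
have h5 : c * q <= q by rewrite -[leRHS]mul1r ler_wpM2r// ltW.
move: h4; rewrite mulrDr; lra.
Qed.

Lemma standard_part_pyr : pyr (internal C) Y.
Proof.
exists F, (internal C `\` G); split; [exact: mF|by split => //; exact: measurableD| |exact: lawF].
have inG x : (internal C `\` (internal C `\` G)) x -> G x.
  by move=> [Cx nCG]; apply: contrapT => nG; apply: nCG.
move=> x y /inG Gx /inG Gy r rF.
have r0 : 0 < mm_dist (F x) (F y) - r by rewrite subr_gt0.
have [q q0 qr] := quarter_gt0 r0.
have := hyper_and (hyper_and (GS Gx) (GS Gy))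
  (hyper_and (hyper_and (F_conv Gx q0) (F_conv Gy q0)) (fS q0)).
apply: filterS => n [[Sx Sy] [[hx hy] [_ _ Sf _]]].
have := Sf _ _ Sx Sy.
have := mm_tri_l (f n (x n)) (F x) (F y); have := mm_tri (f n (y n)) (f n (x n)) (F y); lra.
Qed.

End StandardPart.

Lemma standard_part (X : nat -> mmspace) (Y : mmspace) (C : forall n, set (mm_car (X n))) :
  (forall n, measurable (C n)) ->
  (forall k, \forall n \near hyper, exists f S, measurable_pair (f, S) /\
     @approximates X Y C (eps k) n f S) ->
  pyr (internal C) Y.
Proof.
move=> mC /saturated_approximation[f [S [mf mS fS]]].
exact: (@standard_part_pyr X Y C mC f S mf mS fS).
Qed.

Lemma exists_pushforward d1 d2 (T : measurableType d1) (S : measurableType d2)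
    (P : probability T R) (h : T -> S) :
  (forall B, measurable B -> measurable (h @^-1` B)) ->
  exists Q : probability S R, forall B, Q B = P (h @^-1` B).
Proof.
move=> mh; have mfh : measurable_fun setT h by move=> _ B mB; rewrite setTI; exact: mh.
pose hm : {mfun T >-> S} := HB.pack h (isMeasurableFun.Build _ _ _ _ h mfh).
by exists (distribution P hm).
Qed.

Lemma mnormalizeE d1 (T : measurableType d1) (m : {measure set T -> \bar R})
    (P : probability T R) (c : R) (A : set T) : m setT = c%:E -> 0 < c ->
  mnormalize m P A = (m A * (c^-1)%:E)%E.
Proof.
move=> mT c0; rewrite /mnormalize mT; case: ifPn => [/orP[/eqP[]|/eqP]//|_//].
by move=> c00; move: c0; rewrite c00 ltxx.
Qed.

Lemma exists_conditional d1 (T : measurableType d1) (P : probability T R) (C : set T) :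
  measurable C -> 0 < pr P C -> exists Q : probability T R,
    forall A, measurable A -> pr P (C `&` A) = pr P C * pr Q A.
Proof.
move=> mC C0; pose m : {measure set T -> \bar R} := mrestr P mC.
have mE U : m U = P (U `&` C) by [].
have mT : m setT = (pr P C)%:E by rewrite mE setTI prE.
clearbody m; exists (mnormalize m P) => A mA.
have mI : measurable (C `&` A) by exact: measurableI.
have -> : pr (mnormalize m P) A = fine (mnormalize m P A) by [].
rewrite (mnormalizeE _ _ mT C0) mE (setIC A) (prE P mI) /=.
by rewrite mulrCA divff ?mulr1// gt_eqF.
Qed.

(** * Image measures as fully supported mm-spaces *)

Section ImageSpace.
Variables (V : Type) (d : V -> V -> R) (d1 : measure_display) (T : measurableType d1)
  (P : probability T R) (G : T -> V) (s : nat -> V).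
Hypotheses (hd : is_metric d) (cd : dcomplete d)
  (sd : forall (x : V) (e : R), 0 < e -> exists n : nat, d x (s n) < e)
  (mG : forall v e, measurable (G @^-1` dball d v e)).

Let supp (v : V) := forall e : R, 0 < e -> 0 < pr P (G @^-1` dball d v e).

(** The complement of the support is covered by those balls of centre [s n] and radius [eps k] that
    are null, and these are countably many. *)
Let supp_null : measurable (G @^-1` (~` supp)) /\ pr P (G @^-1` (~` supp)) = 0.
Proof.
pose B n k := if `[< pr P (G @^-1` dball d (s n) (eps k)) = 0 >]
  then G @^-1` dball d (s n) (eps k) else set0.
have mB n k : measurable (B n k) by rewrite /B; case: ifP.
have -> : G @^-1` (~` supp) = \bigcup_n \bigcup_k B n k.
  apply/seteqP; split=> [x /= nS|x [n _ [k _]]]; last first.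
    rewrite /B; case: ifP => // /asboolP B0 xB /= S.
    have /S : 0 < eps k - d (G x) (s n).
      by rewrite subr_gt0 (met_sym hd); exact: xB.
    rewrite ltNge => /negP; apply; rewrite -B0; apply: le_pr => // y.
    by rewrite /dball/= => h; have := met_tri hd (G x) (s n) (G y); rewrite (met_sym hd (s n) (G x)); lra.
  have [e /not_implyP[e0 /negP]] : exists e : R, ~ (0 < e -> 0 < pr P (G @^-1` dball d (G x) e)).
    by apply/existsNP => H; apply: nS => e; exact: H.
  rewrite -leNgt => ple; have [q q0 qe] := half_gt0 e0.
  have [k /(_ k (leqnn k)) kq] := eps_small q0; have [n xn] := sd (G x) (eps_gt0 k).
  exists n => //; exists k => //; rewrite /B asboolT; first by rewrite /dball/= (met_sym hd); exact: xn.
  apply/eqP; rewrite eq_le pr_ge0 andbT; apply: le_trans ple; apply: le_pr => // y.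
  by rewrite /dball/= => h; have := met_tri hd (s n) (G x) (G y); lra.
have mU n : measurable (\bigcup_k B n k) by exact: bigcupT_measurable.
split; first exact: bigcupT_measurable.
apply: pr_bigcup_null => // n; apply: pr_bigcup_null => // k.
by rewrite /B; case: ifP => [/asboolP//|_]; rewrite pr0.
Qed.

Let supp_ex : exists x, supp (G x).
Proof.
apply: contrapT => /forallNP H; have [_] := supp_null.
have -> : G @^-1` (~` supp) = setT by apply/seteqP; split=> // x _; exact: H.
by rewrite prT; lra.
Qed.

Let W0 : Type := {v : V | supp v}.
Let w0 : W0 := exist supp (G (projT1 (cid supp_ex))) (projT2 (cid supp_ex)).
Let W1 : pointedType := HB.pack W0 (gen_eqMixin W0) (gen_choiceMixin W0) (isPointed.Build W0 w0).
Let dW (x y : W1) : R := d (sval x) (sval y).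
Let W : measurableType _ := g_sigma_algebraType (dopen dW).

Let hdW : is_metric dW.
Proof.
case: hd => d0 dsym dtri; split=> [[x Sx] [y Sy]|x y|x y z]; [|exact: dsym|exact: dtri].
rewrite /dW/= d0; split=> [xy|[]//].
by move: Sx Sy; rewrite xy => Sx Sy; congr exist; exact: Prop_irrelevance.
Qed.

Let cdW : dcomplete dW.
Proof.
move=> u Hu; have [v Hv] := cd (u := fun n => sval (u n)) Hu.
have Sv : supp v.
  move=> e e0; have [q q0 qe] := half_gt0 e0.
  have [N /(_ N (leqnn N)) /= HN] := Hv q q0.
  apply: lt_le_trans (svalP (u N) q q0) _; apply: le_pr => // x.
  by rewrite /dball/= => h; have := met_tri hd (sval (u N)) v (G x);
    rewrite (met_sym hd v (sval (u N))); lra.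
by exists (exist _ v Sv).
Qed.

(** The dense sequence of the ambient space may miss the support altogether. For each centre and
    radius a point of the support is picked in that ball, with default [w0] if there is none. *)
Let t (p : nat * nat) : W1 := xget (w0 : W1) [set w : W1 | d (s p.1) (sval w) < eps p.2].

Let sdW (w : W1) (e : R) : 0 < e -> exists n k, dW w (t (n, k)) < e.
Proof.
move=> e0; have [q q0 qe] := half_gt0 e0; have [k /(_ k (leqnn k)) kq] := eps_small q0.
have [n wn] := sd (sval w) (eps_gt0 k); exists n, k; rewrite /dW /t.
case: xgetP => [w' _ /= h|/(_ w) /=]; last by rewrite (met_sym hd).
have := met_tri hd (s n) (sval w) (sval w'); lra.
Qed.

Let t' (n : nat) : W1 := if (unpickle n : option (nat * nat)) is Some p then t p else w0.

Let sdW' (w : W1) (e : R) : 0 < e -> exists n, dW w (t' n) < e.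
Proof. by move=> e0; have [n [k h]] := sdW w e0; exists (pickle (n, k)); rewrite /t' pickleK. Qed.

Let h (x : T) : W := if pselect (supp (G x)) is left Sx then exist supp (G x) Sx else w0.

Let hE x : supp (G x) -> sval (h x) = G x.
Proof. by rewrite /h; case: pselect. Qed.

Let mh B : measurable B -> measurable (h @^-1` B).
Proof.
move=> mB; rewrite -[X in measurable X]setTI; suff : measurable_fun setT h by apply.
apply: (@measurability _ _ T W setT h (dopen dW)); first by [].
move=> _ [U oU <-]; rewrite setTI.
apply: (measurable_preimage_dopen hdW sdW') oU => n k.
have mN := supp_null.1.
have -> : h @^-1` dball dW (t' n) (eps k) =
  (G @^-1` dball d (sval (t' n)) (eps k) `\` G @^-1` (~` supp)) `|`
  (if dW (t' n) w0 < eps k then G @^-1` (~` supp) else set0).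
  apply/seteqP; split=> x.
    rewrite /dball /= /h; case: pselect => [Sx hx|nS ->]; last by right.
    by left; split => //; exact.
  rewrite /dball/= => -[[hx /contrapT Sx]|]; first by rewrite /dW hE.
  by case: ifP => // hx nS; rewrite /h; case: pselect.
by apply: measurableU; [exact: measurableD|case: ifP].
Qed.

Let Q : probability W R := projT1 (cid (exists_pushforward P mh)).

Let QE B : Q B = P (h @^-1` B).
Proof. exact: (projT2 (cid (exists_pushforward P mh))). Qed.

Let Qsupp (w : W) (e : R) : 0 < e -> (0 < Q (dball dW w e))%E.
Proof.
move=> e0; have mN := supp_null.1.
have mB : measurable (h @^-1` dball dW w e).
  by apply: mh; apply: sub_sigma_algebra; exact: dopen_dball.
rewrite QE prE// lte_fin; apply: lt_le_trans (svalP w e e0) _.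
apply: (@pr_eqD _ _ P _ _ (G @^-1` (~` supp))) => //; first exact: supp_null.2.
by move=> x [hx /contrapT Sx]; rewrite /dball/= /dW hE.
Qed.

Definition image_mm : mmspace :=
  @MMSpace _ W dW hdW cdW (ex_intro _ t' sdW') (erefl _) Q Qsupp.

(** [h] agrees with [G] off a null set in general; the last clause gives agreement at every point
    that [G] sends into the support, as needed for maps out of a fully supported space. *)
Lemma image_mmP : exists (h : T -> mm_car image_mm) (emb : mm_car image_mm -> V) (N : set T),
  [/\ forall B, measurable B -> measurable (h @^-1` B),
      forall B, measurable B -> pr P (h @^-1` B) = pr (mm_mu image_mm) B,
      forall w w', mm_dist w w' = d (emb w) (emb w'),
      measurable N /\ pr P N = 0 &
      (forall x, ~ N x -> emb (h x) = G x) /\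
      forall x, (forall e : R, 0 < e -> 0 < pr P (G @^-1` dball d (G x) e)) -> emb (h x) = G x].
Proof.
exists h, (fun w => sval w), (G @^-1` (~` supp)); split => //.
- by move=> B mB; rewrite /pr /= QE.
- by split=> x; [move=> /= /contrapT; exact: hE|exact: hE].
Qed.

End ImageSpace.

Lemma measurable_lip1 (Y Z : mmspace) (f : mm_car Y -> mm_car Z) :
  lip1 f -> forall B, measurable B -> measurable (f @^-1` B).
Proof.
move=> lf; apply: measurable_into_dopen => U oU; apply: measurable_dopen => x /oU[e e0 He].
by exists e => // y; rewrite /dball/= => xy; apply: He; apply: le_lt_trans (lf _ _) xy.
Qed.

Lemma dominatedP (Y Z : mmspace) : dominated Z Y <-> exists f : mm_car Y -> mm_car Z,
  lip1 f /\ forall B, measurable B -> pr (mm_mu Y) (f @^-1` B) = pr (mm_mu Z) B.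
Proof.
split=> -[f [lf pf]]; exists f; split => //.
  by move=> B mB; rewrite /pr pf.2.
split; first by move=> _ B mB; rewrite setTI; exact: measurable_lip1.
by move=> B mB; rewrite !prE ?pf//; exact: measurable_lip1.
Qed.

(** * Closure properties of the class [pyr C] *)

Section PyramidProperties.
Variable X : nat -> mmspace.
Local Notation L := (loeb X).
Local Notation lam := (loeb_prob X).
Implicit Type C : set L.

Lemma pyr_dominated C Y Z : pyr C Y -> dominated Z Y -> pyr C Z.
Proof.
move=> [F [N [mF N0 lipF lawF]]] /dominatedP[f [lf pf]].
have mf := measurable_lip1 lf.
exists (f \o F), N; split => //.
- by move=> B mB; rewrite comp_preimage; exact: (mF _ (mf _ mB)).
- by move=> x y Cx Cy r rf; apply: lipF => //; exact: lt_le_trans rf (lf _ _).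
- by move=> B mB; rewrite comp_preimage lawF ?pf//; exact: mf.
Qed.

Lemma pyr_ae C C' Y : measurable C -> measurable C' ->
  pr lam (C `\` C') = 0 -> pr lam (C' `\` C) = 0 -> pyr C Y -> pyr C' Y.
Proof.
move=> mC mC' CC' C'C [F [N [mF [mN N0] lipF lawF]]].
have mD : measurable (C' `\` C) by exact: measurableD.
have CE B : measurable B -> pr lam (C' `&` B) = pr lam (C `&` B).
  move=> mB; apply/eqP; rewrite eq_le; apply/andP; split.
    apply: (@pr_eqD _ _ _ _ _ (C' `\` C)) => //; [exact: measurableI|exact: measurableI|].
    by move=> x [[C'x Bx] /not_andP[//|/contrapT]].
  apply: (@pr_eqD _ _ _ _ _ (C `\` C')) => //; [exact: measurableI|exact: measurableI|exact: measurableD|].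
  by move=> x [[Cx Bx] /not_andP[//|/contrapT]].
exists F, (N `|` (C' `\` C)); split => //.
- split; first exact: measurableU.
  apply/eqP; rewrite eq_le pr_ge0 andbT; apply: le_trans (prU_le _ _ _) _ => //.
  by rewrite N0 C'C addr0.
- have sub x : (C' `\` (N `|` (C' `\` C))) x -> (C `\` N) x.
    move=> [C'x /not_orP[nN /not_andP[//|/contrapT Cx]]]; split => //.
  by move=> x y /sub Cx /sub Cy; exact: lipF.
- move=> B mB; rewrite CE; last exact: mF.
  by rewrite lawF// -[C in LHS]setIT -[C' in RHS]setIT CE.
Qed.

(* The part of a space that is parametrized by [C], together with its inclusion. *)
Lemma pyr_component C (Y : mmspace) (F : L -> mm_car Y) (N : set L) :
  measurable C -> 0 < pr lam C ->
  (forall B, measurable B -> measurable (F @^-1` B)) -> measurable N -> pr lam N = 0 ->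
  (forall x y, (C `\` N) x -> (C `\` N) y -> forall r, r < mm_dist (F x) (F y) -> far r x y) ->
  exists (Z : mmspace) (f : mm_car Z -> mm_car Y), [/\ pyr C Z, lip1 f &
    forall B, measurable B -> pr lam (C `&` F @^-1` B) = pr lam C * pr (mm_mu Z) (f @^-1` B)].
Proof.
move=> mC C0 mF mN N0 lipF; have [Q HQ] := exists_conditional mC C0.
have mG v e : measurable (F @^-1` dball (@mm_dist Y) v e) by apply: mF; exact: measurable_dball.
have [h [emb [N' [mh ph hE [mN' N'0] [embh _]]]]] :=
  image_mmP Q (mm_metric Y) (@mm_complete Y) (@mm_denseP Y) mG.
set Z := image_mm _ _ _ _ _ in h emb mh ph hE embh.
have lemb : @lip1 Z Y emb by move=> w w'; rewrite hE.
have memb := measurable_lip1 lemb.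
have CN' : pr lam (C `&` N') = 0 by rewrite HQ// N'0 mulr0.
have mCN' : measurable (C `&` N') by exact: measurableI.
exists Z, emb; split => //; last first.
  move=> B mB; rewrite -ph; last exact: memb.
  rewrite -HQ; last by apply: mh; exact: memb.
  have mCB : measurable (C `&` F @^-1` B) by apply: measurableI => //; exact: mF.
  have mCB' : measurable (C `&` h @^-1` (emb @^-1` B)) by apply: measurableI => //; apply: mh; exact: memb.
  apply/eqP; rewrite eq_le; apply/andP; split;
    apply: (@pr_eqD _ _ _ _ _ (C `&` N')) => // x [[Cx Bx] /not_andP[//|nN']].
  - by split => //; rewrite /preimage/= embh.
  - by split => //; move: Bx; rewrite /preimage/= embh.
exists h, (N `|` (C `&` N')); split => //.
- split; first exact: measurableU.
  apply/eqP; rewrite eq_le pr_ge0 andbT; apply: le_trans (prU_le _ _ _) _ => //.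
  by rewrite N0 CN' addr0.
- have sub x : (C `\` (N `|` (C `&` N'))) x -> (C `\` N) x /\ ~ N' x.
    by move=> [Cx /not_orP[nN /not_andP[//|nN']]].
  move=> x y /sub[Cx nx] /sub[Cy ny] r; rewrite hE !embh//; exact: lipF.
- by move=> B mB; rewrite HQ ?ph//; exact: mh.
Qed.

(** The upper bound is the image of [C] under the pair of the two maps. The maximum metric keeps the
    pair 1-Lipschitz and makes both projections 1-Lipschitz. *)
Lemma pyr_directed C Y Y' : measurable C -> 0 < pr lam C -> pyr C Y -> pyr C Y' ->
  exists Z, [/\ pyr C Z, dominated Y Z & dominated Y' Z].
Proof.
move=> mC C0 [F [N [mF [mN N0] lipF lawF]]] [F' [N' [mF' [mN' N'0] lipF' lawF']]].
have [Q HQ] := exists_conditional mC C0.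
pose V := (mm_car Y * mm_car Y')%type.
pose d (v w : V) : R := Num.max (mm_dist v.1 w.1) (mm_dist v.2 w.2).
have hd : is_metric d.
  split=> [[a b] [a' b']|v w|u v w]; rewrite /d/=.
  - split=> [H|[-> ->]]; last by rewrite !mm_xx maxxx.
    have : mm_dist a a' <= 0 /\ mm_dist b b' <= 0 by rewrite -H !le_max !lexx orbT.
    move=> [h h']; congr (_, _).
      by case: (mm_metric Y) => /(_ a a') [H' _] _ _; apply: H'; apply/eqP; rewrite eq_le h mm_ge0.
    by case: (mm_metric Y') => /(_ b b') [H' _] _ _; apply: H'; apply/eqP; rewrite eq_le h' mm_ge0.
  - by rewrite mm_sym (mm_sym v.2).
  - rewrite ge_max; apply/andP; split.
      by apply: le_trans (mm_tri v.1 _ _) _; apply: lerD; rewrite le_max lexx.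
    by apply: le_trans (mm_tri v.2 _ _) _; apply: lerD; rewrite le_max lexx orbT.
have cd : dcomplete d.
  move=> u Hu.
  have [e e0|a Ha] := @mm_complete Y (fun n => (u n).1).
    have [M HM] := Hu e e0; exists M => m n Mm Mn.
    by apply: le_lt_trans (HM m n Mm Mn); rewrite /d le_max lexx.
  have [e e0|b Hb] := @mm_complete Y' (fun n => (u n).2).
    have [M HM] := Hu e e0; exists M => m n Mm Mn.
    by apply: le_lt_trans (HM m n Mm Mn); rewrite /d le_max lexx orbT.
  exists (a, b) => e e0; have [M HM] := Ha e e0; have [M' HM'] := Hb e e0.
  exists (maxn M M') => n; rewrite geq_max => /andP[Mn M'n].
  by rewrite /d gt_max HM//= HM'.
pose s n : V := if (unpickle n : option (nat * nat)) is Some p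
  then (mm_dense Y p.1, mm_dense Y' p.2) else (mm_dense Y 0, mm_dense Y' 0).
have sd (x : V) (e : R) : 0 < e -> exists n : nat, d x (s n) < e.
  move=> e0; have [i Hi] := mm_denseP x.1 e0; have [j Hj] := mm_denseP x.2 e0.
  by exists (pickle (i, j)); rewrite /s pickleK /d/= gt_max Hi.
pose G (x : L) : V := (F x, F' x).
have mG v e : measurable (G @^-1` dball d v e).
  have -> : G @^-1` dball d v e = F @^-1` dball (@mm_dist Y) v.1 e `&`
      F' @^-1` dball (@mm_dist Y') v.2 e.
    by apply/seteqP; split=> x; rewrite /dball /= /d gt_max => /andP.
  by apply: measurableI; [apply: mF; exact: measurable_dball|apply: mF'; exact: measurable_dball].
have [h [emb [N2 [mh ph hE [mN2 N20] [embh _]]]]] := image_mmP Q hd cd sd mG.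
set Z := image_mm _ _ _ _ _ in h emb mh ph hE embh.
have CN2 : pr lam (C `&` N2) = 0 by rewrite HQ// N20 mulr0.
have mCN2 : measurable (C `&` N2) by exact: measurableI.
have l1 : @lip1 Z Y (fun z => (emb z).1) by move=> w w'; rewrite hE /d le_max lexx.
have l2 : @lip1 Z Y' (fun z => (emb z).2) by move=> w w'; rewrite hE /d le_max lexx orbT.
have lawQ (W : mmspace) (H : L -> mm_car W) (k : mm_car Z -> mm_car W) :
    (forall B, measurable B -> measurable (H @^-1` B)) ->
    (forall B, measurable B -> measurable (k @^-1` B)) ->
    (forall B, measurable B -> pr lam (C `&` H @^-1` B) = pr lam C * pr (mm_mu W) B) ->
    (forall x, ~ N2 x -> k (h x) = H x) ->
    forall B, measurable B -> pr (mm_mu Z) (k @^-1` B) = pr (mm_mu W) B.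
  move=> mH mk lH kh B mB; rewrite -ph; last exact: mk.
  apply: (mulfI (lt0r_neq0 C0)); rewrite -lH// -HQ; last by apply: mh; exact: mk.
  have mCB : measurable (C `&` H @^-1` B) by apply: measurableI => //; exact: mH.
  have mCB' : measurable (C `&` h @^-1` (k @^-1` B)) by apply: measurableI => //; apply: mh; exact: mk.
  apply/eqP; rewrite eq_le; apply/andP; split;
    apply: (@pr_eqD _ _ _ _ _ (C `&` N2)) => // x [[Cx Bx] /not_andP[//|nN2]].
  - by split => //; move: Bx; rewrite /preimage/= kh.
  - by split => //; rewrite /preimage/= kh.
exists Z; split; last 2 first.
- apply/dominatedP; exists (fun z => (emb z).1); split => //.
  apply: (lawQ _ F) => //; first exact: measurable_lip1.
  by move=> x nx; rewrite embh.
- apply/dominatedP; exists (fun z => (emb z).2); split => //.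
  apply: (lawQ _ F') => //; first exact: measurable_lip1.
  by move=> x nx; rewrite embh.
exists h, (N `|` N' `|` (C `&` N2)); split => //.
- split; first by apply: measurableU => //; exact: measurableU.
  apply/eqP; rewrite eq_le pr_ge0 andbT; apply: le_trans (prU_le _ _ _) _ => //.
    exact: measurableU.
  by rewrite CN2 addr0; apply: le_trans (prU_le _ _ _) _ => //; rewrite N0 N'0 addr0.
- have sub x : (C `\` (N `|` N' `|` (C `&` N2))) x -> [/\ (C `\` N) x, (C `\` N') x & ~ N2 x].
    by move=> [Cx /not_orP[/not_orP[nN nN'] /not_andP[//|nN2]]].
  move=> x y /sub[Cx Cx' nx] /sub[Cy Cy' ny] r; rewrite hE !embh// /d lt_max => /orP[].
    exact: lipF.
  exact: lipF'.
- by move=> B mB; rewrite HQ ?ph//; exact: mh.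
Qed.

(** Distance bounds between internal sets become uniform at almost every index: pairs violating the
    bound would assemble to two points of the ultraproduct violating it. *)
Lemma far_internal (A B : forall n, set (mm_car (X n))) (r : R) :
  (forall x y, internal A x -> internal B y -> far r x y) ->
  \forall n \near hyper, forall x y, A n x -> B n y -> r <= mm_dist x y.
Proof.
move=> H; apply: contrapT => /hyperN nH.
have pick n : exists p : mm_car (X n) * mm_car (X n),
    ~ (forall x y, A n x -> B n y -> r <= mm_dist x y) ->
    [/\ A n p.1, B n p.2 & ~ r <= mm_dist p.1 p.2].
  have [?|/existsNP[x /existsNP[y /not_implyP[Ax /not_implyP[By nr]]]]] :=
    pselect (forall x y, A n x -> B n y -> r <= mm_dist x y); first by exists point.
  by exists (x, y).
pose p n := projT1 (cid (pick n)).
have pP n := projT2 (cid (pick n)).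
have Ap : internal A (fun n => (p n).1) by apply: filterS nH => n /pP[].
have Bp : internal B (fun n => (p n).2) by apply: filterS nH => n /pP[].
by have [n [/pP[_ _ nr] /nr]] := hyper_ex (hyper_and nH (H _ _ Ap Bp)).
Qed.

End PyramidProperties.

Lemma bigsetU_ord_cond (T : Type) (m : nat) (P : pred nat) (F : nat -> set T) :
  \big[setU/set0]_(j < m | P j) F j = \bigcup_(j in [set j | (j < m)%N /\ P j]) F j.
Proof.
rewrite -(bigcup_seq_cond (index_enum 'I_m) (fun j : 'I_m => F j) (fun j : 'I_m => P j)).
apply/seteqP; split=> x [j /=]; first by move=> /andP[_ Pj] Fx; exists j => /=.
by move=> [jm Pj] Fx; exists (Ordinal jm) => //=; rewrite mem_index_enum.
Qed.

Section DiscreteApproximation.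
Variable X : nat -> mmspace.
Local Notation L := (loeb X).
Local Notation lam := (loeb_prob X).
Implicit Type C : set L.

(** The map sending [E j] to [y j] is an [e]-approximate version of the map required by [pyr C],
    with finitely many values. The pieces live in the Loeb space and need not be internal. *)
Definition discrete_approx C (Y : mmspace) (e : R) : Prop :=
  exists (m : nat) (y : nat -> mm_car Y) (E : nat -> set L), [/\
    forall j, measurable (E j) /\ E j `<=` C,
    forall i j x, E i x -> E j x -> i = j,
    pr lam C - e <= \sum_(j < m) pr lam (E j),
    (forall i j x x', E i x -> E j x' -> far (mm_dist (y i) (y j) - e) x x') &
    forall K, measurable K ->
      \sum_(j < m | `[< K (y j) >]) pr lam (E j) <= pr lam C * pr (mm_mu Y) (thicken K e) + e].

(** Shrinking the pieces to internal subsets turns a map with finitely many values into a sequence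
    of such maps on the spaces [X n], and [standard_part] takes over. *)
Lemma discrete_pyr C Y : measurable C -> (forall e : R, 0 < e -> discrete_approx C Y e) -> pyr C Y.
Proof.
move=> mC H; have [C' [mC' CC' C'C]] := loeb_internal_ae mC.
have mIC' : measurable (internal C' : set L) by exact: measurable_internal.
apply: (pyr_ae mIC' mC C'C CC'); apply: standard_part => // k.
have [q q0 qk] := quarter_gt0 (eps_gt0 k).
have [m [y [E [mE dE sE fE lE]]]] := H q q0.
(* Mass lost per piece. It is divided by the number of pieces, so that one such loss on every piece
   costs at most [q] in all. *)
have [dl dl0 mdl] : exists2 dl : R, 0 < dl & m%:R * dl <= q.
  exists (q / m.+1%:R); first by rewrite divr_gt0.
  by rewrite mulrCA ler_piMr ?(ltW q0)// ler_pdivrMr// mul1r ler_nat.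
have sumdl (P : pred 'I_m) : \sum_(j < m | P j) dl <= q.
  apply: le_trans (_ : \sum_(j < m) dl <= _); last by rewrite sumr_const card_ord -mulr_natl.
  by rewrite big_mkcond; apply: ler_sum => j _; case: ifP => // _; exact: ltW.
have mEC j : measurable (E j `&` internal C') by apply: measurableI => //; have [] := mE j.
have prEC j : pr lam (E j) <= pr lam (E j `&` internal C').
  have [mEj EjC] := mE j.
  apply: (@pr_eqD _ _ _ _ _ (C `\` internal C')) => //; first exact: measurableD.
  by move=> x [Ex /not_andP[/(_ (EjC _ Ex))//|/contrapT]].
pose J j := projT1 (cid (loeb_inner (mEC j) dl0)).
have [mJ JE JC prJ] : [/\ forall j n, measurable (J j n), forall j, internal (J j) `<=` E j,
    forall j, internal (J j) `<=` internal C' &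
    forall j, pr lam (E j) - dl <= pr lam (internal (J j))].
  split=> j; have [m1 s1 p1] := projT2 (cid (loeb_inner (mEC j) dl0)) => //.
  - by move=> x /s1[].
  - by move=> x /s1[].
  - by have := prEC j; move: p1; rewrite -/(J j); lra.
have cE : pr lam C = pr lam (internal C').
  by apply/eqP; rewrite eq_le; apply/andP; split;
    [apply: (@pr_eqD _ _ _ _ _ (C `\` internal C')) => //; first exact: measurableD
    |apply: (@pr_eqD _ _ _ _ _ (internal C' `\` C : set L)) => //; first exact: measurableD];
    move=> x [Cx /not_andP[//|/contrapT]].
have h1 : \forall n \near hyper, forall j : 'I_m, J j n `<=` C' n.
  by apply: hyper_forall_ord => j; apply/internal_subP.
have h2 : \forall n \near hyper, forall i j : 'I_m, i != j -> J i n `&` J j n = set0.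
  apply: hyper_forall_ord => i; apply: hyper_forall_ord => j.
  have [->|ij] := eqVneq i j; first by apply: filterE => n /eqP[].
  have : internal (fun n => J i n `&` J j n) = internal (fun n => set0).
    rewrite internal0 internalI; apply/seteqP; split=> // x [/JE Ei /JE Ej].
    by move: ij; rewrite (ord_inj (dE _ _ _ Ei Ej)) eqxx.
  by move=> /internal_eq; apply: filterS.
have h3 : \forall n \near hyper, forall j : 'I_m,
    `|pr (mm_mu (X n)) (J j n) - pr lam (internal (J j))| < dl.
  by apply: hyper_forall_ord => j; exact: loeb_internal.
have h4 : \forall n \near hyper, forall i j : 'I_m, forall x x', J i n x -> J j n x' ->
    mm_dist (y i) (y j) - q <= mm_dist x x'.
  apply: hyper_forall_ord => i; apply: hyper_forall_ord => j; apply: far_internal => x x' Jx Jx'.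
  by apply: fE; [exact: JE Jx|exact: JE Jx'].
have h5 := loeb_internal mC' q0.
apply: filterS (hyper_and (hyper_and h1 h2) (hyper_and (hyper_and h3 h4) h5)).
move=> n [[{}h1 {}h2] [[{}h3 {}h4] {}h5]].
pose S := \bigcup_(j < m) J j n.
(* Off the pieces the index defaults to 0, so [f] is constantly [y 0] there and remains
   measurable. *)
pose f x := y (xget 0%N [set j | (j < m)%N /\ J j n x]).
have disj i j x : (i < m)%N -> (j < m)%N -> J i n x -> J j n x -> i = j.
  move=> im jm Ji Jj; apply/eqP/negPn/negP => ij.
  have /seteqP[/(_ x) H0 _] := h2 (Ordinal im) (Ordinal jm) ij.
  by apply: H0.
have fE' j x : (j < m)%N -> J j n x -> f x = y j.
  move=> jm Jx; rewrite /f; case: xgetP => [i _ [im Jix]|/(_ j)]; first by rewrite (disj i j x).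
  by move=> /(_ (conj jm Jx)).
have fS x : ~ S x -> f x = y 0%N.
  by move=> nS; rewrite /f; case: xgetP => // i _ [im Jix]; exfalso; apply: nS; exists i.
have mS : measurable S by apply: bigcup_measurable => j _; exact: mJ.
have sub K : S `&` f @^-1` K = \big[setU/set0]_(j < m | `[< K (y j) >]) J j n.
  rewrite (bigsetU_ord_cond _ (fun j => `[< K (y j) >]) (fun j => J j n)).
  apply/seteqP; split=> x.
    move=> [[j /= jm Jx]]; rewrite /preimage/= (fE' j)// => Kj.
    by exists j => //=; split => //; exact/asboolP.
  move=> [j /= [jm /asboolP Kj] Jx]; split; first by exists j.
  by rewrite /preimage/= (fE' j).
exists f, S; split; first split => //= B mB.
  have -> : f @^-1` B = (S `&` f @^-1` B) `|` (if `[< B (y 0%N) >] then ~` S else set0).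
    apply/seteqP; split=> x.
      move=> Bx; have [Sx|nS] := pselect (S x); [by left|right].
      by move: Bx; rewrite /preimage/= fS// => By0; rewrite asboolT.
    by move=> [[]//|]; case: ifP => // /asboolP By0 nS; rewrite /preimage/= fS.
  apply: measurableU; last by case: ifP => // _; exact: measurableC.
  by rewrite sub; apply: bigsetU_measurable => j _; exact: mJ.
split.
- by move=> x [j /= jm Jx]; exact: (h1 (Ordinal jm)).
- have -> : pr (mm_mu (X n)) S = \sum_(j < m) pr (mm_mu (X n)) (J j n).
    rewrite /S bigcup_mkord pr_bigU// ?index_enum_uniq// => i j x Ji Jj.
    by apply: ord_inj; exact: (disj _ _ x).
  have : \sum_(j < m) (pr lam (E j) - dl - dl) <= \sum_(j < m) pr (mm_mu (X n)) (J j n).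
    apply: ler_sum => j _; have := h3 j; have := prJ j.
    by rewrite ltr_norml => ? /andP[? ?]; lra.
  rewrite !sumrB; have := sumdl xpredT; move: h5; rewrite ltr_norml => /andP[? ?].
  by move: sE; rewrite cE; lra.
- move=> x x' [i /= im Ji] [j /= jm Jj]; rewrite (fE' i)// (fE' j)//.
  by have := h4 (Ordinal im) (Ordinal jm) x x' Ji Jj => /=; lra.
- move=> K mK; rewrite sub; apply: le_trans (pr_bigU_le _ _ _ _) _ => //.
  have := lE K mK; rewrite -cE.
  have : \sum_(j < m | `[< K (y j) >]) pr (mm_mu (X n)) (J j n) <=
         \sum_(j < m | `[< K (y j) >]) (pr lam (E j) + dl).
    apply: ler_sum => j _; have := h3 j.
    have : pr lam (internal (J j)) <= pr lam (E j).
      by apply: le_pr; [exact: measurable_internal|exact: (mE j).1|exact: JE].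
    by rewrite ltr_norml => ? /andP[? ?]; lra.
  rewrite big_split/=; have := sumdl (fun j => `[< K (y j) >]).
  have : pr lam C * pr (mm_mu Y) (thicken K q) <= pr lam C * pr (mm_mu Y) (thicken K (eps k)).
    apply: ler_wpM2l; first exact: pr_ge0.
    apply: le_pr; [exact: measurable_thicken|exact: measurable_thicken|].
    by move=> w [z Kz]; rewrite /dball/= => zw; exists z => //; rewrite /dball/=; lra.
  by lra.
Qed.

End DiscreteApproximation.

(** * Density of a chain in a pyramid *)

(* [Y'] maps approximately 1-Lipschitz, and approximately measure preserving, onto a finite
   subset of [Y]. *)
Definition net_approx (Y' Y : mmspace) (e : R) : Prop :=
  exists (m : nat) (A : nat -> set (mm_car Y')) (y : nat -> mm_car Y), [/\
    forall j, measurable (A j),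
    forall i j b, A i b -> A j b -> i = j,
    1 - e <= \sum_(j < m) pr (mm_mu Y') (A j),
    (forall i j b b', A i b -> A j b' -> mm_dist (y i) (y j) <= mm_dist b b' + e) &
    forall K, measurable K ->
      \sum_(j < m | `[< K (y j) >]) pr (mm_mu Y') (A j) <= pr (mm_mu Y) (thicken K e) + e].

Lemma net_discrete_approx X (C : set (loeb X)) (Y' Y : mmspace) (e : R) : measurable C ->
  0 < e -> pyr C Y' -> net_approx Y' Y e -> discrete_approx C Y (e + e).
Proof.
move=> mC e0 [F [N [mF [mN N0] lipF lawF]]] [m [A [y [mA dA sA nA lA]]]].
have mCA j : measurable (C `&` F @^-1` A j) by apply: measurableI => //; exact: mF.
have prE j : pr (loeb_prob X) ((C `&` F @^-1` A j) `\` N) =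
    pr (loeb_prob X) C * pr (mm_mu Y') (A j).
  rewrite -lawF// prD// [X in _ - X](_ : _ = 0) ?subr0//.
  by apply: (pr_null (B := N)) => //; exact: measurableI.
set c := pr (loeb_prob X) C in prE *.
have c0 : 0 <= c by exact: pr_ge0.
have c1 : c <= 1 by exact: pr_le1.
have ce : c * e <= e by rewrite ler_piMl// ltW.
exists m, y, (fun j => (C `&` F @^-1` A j) `\` N); split.
- by move=> j; split; [exact: measurableD|move=> x [[]]].
- by move=> i j x [[_ Ai] _] [[_ Aj] _]; exact: dA Ai Aj.
- under eq_bigr => j _ do rewrite prE.
  rewrite -mulr_sumr.
  by have := ler_wpM2l c0 sA; rewrite mulrBr mulr1; rewrite -/c; lra.
- move=> i j x x' [[Cx Ai] nx] [[Cx' Aj] nx']; apply: lipF => //.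
  by have := nA _ _ _ _ Ai Aj; lra.
- move=> K mK; under eq_bigr => j _ do rewrite prE.
  rewrite -mulr_sumr.
  have := ler_wpM2l c0 (lA K mK); rewrite mulrDr -/c.
  have : c * pr (mm_mu Y) (thicken K e) <= c * pr (mm_mu Y) (thicken K (e + e)).
    apply: ler_wpM2l => //.
    apply: le_pr; [exact: measurable_thicken|exact: measurable_thicken|].
    by move=> w [z Kz]; rewrite /dball/= => zw; exists z => //; rewrite /dball/=; lra.
  by lra.
Qed.

Lemma pyr_net_closed X (C : set (loeb X)) (Y : mmspace) : measurable C ->
  (forall e : R, 0 < e -> exists2 Y', pyr C Y' & net_approx Y' Y e) -> pyr C Y.
Proof.
move=> mC H; apply: discrete_pyr => // e /half_gt0[q q0 <-].
by have [Y' pY' nY'] := H q q0; exact: net_discrete_approx pY' nY'.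
Qed.

Lemma box_lt_coupling (Y Z : mmspace) (e : R) : (box Y Z < e%:E)%E ->
  exists (pi : probability (mm_car Y * mm_car Z)%type R) (S : set (mm_car Y * mm_car Z)),
    [/\ coupling pi, measurable S,
      forall p q, S p -> S q -> `|mm_dist p.1 q.1 - mm_dist p.2 q.2| < e &
      1 - e < pr pi S].
Proof.
move=> /ereal_inf_lt[_ [pi [S [cpi mS ->]]]]; rewrite gt_max => /andP[disS piS].
exists pi, S; split => //.
  move=> p q Sp Sq; rewrite -lte_fin; apply: le_lt_trans disS.
  by apply: ereal_sup_ubound; exists p => //; exists q.
by move: piS; rewrite prE// -EFinB lte_fin; lra.
Qed.

(** In each cell of [Y'] met by [S] a pair of [S] is chosen, and the cell is sent to its second
    coordinate. The five [q] are the distortion of [S] and two radii at each end, for moving from a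
    point of a cell through the centre to the chosen one. *)
Lemma box_net_approx (Y' Y : mmspace) (q e : R) : 0 < q -> q + q + q + q + q <= e ->
  (box Y' Y < q%:E)%E -> net_approx Y' Y e.
Proof.
move=> q0 qe /box_lt_coupling[pi [S [[cpi1 cpi2] mS disS piS]]].
have [M HM] := cells_tight Y' q0 q0.
pose good j := `[< (exists2 p, S p & cell q j p.1) >].
pose b j := xget (mm_dense Y' 0, mm_dense Y 0) [set p | S p /\ cell q j p.1].
have bP j : good j -> S (b j) /\ cell q j (b j).1.
  by rewrite /b => /asboolP[p Sp cp]; case: xgetP => [_ _ //|/(_ p)[]].
pose A j := if good j then cell q j else set0 : set (mm_car Y').
have mA j : measurable (A j) by rewrite /A; case: ifP => // _; exact: measurable_cell.
have AP j x : A j x -> good j /\ cell q j x by rewrite /A; case: ifP.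
have dA i j x : A i x -> A j x -> i = j.
  by move=> /AP[_ ci] /AP[_ cj]; exact: cell_inj ci cj.
have sumA (P : pred nat) : \sum_(j < M | P j) pr (mm_mu Y') (A j) =
    pr pi ((\bigcup_(j in [set j | (j < M)%N /\ P j]) A j) `*` setT).
  have mU : measurable (\bigcup_(j in [set j | (j < M)%N /\ P j]) A j).
    by apply: bigcup_measurable => j _; exact: mA.
  rewrite [RHS]/pr cpi1// -/(pr _ _) -bigsetU_ord_cond pr_bigU_cond ?index_enum_uniq//.
  by move=> i j x Ai Aj; apply: ord_inj; exact: dA Ai Aj.
have piSI (B : set (mm_car Y' * mm_car Y)) : measurable B -> pr pi B <= pr pi (B `&` S) + q.
  move=> mB; have := prD pi mB mS.
  have : pr pi (B `\` S) <= pr pi (~` S).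
    by apply: le_pr; [exact: measurableD|exact: measurableC|move=> x []].
  by rewrite prC//; lra.
have mtimes (B : set (mm_car Y')) : measurable B ->
    measurable (B `*` setT : set (mm_car Y' * mm_car Y)) by move=> mB; exact: measurableX.
exists M, A, (fun j => (b j).2); split => //.
- rewrite (sumA xpredT); set B := \bigcup_(j < M) cell q j in HM.
  have mB : measurable B by exact: measurable_cells.
  have := piSI _ (mtimes _ mB).
  have -> : pr pi (B `*` setT) = pr (mm_mu Y') B by rewrite /pr cpi1.
  suff : pr pi (B `*` setT `&` S) <=
      pr pi (\bigcup_(j in [set j | (j < M)%N /\ xpredT j]) A j `*` setT).
    by lra.
  apply: le_pr.
  + by apply: measurableI => //; exact: mtimes.
  + by apply: mtimes; apply: bigcup_measurable => j _; exact: mA.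
  + move=> p [[[j /= jM cj] _] Sp]; split => //; exists j => //.
    by rewrite /A ifT//; apply/asboolP; exists p.
- move=> i j x x' /AP[/bP[Si ci] ci'] /AP[/bP[Sj cj] cj'].
  have := disS _ _ Si Sj; rewrite ltr_norml => /andP[? ?].
  have := cell_dist ci; have := cell_dist ci'; have := cell_dist cj; have := cell_dist cj'.
  have := mm_tri x (b i).1 (b j).1; have := mm_tri x' x (b j).1.
  have := mm_tri_l (mm_dense Y' i) (b i).1 x; have := mm_tri_l (mm_dense Y' j) x' (b j).1.
  by lra.
- move=> K mK; rewrite (sumA (fun j => `[< K (b j).2 >])).
  set B := \bigcup_(j in _) A j.
  have mB : measurable B by apply: bigcup_measurable => j _; exact: mA.
  have := piSI _ (mtimes _ mB).
  suff : pr pi (B `*` setT `&` S) <= pr pi (setT `*` thicken K e).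
    have -> : pr pi (setT `*` thicken K e) = pr (mm_mu Y) (thicken K e).
      by rewrite /pr cpi2//; exact: measurable_thicken.
    by lra.
  apply: le_pr.
  + by apply: measurableI => //; exact: mtimes.
  + by apply: measurableX => //; exact: measurable_thicken.
  + move=> p [[[j [/= jM /asboolP Kj] /AP[/bP[Sj cj] cj']] _] Sp]; split => //.
    exists (b j).2 => //; rewrite /dball/=.
    have := disS _ _ Sj Sp; rewrite ltr_norml => /andP[? ?].
    have := cell_dist cj; have := cell_dist cj'.
    by have := mm_tri_l (mm_dense Y' j) (b j).1 p.1; lra.
Qed.

Lemma pyr_box_closed X (C : set (loeb X)) : measurable C -> box_closed (pyr C).
Proof.
move=> mC Y H; apply: pyr_net_closed => // e e0.
have [r r0 re] := half_gt0 e0; have [q q0 qr] := quarter_gt0 r0.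
have [Y' [pY' bY']] := H q q0; exists Y' => //.
by apply: box_net_approx bY' => //; lra.
Qed.

Lemma dominated_trans (X Y Z : mmspace) : dominated X Y -> dominated Y Z -> dominated X Z.
Proof.
move=> /dominatedP[f [lf pf]] /dominatedP[g [lg pg]]; apply/dominatedP; exists (f \o g); split.
  by move=> x y /=; apply: le_trans (lf _ _) _; exact: lg.
by move=> B mB; rewrite comp_preimage pg ?pf//; exact: measurable_lip1.
Qed.

Lemma pyr_nonempty (X : nat -> mmspace) (C : set (loeb X)) : measurable C ->
  0 < pr (loeb_prob X) C -> exists Y, pyr C Y.
Proof.
move=> mC C0; have [|||x y _ _ r|Z [f [pZ _ _]]] :=
  @pyr_component X C (X 0%N) (fun=> point) set0 mC C0; last by exists Z.
- by move=> B mB; rewrite preimage_cst; case: ifP.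
- exact: measurable0.
- exact: pr0.
- by rewrite mm_xx => r0; apply: filterE => n; exact: le_trans (ltW r0) (mm_ge0 _ _).
Qed.

Lemma pyr_pyramid (X : nat -> mmspace) (C : set (loeb X)) : measurable C ->
  0 < pr (loeb_prob X) C -> pyramid (pyr C).
Proof.
move=> mC C0; split.
- exact: pyr_nonempty.
- exact: pyr_box_closed.
- by move=> Y Z; exact: pyr_dominated.
- by move=> Y Y'; exact: pyr_directed.
Qed.

Lemma pyr_eventually_dominated (X : nat -> mmspace) (Y : mmspace) (N : nat) :
  (forall n, (N <= n)%N -> dominated Y (X n)) -> pyr (setT : set (loeb X)) Y.
Proof.
move=> H; rewrite -(internalT X); apply: standard_part => // k.
apply: filterS (hyper_ge N) => n /H/dominatedP[f [lf pf]].
have mf := measurable_lip1 lf.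
exists f, setT; split; first by split => //=.
split => //.
- by have := eps_gt0 k; lra.
- by move=> x y _ _; have := lf x y; have := eps_gt0 k; lra.
- move=> K mK; rewrite setTI pf// internalT prT mul1r.
  have : pr (mm_mu Y) K <= pr (mm_mu Y) (thicken K (eps k)).
    apply: le_pr => //; first exact: measurable_thicken.
    by move=> y Ky; exists y => //; rewrite /dball/= mm_xx eps_gt0.
  by have := eps_gt0 k; lra.
Qed.

Section Codes.
Variables (k M : nat).

Definition dist_code (Y : mmspace) : nat := pickle [ffun p : 'I_M * 'I_M =>
  Num.truncn (mm_dist (mm_dense Y p.1) (mm_dense Y p.2) * k.+1%:R)].

(** The extra factor [M.+1] makes the rounding errors of [M] masses add up to at most [eps k]. *)
Definition mass_code (Y : mmspace) : nat := pickle [ffun j : 'I_M =>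
  Num.truncn (pr (mm_mu Y) (cell (eps k) j) * (k.+1%:R * M.+1%:R))].

Definition tight (Y : mmspace) : Prop :=
  1 - eps k < pr (mm_mu Y) (\bigcup_(j < M) cell (eps k) j).

Lemma truncn_close (a b c : R) : 0 <= a -> 0 <= b -> 0 < c ->
  Num.truncn (a * c) = Num.truncn (b * c) -> `|a - b| <= c^-1.
Proof.
move=> a0 b0 c0 ab.
have ac0 : 0 <= a * c by rewrite mulr_ge0// ltW.
have bc0 : 0 <= b * c by rewrite mulr_ge0// ltW.
have /andP[h1 h2] := truncn_itv ac0; have /andP[h3 h4] := truncn_itv bc0.
rewrite -(ler_pM2r c0) mulVf ?gt_eqF//.
have -> : `|a - b| * c = `|a * c - b * c| by rewrite -mulrBl normrM (gtr0_norm c0).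
move: h1 h2 h3 h4; rewrite ab => h1 h2 h3 h4; rewrite ler_norml.
by move: h2 h4; rewrite -natr1 => h2 h4; apply/andP; split; lra.
Qed.

Lemma code_net_approx (Y' Y : mmspace) (e : R) : eps k + eps k + eps k <= e ->
  tight Y' -> dist_code Y' = dist_code Y -> mass_code Y' = mass_code Y -> net_approx Y' Y e.
Proof.
move=> ke tY' /(pcan_inj pickleK)/ffunP dc /(pcan_inj pickleK)/ffunP mc.
have k0 := eps_gt0 k.
have dcl (i j : nat) : (i < M)%N -> (j < M)%N ->
    mm_dist (mm_dense Y i) (mm_dense Y j) <= mm_dist (mm_dense Y' i) (mm_dense Y' j) + eps k.
  move=> iM jM; have := dc (Ordinal iM, Ordinal jM); rewrite !ffunE/=.
  move=> /(truncn_close (mm_ge0 _ _) (mm_ge0 _ _) (ltr0Sn _ k)).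
  by rewrite ler_norml -/(eps k) => /andP[? ?]; lra.
have [w [w0 wE Mw]] : exists w : R, [/\ 0 <= w, (k.+1%:R * M.+1%:R)^-1 = w & M%:R * w <= eps k].
  exists (k.+1%:R * M.+1%:R)^-1; split => //.
  by rewrite invfM mulrCA ler_piMr ?(ltW k0)// ler_pdivrMr// mul1r ler_nat.
have mcl (j : 'I_M) : pr (mm_mu Y') (cell (eps k) j) <=
    pr (mm_mu Y) (cell (eps k) j) + w.
  have := mc j; rewrite !ffunE/= => /(truncn_close (pr_ge0 _ _) (pr_ge0 _ _)).
  by rewrite mulr_gt0// wE => /(_ isT); rewrite ler_norml => /andP[_]; rewrite lerBlDl.
pose A (j : nat) : set (mm_car Y') := if (j < M)%N then cell (eps k) j else set0.
have AP j x : A j x -> (j < M)%N /\ cell (eps k) j x by rewrite /A; case: ifP.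
have AE (j : 'I_M) : A j = cell (eps k) j by rewrite /A ltn_ord.
exists M, A, (mm_dense Y); split.
- by move=> j; rewrite /A; case: ifP => // _; exact: measurable_cell.
- by move=> i j b /AP[_ ci] /AP[_ cj]; exact: cell_inj ci cj.
- under eq_bigr => j _ do rewrite AE.
  rewrite -pr_bigU ?index_enum_uniq//; last 2 first.
  + by move=> j; exact: measurable_cell.
  + by move=> i j x ci cj; apply: ord_inj; exact: cell_inj ci cj.
  by rewrite -bigcup_mkord; move: tY'; rewrite /tight; lra.
- move=> i j x x' /AP[iM ci] /AP[jM cj].
  have := dcl i j iM jM; have := cell_dist ci; have := cell_dist cj.
  have := mm_tri x (mm_dense Y' i) (mm_dense Y' j); have := mm_tri_r x' x (mm_dense Y' j).
  by lra.
- move=> K mK; under eq_bigr => j _ do rewrite AE.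
  apply: le_trans (_ : \sum_(j < M | `[< K (mm_dense Y j) >])
    (pr (mm_mu Y) (cell (eps k) j) + w) <= _).
    by apply: ler_sum => j _; exact: mcl.
  rewrite big_split/=; apply: lerD.
    rewrite -pr_bigU_cond ?index_enum_uniq//; last 2 first.
    + by move=> j; exact: measurable_cell.
    + by move=> i j x ci cj; apply: ord_inj; exact: cell_inj ci cj.
    apply: le_pr; [|exact: measurable_thicken|].
      by apply: bigsetU_measurable => j _; exact: measurable_cell.
    rewrite (bigsetU_ord_cond _ (fun j => `[< K (mm_dense Y j) >]) (fun j => cell (eps k) j)).
    move=> y [j /= [jM /asboolP Kj] cj]; exists (mm_dense Y j) => //; rewrite /dball/=.
    by have := cell_dist cj; lra.
  apply: le_trans (_ : eps k <= _); last by lra.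
  apply: le_trans (_ : \sum_(j < M) w <= _); last by rewrite sumr_const card_ord -mulr_natl.
  by rewrite big_mkcond; apply: ler_sum => j _; case: ifP.
Qed.

End Codes.

(* There are countably many codes, and mm-spaces with the same code are close in the sense of
   [net_approx]: realizing every code that occurs in [P] makes the chain dense. *)
Lemma exists_dense_chain (P : mmspace -> Prop) : pyramid P ->
  exists X : nat -> mmspace, (forall n, P (X n)) /\ forall Y, P Y -> pyr (setT : set (loeb X)) Y.
Proof.
move=> [[X0 PX0] boxP downP dirP].
pose cond (c : nat * nat * nat * nat) (Y : mmspace) :=
  [/\ P Y, tight c.1.1.1 c.1.1.2 Y, dist_code c.1.1.1 c.1.1.2 Y = c.1.2 &
      mass_code c.1.1.1 c.1.1.2 Y = c.2].
(* [Z n] has the code numbered [n] whenever some member of [P] has it; otherwise [X0] merely keeps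
   the sequence inside [P]. *)
have H n : exists Y, P Y /\ forall c, unpickle n = Some c ->
    (exists Y', cond c Y') -> cond c Y.
  case E : (unpickle n) => [c|]; last by exists X0.
  have [[Y' cY']|nY'] := pselect (exists Y', cond c Y').
    by exists Y'; split; [case: cY'|move=> _ [<-]].
  by exists X0; split => // _ [<-].
have [Z HZ] := choice H.
have dir' (A B : {Y | P Y}) : exists D : {Y | P Y}, dominated (sval A) (sval D) /\
    dominated (sval B) (sval D).
  by have [D [PD h1 h2]] := dirP _ _ (svalP A) (svalP B); exists (exist P D PD).
pose z n : {Y | P Y} := exist P (Z n) (HZ n).1.
pose step (n : nat) (A : {Y | P Y}) : {Y | P Y} := projT1 (cid (dir' A (z n))).
(* Each term dominates the previous one and the next realized code, so every [Z n] is dominated by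
   all later terms of the chain. *)
pose W := nat_rect (fun _ => {Y | P Y}) (z 0%N) step.
have stepP n : dominated (sval (W n)) (sval (W n.+1)) /\ dominated (Z n) (sval (W n.+1)).
  exact: (projT2 (cid (dir' (W n) (z n)))).
have WZ n m : (n < m)%N -> dominated (Z n) (sval (W m)).
  elim: m => // m IH; rewrite ltnS leq_eqVlt => /orP[/eqP ->|/IH nm]; first exact: (stepP m).2.
  exact: dominated_trans nm (stepP m).1.
exists (fun n => sval (W n)); split=> [n|Y PY]; first exact: svalP.
apply: pyr_net_closed => // e /quarter_gt0[q q0 qe].
have [k /(_ k (leqnn k)) kq] := eps_small q0.
have [M tY] := cells_tight Y (eps_gt0 k) (eps_gt0 k).
pose c := (k, M, dist_code k M Y, mass_code k M Y).
have cY : exists Y', cond c Y' by exists Y.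
have [_ /(_ c (pickleK c) cY)[PZ tZ dZ mZ]] := HZ (pickle c).
exists (Z (pickle c)).
  by apply: (@pyr_eventually_dominated _ _ (pickle c).+1) => n; exact: WZ.
by apply: (code_net_approx _ tZ dZ mZ) => /=; lra.
Qed.

(** * Couplings and box distance *)

Section DominatedAdditive.
Context (disp : measure_display) (T : measurableType disp) (P : probability T R)
  (p : set T -> R) (K : R).
Hypotheses (p_ge0 : forall A, measurable A -> 0 <= p A)
  (p_dom : forall A, measurable A -> p A <= K * pr P A)
  (p_add : forall A B, measurable A -> measurable B -> A `&` B = set0 ->
    p (A `|` B) = p A + p B)
  (pT : p setT = 1).

Let q (A : set T) : \bar R := if `[< measurable A >] then (p A)%:E else 0%E.

Let qE A : measurable A -> q A = (p A)%:E.
Proof. by rewrite /q => mA; rewrite asboolT. Qed.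

Let q_ge0 A : (0 <= q A)%E.
Proof. by rewrite /q; case: ifP => // /asboolP mA; rewrite lee_fin p_ge0. Qed.

Let p0 : p set0 = 0.
Proof.
have := p_add measurable0 measurable0 (setI0 (set0 : set T)); rewrite setU0.
by rewrite -[X in X = _]addr0 => /addrI.
Qed.

Let q0 : q set0 = 0%E.
Proof. by rewrite qE// p0. Qed.

Let q_sigma : semi_sigma_additive q.
Proof.
move=> F mF tF mU.
have mUn n : measurable (\big[setU/set0]_(i < n) F i) by exact: bigsetU_measurable.
have fin n : p (\big[setU/set0]_(i < n) F i) = \sum_(0 <= i < n) p (F i).
  elim: n => [|n IH]; first by rewrite big_ord0 big_geq// p0.
  have mUn' := mUn n.
  rewrite big_ord_recr/= p_add// ?IH ?big_nat_recr//=.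
  apply/seteqP; split=> // x; rewrite -bigcup_mkord => -[[j /= jn Fj] Fn].
  by have := tF j n I I (ex_intro _ x (conj Fj Fn)) => jn'; rewrite jn' ltnn in jn.
rewrite (_ : (fun n => _) = EFin \o (fun n => \sum_(0 <= i < n) p (F i))); last first.
  by apply/funext => n /=; rewrite -sumEFin; apply: eq_bigr => i _; rewrite qE.
rewrite qE//; apply: cvg_EFin; first exact: nearW.
move=> V /nbhs_ballP[e' /= e'0 e'V]; have [e e0 ee] := half_gt0 e'0.
have K1 : 0 < 1 + `|K| by rewrite ltr_pwDl.
have nd m n : (m <= n)%N -> \big[setU/set0]_(i < m) F i `<=` \big[setU/set0]_(i < n) F i.
  by move=> mn; exact: subset_bigsetU.
have [N HN] := pr_cvg_up P mUn nd (divr_gt0 e0 K1).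
exists N => // n /= Nn; apply: e'V; rewrite /ball/=; apply: (@le_lt_trans _ _ e); last lra.
have := HN n Nn.
have -> : \bigcup_n \big[setU/set0]_(i < n) F i = \bigcup_n F n.
  apply/seteqP; split=> x [i _]; first exact: bigsetU_bigcup.
  by move=> Fi; exists i.+1 => //; rewrite -bigcup_mkord; exists i => /=.
have mD : measurable (\bigcup_n F n `\` \big[setU/set0]_(i < n) F i) by exact: measurableD.
have -> : p (\bigcup_n F n) - \sum_(0 <= i < n) p (F i) =
    p (\bigcup_n F n `\` \big[setU/set0]_(i < n) F i).
  rewrite -fin; apply/eqP; rewrite subr_eq -p_add//; last by rewrite setDE -setIA setICl setI0.
  by apply/eqP; congr p; rewrite setUC setDUK//; exact: bigsetU_bigcup.
move=> h; have := p_dom mD; have := p_ge0 mD; rewrite pr_subD//; last exact: bigsetU_bigcup.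
set x := pr P _ - pr P _ => px0 px; rewrite ger0_norm//; apply: le_trans px _.
have x0 : 0 <= x by rewrite subr_ge0; apply: le_pr => //; exact: bigsetU_bigcup.
have xe : x <= e / (1 + `|K|) by rewrite /x; lra.
apply: le_trans (_ : `|K| * (e / (1 + `|K|)) <= _).
  by apply: le_trans (_ : `|K| * x <= _); [rewrite ler_wpM2r// ler_norm|rewrite ler_wpM2l].
by rewrite mulrCA ler_piMr ?(ltW e0)// ler_pdivrMr// mul1r lerDr.
Qed.

HB.instance Definition _ := isMeasure.Build _ T R q q0 q_ge0 q_sigma.

Let qT : q setT = 1%E.
Proof. by rewrite qE// pT. Qed.

HB.instance Definition _ := Measure_isProbability.Build _ T R q qT.

(** Domination by a multiple of [P] transfers continuity along increasing unions from [P] to [p], so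
    finite additivity is enough. This replaces the construction of a measure from a density. *)
Lemma exists_dominated_additive : exists Q : probability T R,
  forall A, measurable A -> pr Q A = p A.
Proof. by exists q => A mA; rewrite /pr /= qE. Qed.

End DominatedAdditive.

Section PartitionCoupling.
Variables (X Y : mmspace) (m : nat) (J : 'I_m -> set (mm_car X)) (A : 'I_m -> set (mm_car Y))
  (c : 'I_m -> R).
Local Notation mu := (mm_mu X).
Local Notation nu := (mm_mu Y).
Hypotheses (mJ : forall j, measurable (J j)) (mA : forall j, measurable (A j))
  (dJ : forall i j x, J i x -> J j x -> i = j) (dA : forall i j x, A i x -> A j x -> i = j)
  (cJ : forall x, exists j, J j x) (cA : forall x, exists j, A j x)
  (c0 : forall j, 0 <= c j) (ca : forall j, c j <= pr mu (J j))
  (cb : forall j, c j <= pr nu (A j)) (c1 : \sum_j c j < 1).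

Let a j := pr mu (J j).
Let b j := pr nu (A j).
(** A matrix with marginals [a] and [b]: [c] on the diagonal plus the product of the remaining
    masses, normalized by their common total. The strict inequality [c1] makes the division
    legitimate. *)
Let w j l := (if j == l then c j else 0) + (a j - c j) * (b l - c l) / (1 - \sum_i c i).
(** The factor by which the product measure is rescaled on a rectangle to give it mass [w j l]. On a
    null rectangle the quotient is 0, which is consistent because [w j l] vanishes there as well
    ([kab]). *)
Let k j l := w j l / (a j * b l).
Let PQ : probability (mm_car X * mm_car Y)%type R := (mu \x nu)%E.
Let p (E : set (mm_car X * mm_car Y)) : R := \sum_j \sum_l k j l * pr PQ (E `&` (J j `*` A l)).

Let prPQ B B' : measurable B -> measurable B' -> pr PQ (B `*` B') = pr mu B * pr nu B'.
Proof. by move=> mB mB'; rewrite {1}/pr /= product_measure1E// fineM ?fin_num_measure. Qed.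

Let w0 j l : 0 <= w j l.
Proof.
apply: addr_ge0; first by case: ifP.
by rewrite divr_ge0 ?mulr_ge0 ?subr_ge0// ltW.
Qed.

Let k0 j l : 0 <= k j l.
Proof. by rewrite divr_ge0// mulr_ge0// pr_ge0. Qed.

Let split_mu B : measurable B -> \sum_j pr mu (B `&` J j) = pr mu B.
Proof.
move=> mB; rewrite -pr_bigU ?index_enum_uniq//.
- congr pr; rewrite -big_distrr/=; apply/setIidPl => x _.
  by have [j Jj] := cJ x; rewrite -bigcup_seq; exists j => //=; rewrite mem_index_enum.
- by move=> j; exact: measurableI.
- by move=> i j x [_ Ji] [_ Jj]; exact: dJ Ji Jj.
Qed.

Let split_nu B : measurable B -> \sum_j pr nu (B `&` A j) = pr nu B.
Proof.
move=> mB; rewrite -pr_bigU ?index_enum_uniq//.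
- congr pr; rewrite -big_distrr/=; apply/setIidPl => x _.
  by have [j Jj] := cA x; rewrite -bigcup_seq; exists j => //=; rewrite mem_index_enum.
- by move=> j; exact: measurableI.
- by move=> i j x [_ Ji] [_ Jj]; exact: dA Ji Jj.
Qed.

Let suma : \sum_j a j = 1.
Proof. by rewrite -(prT mu) -split_mu//; apply: eq_bigr => j _; rewrite setTI. Qed.

Let sumb : \sum_j b j = 1.
Proof. by rewrite -(prT nu) -split_nu//; apply: eq_bigr => j _; rewrite setTI. Qed.

Let sub1 : 1 - \sum_i c i != 0.
Proof. by rewrite gt_eqF// subr_gt0. Qed.

Let sum_wl j : \sum_l w j l = a j.
Proof.
rewrite big_split/= -big_mkcond/= (big_pred1 j); last by move=> l; rewrite /= eq_sym.
rewrite -mulr_suml -mulr_sumr sumrB sumb mulfK//; lra.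
Qed.

Let sum_wr l : \sum_j w j l = b l.
Proof.
rewrite big_split/= -big_mkcond/= (big_pred1 l)// -mulr_suml -mulr_suml sumrB suma.
have -> : (1 - \sum_i c i) * (b l - c l) = (b l - c l) * (1 - \sum_i c i) by rewrite mulrC.
rewrite mulfK//; lra.
Qed.

Let c_null_a j : a j = 0 -> c j = 0.
Proof. by move=> aj; apply/eqP; rewrite eq_le c0 andbT -aj ca. Qed.

Let c_null_b j : b j = 0 -> c j = 0.
Proof. by move=> bj; apply/eqP; rewrite eq_le c0 andbT -bj cb. Qed.

Let w_null_a j l : a j = 0 -> w j l = 0.
Proof.
by move=> aj; rewrite /w aj (c_null_a aj) subrr !mul0r addr0; case: ifP.
Qed.

Let w_null_b j l : b l = 0 -> w j l = 0.
Proof.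
move=> bl; rewrite /w bl (c_null_b bl) subrr mulr0 mul0r addr0; case: ifP => // /eqP ->.
exact: c_null_b.
Qed.

Let kab j l : k j l * (a j * b l) = w j l.
Proof.
rewrite /k; have [aj|aj] := eqVneq (a j) 0; first by rewrite w_null_a// !mul0r.
have [bl|bl] := eqVneq (b l) 0; first by rewrite w_null_b// !mul0r.
by rewrite divfK// mulf_neq0.
Qed.

Let mJA j l : measurable (J j `*` A l : set (mm_car X * mm_car Y)).
Proof. exact: measurableX. Qed.

Let p_ge0 E : measurable E -> 0 <= p E.
Proof.
by move=> _; apply: sumr_ge0 => j _; apply: sumr_ge0 => l _; rewrite mulr_ge0// pr_ge0.
Qed.

Let p_dom E : measurable E -> p E <= (\sum_j \sum_l k j l) * pr PQ E.
Proof.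
move=> mE; rewrite mulr_suml; apply: ler_sum => j _; rewrite mulr_suml; apply: ler_sum => l _.
apply: ler_wpM2l => //; by apply: le_pr; [exact: measurableI|by []|exact: subIsetl].
Qed.

Let p_add E E' : measurable E -> measurable E' -> E `&` E' = set0 -> p (E `|` E') = p E + p E'.
Proof.
move=> mE mE' EE'; rewrite -big_split/=; apply: eq_bigr => j _; rewrite -big_split/=.
apply: eq_bigr => l _; rewrite -mulrDr setIUl prU//; [exact: measurableI|exact: measurableI|].
by rewrite setIACA EE' set0I.
Qed.

Let p_left B : measurable B -> p (B `*` setT) = pr mu B.
Proof.
move=> mB; rewrite -[RHS]split_mu//; apply: eq_bigr => j _.
have mBJ : measurable (B `&` J j) by exact: measurableI.
have E l : k j l * pr PQ (B `*` setT `&` J j `*` A l) = k j l * b l * pr mu (B `&` J j).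
  by rewrite -setXI setTI prPQ// -mulrA [b l * _]mulrC.
under eq_bigr => l _ do rewrite E.
rewrite -mulr_suml; have [aj|aj] := eqVneq (a j) 0.
  have -> : pr mu (B `&` J j) = 0 by apply: (pr_null mBJ (mJ j)).
  by rewrite mulr0.
suff -> : \sum_l k j l * b l = 1 by rewrite mul1r.
apply: (mulfI aj); rewrite mulr1 mulr_sumr -[RHS]sum_wl; apply: eq_bigr => l _.
by rewrite -[RHS]kab mulrCA.
Qed.

Let p_right B : measurable B -> p (setT `*` B) = pr nu B.
Proof.
move=> mB; rewrite -[RHS]split_nu// [LHS]exchange_big/=; apply: eq_bigr => l _.
have mBA : measurable (B `&` A l) by exact: measurableI.
have E j : k j l * pr PQ (setT `*` B `&` J j `*` A l) = k j l * a j * pr nu (B `&` A l).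
  by rewrite -setXI setTI prPQ// -mulrA.
under eq_bigr => j _ do rewrite E.
rewrite -mulr_suml; have [bl|bl] := eqVneq (b l) 0.
  have -> : pr nu (B `&` A l) = 0 by apply: (pr_null mBA (mA l)).
  by rewrite mulr0.
suff -> : \sum_j k j l * a j = 1 by rewrite mul1r.
apply: (mulIf bl); rewrite mul1r mulr_suml -[RHS]sum_wr; apply: eq_bigr => j _.
by rewrite -[RHS]kab mulrA.
Qed.

(* Mass [c j] is transported inside each rectangle, the remaining mass independently. *)
Lemma partition_coupling : exists Q : probability (mm_car X * mm_car Y)%type R,
  [/\ forall B, measurable B -> pr Q (B `*` setT) = pr mu B,
      forall B, measurable B -> pr Q (setT `*` B) = pr nu B &
      forall j, c j <= pr Q (J j `*` A j)].
Proof.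
have pT : p setT = 1 by rewrite -setXTT p_left// prT.
have [Q HQ] := exists_dominated_additive p_ge0 p_dom p_add pT.
exists Q; split.
- by move=> B mB; rewrite HQ ?p_left//; exact: measurableX.
- by move=> B mB; rewrite HQ ?p_right//; exact: measurableX.
move=> j; rewrite HQ// /p (bigD1 j)//= (bigD1 j)//= setIid -addrA.
rewrite -[leLHS]addr0; apply: lerD; last first.
  apply: addr_ge0; first by apply: sumr_ge0 => l _; rewrite mulr_ge0// pr_ge0.
  by apply: sumr_ge0 => i _; apply: sumr_ge0 => l _; rewrite mulr_ge0// pr_ge0.
rewrite prPQ// -/(a j) -/(b j) kab /w eqxx lerDl.
by rewrite divr_ge0 ?mulr_ge0 ?subr_ge0// ltW.
Qed.

End PartitionCoupling.

(** From some index on a Cauchy sequence is bounded, and its ultralimit is then its limit. *)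
Lemma real_complete (u : nat -> R) :
  (forall e : R, 0 < e -> exists N, forall m n, (N <= m)%N -> (N <= n)%N -> `|u m - u n| < e) ->
  exists x : R, forall e : R, 0 < e -> exists N, forall n, (N <= n)%N -> `|u n - x| < e.
Proof.
move=> Hu; have [N0 HN0] := Hu 1 ltr01.
pose v n := if (N0 <= n)%N then u n else u N0.
have vb n : u N0 - 1 <= v n <= u N0 + 1.
  rewrite /v; case: ifP => [Nn|_]; last by apply/andP; split; lra.
  by have := HN0 n N0 Nn (leqnn _); rewrite ltr_norml => /andP[? ?]; apply/andP; split; lra.
have [l _ Hl] := hyper_lim vb; exists l => e /half_gt0[q q0 qe].
have [N HN] := Hu q q0; exists N => n Nn.
have [m [[Nm N0m] vl]] := hyper_ex (hyper_and (hyper_and (hyper_ge N) (hyper_ge N0)) (Hl q q0)).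
have := HN n m Nn Nm; move: vl; rewrite /v N0m !ltr_norml.
by move=> /andP[? ?] /andP[? ?]; apply/andP; split; lra.
Qed.

(** * Images in sup-normed spaces and McShane extension *)

Section SupMetric.
Variable M : nat.
Local Notation V := ('I_M -> R).

Definition supd (v w : V) : R := \big[Num.max/0]_l `|v l - w l|.

Lemma supd_ge l (v w : V) : `|v l - w l| <= supd v w.
Proof. exact: le_bigmax. Qed.

Lemma supd_le (v w : V) (r : R) : 0 <= r -> (forall l, `|v l - w l| <= r) -> supd v w <= r.
Proof. by move=> r0 H; apply/bigmax_leP. Qed.

Lemma supd_lt (v w : V) (r : R) : 0 < r -> (forall l, `|v l - w l| < r) -> supd v w < r.
Proof. by move=> r0 H; apply/bigmax_ltP. Qed.

Lemma supd_ge0 (v w : V) : 0 <= supd v w.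
Proof. exact: bigmax_ge_id. Qed.

Lemma supd_metric : is_metric supd.
Proof.
split=> [v w|v w|u v w].
- split=> [vw|->].
    apply/funext => l; apply/eqP; rewrite -subr_eq0 -normr_le0 -vw; exact: supd_ge.
  by apply/eqP; rewrite eq_le supd_ge0 andbT; apply: supd_le => // l; rewrite subrr normr0.
- by apply: eq_bigr => l _; rewrite distrC.
- apply: supd_le => [|l]; first by rewrite addr_ge0// supd_ge0.
  by apply: le_trans (ler_distD (v l) _ _) _; apply: lerD; exact: supd_ge.
Qed.

Lemma supd_complete : dcomplete supd.
Proof.
move=> u Hu.
have /choice[x Hx] : forall l, exists x : R, forall e : R, 0 < e ->
    exists N, forall n, (N <= n)%N -> `|u n l - x| < e.
  move=> l; apply: (@real_complete (fun n => u n l)) => e e0; have [N HN] := Hu e e0.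
  by exists N => m n Nm Nn; apply: le_lt_trans (HN m n Nm Nn); exact: supd_ge.
exists x => e e0; have /choice[N HN] : forall l, exists N, forall n, (N <= n)%N -> `|u n l - x l| < e.
  by move=> l; exact: Hx.
exists (\max_l N l) => n Nn; apply: supd_lt => // l.
by apply: HN; apply: leq_trans Nn; exact: leq_bigmax.
Qed.

Definition sup_dense (n : nat) : V :=
  if (unpickle n : option ({ffun 'I_M -> int} * nat)) is Some c
  then fun l => (c.1 l)%:~R * eps c.2 else fun=> 0.

Lemma sup_denseP (v : V) (e : R) : 0 < e -> exists n, supd v (sup_dense n) < e.
Proof.
move=> e0; have [k /(_ k (leqnn k)) ke] := eps_small e0.
pose c := ([ffun l : 'I_M => Num.floor (v l * k.+1%:R)], k).
exists (pickle c); rewrite /sup_dense pickleK; apply: supd_lt => // l.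
rewrite ffunE /=; apply: le_lt_trans ke; have k1 : 0 < k.+1%:R :> R by [].
have ek : k.+1%:R * eps k = 1 by rewrite /eps mulfV.
have /andP[h1 h2] := floor_itv (v l * k.+1%:R).
have vE : v l = v l * k.+1%:R * eps k by rewrite -mulrA ek mulr1.
rewrite {1}vE -mulrBl normrM (gtr0_norm (eps_gt0 k)) ler_piMl ?(ltW (eps_gt0 k))//.
by move: h1 h2; rewrite intrD ler_norml => ? ?; apply/andP; split; lra.
Qed.

End SupMetric.

(** Full support of [X] and the Lipschitz bound put every value of [g] in the support of the image
    measure, so [emb (h x) = g x] holds everywhere and [h] is 1-Lipschitz without exception. *)
Lemma sup_image (X : mmspace) (M : nat) (g : mm_car X -> 'I_M -> R) :
  (forall l x x', `|g x l - g x' l| <= mm_dist x x') ->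
  exists (W : mmspace) (h : mm_car X -> mm_car W) (emb : mm_car W -> 'I_M -> R),
    [/\ lip1 h, forall B, measurable B -> pr (mm_mu X) (h @^-1` B) = pr (mm_mu W) B,
      forall w w', mm_dist w w' = supd (emb w) (emb w') & forall x, emb (h x) = g x].
Proof.
move=> gl.
have gd x x' : supd (g x) (g x') <= mm_dist x x' by apply: supd_le; [exact: mm_ge0|].
have mG v e : measurable (g @^-1` dball (@supd M) v e).
  apply: measurable_dopen => x; rewrite /dball/= => vx.
  exists (e - supd v (g x)); first by rewrite subr_gt0.
  move=> y; rewrite /dball/= => xy; have := met_tri (@supd_metric M) (g x) v (g y).
  by have := gd x y; lra.
have [h [emb [N [mh ph hE _ [_ embh]]]]] :=
  image_mmP (mm_mu X) (@supd_metric M) (@supd_complete M) (@sup_denseP M) mG.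
set W := image_mm _ _ _ _ _ in h emb mh ph hE embh.
have eh x : emb (h x) = g x.
  apply: embh => e e0; have := mm_fullsupp x e0; rewrite prE ?lte_fin; last exact: measurable_dball.
  move=> /lt_le_trans; apply; apply: le_pr => //; first exact: measurable_dball.
  by move=> y; rewrite /dball/= => xy; apply: le_lt_trans (gd x y) xy.
by exists W, h, emb; split => // x x'; rewrite hE !eh.
Qed.

Section McShane.
Variables (X Y : mmspace) (M : nat) (J : nat -> set (mm_car X)) (s : nat -> mm_car Y) (t : R).
Hypotheses (t0 : 0 <= t) (far_J : forall i j x x', (i < M)%N -> (j < M)%N ->
  J i x -> J j x' -> mm_dist (s i) (s j) - t <= mm_dist x x').
Hypothesis J_ex : exists j, (j < M)%N /\ exists x, J j x.

Let vals (x : mm_car X) (l : nat) : set R :=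
  [set r | exists j z, [/\ (j < M)%N, J j z & r = mm_dist (s j) (s l) + mm_dist x z]].

(** McShane's extension of the partial function with value [mm_dist (s j) (s l)] on [J j]. That
    function is 1-Lipschitz only up to [t], so the extension is exactly 1-Lipschitz and is off by at
    most [t] on the pieces ([mcshane_near]). *)
Definition mcshane (x : mm_car X) (l : nat) : R := inf (vals x l).

Let vals0 x l : vals x l !=set0.
Proof. by have [j [jM [z Jz]]] := J_ex; exists (mm_dist (s j) (s l) + mm_dist x z), j, z. Qed.

Let vals_lb x l : has_lbound (vals x l).
Proof. by exists 0 => _ [j [z [_ _ ->]]]; rewrite addr_ge0// mm_ge0. Qed.

Lemma mcshane_lip l x x' : `|mcshane x l - mcshane x' l| <= mm_dist x x'.
Proof.
have H a b : mcshane a l - mm_dist a b <= mcshane b l.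
  apply: lb_le_inf => // _ [j [z [jM Jz ->]]]; rewrite lerBlDr.
  apply: le_trans (_ : mm_dist (s j) (s l) + mm_dist a z <= _).
    by apply: ge_inf => //; exists j, z.
  by have := mm_tri b a z; lra.
by have := H x x'; have := H x' x; rewrite (mm_sym x') ler_norml => ? ?; apply/andP; split; lra.
Qed.

Lemma mcshane_near i l x : (i < M)%N -> (l < M)%N -> J i x ->
  `|mcshane x l - mm_dist (s i) (s l)| <= t.
Proof.
move=> iM lM Jx; rewrite ler_norml; apply/andP; split.
  rewrite lerBrDl; apply: lb_le_inf => // _ [j [z [jM Jz ->]]].
  by have := far_J iM jM Jx Jz; have := mm_tri (s j) (s i) (s l); lra.
rewrite lerBlDl; apply: le_trans (_ : mm_dist (s i) (s l) + mm_dist x x <= _).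
  by apply: ge_inf => //; exists i, x.
by rewrite mm_xx addr0 lerDl.
Qed.

End McShane.

(** [W] is the image of [X] under the McShane functions. It sends [J j] within [t] of the vector of
    distances from the [j]-th dense point to the first [M] ones. The coupling matches [J j] with
    [cell q j] on mass [c j]; the distortion there is at most [t] for each point of [W] and [q] for
    each point of [Y]. *)
Lemma box_le_matching (X Y : mmspace) (M : nat) (J : nat -> set (mm_car X)) (c : nat -> R)
    (q t : R) : 0 < q -> 0 <= t ->
  (forall j, measurable (J j)) ->
  (forall i j x, (i < M)%N -> (j < M)%N -> J i x -> J j x -> i = j) ->
  (forall i j x x', (i < M)%N -> (j < M)%N -> J i x -> J j x' ->
    mm_dist (mm_dense Y i) (mm_dense Y j) - t <= mm_dist x x') ->
  (exists j, (j < M)%N /\ exists x, J j x) ->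
  (forall j, 0 <= c j) ->
  (forall j, (j < M)%N -> c j <= pr (mm_mu X) (J j)) ->
  (forall j, (j < M)%N -> c j <= pr (mm_mu Y) (cell q j)) ->
  \sum_(j < M) c j < 1 ->
  exists2 W, dominated W X &
    (box W Y <= maxe (t + t + q + q)%:E (1 - \sum_(j < M) c j)%:E)%E.
Proof.
move=> q0 t0 mJ dJ fJ J_ex c0 cJ cA c1; set s := mm_dense Y in fJ *.
pose g (x : mm_car X) (l : 'I_M) : R := mcshane M J s x l.
have gl l x x' : `|g x l - g x' l| <= mm_dist x x' by exact: mcshane_lip.
have [W [h [emb [lh ph hE eh]]]] := sup_image gl.
(* Index [M] stands for the complement of all pieces. This makes both families partitions, and
   nothing is matched on that last index. *)
pose JJ (j : 'I_M.+1) : set (mm_car X) :=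
  if (j < M)%N then J j else ~` \bigcup_(i < M) J i.
pose AA (j : 'I_M.+1) : set (mm_car Y) :=
  if (j < M)%N then cell q j else ~` \bigcup_(i < M) cell q i.
pose cc (j : 'I_M.+1) : R := if (j < M)%N then c j else 0.
have sumcc : \sum_j cc j = \sum_(j < M) c j.
  rewrite big_ord_recr/= {2}/cc ltnn addr0; apply: eq_bigr => j _.
  by rewrite /cc /= ltn_ord.
have part T (B : nat -> set T) : (forall i j x, (i < M)%N -> (j < M)%N -> B i x -> B j x -> i = j) ->
    let BB (j : 'I_M.+1) : set T := if (j < M)%N then B j else ~` \bigcup_(i < M) B i in
    (forall i j x, BB i x -> BB j x -> i = j) /\ (forall x, exists j, BB j x).
  move=> dB BB; split=> [i j x|x].
    rewrite /BB; case: ifP => iM; case: ifP => jM.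
    - by move=> Bi Bj; apply: ord_inj; exact: dB Bi Bj.
    - by move=> Bi nB; exfalso; apply: nB; exists i.
    - by move=> nB Bj; exfalso; apply: nB; exists j.
    - move=> _ _; apply: ord_inj; have := ltn_ord i; have := ltn_ord j.
      rewrite !ltnS => jM' iM'; apply/eqP; rewrite eqn_leq; apply/andP; split.
        by apply: leq_trans iM' _; rewrite leqNgt jM.
      by apply: leq_trans jM' _; rewrite leqNgt iM.
  have [[j /= jM Bj]|nB] := pselect ((\bigcup_(i < M) B i) x).
    by exists (widen_ord (leqnSn M) (Ordinal jM)); rewrite /BB /= jM.
  by exists ord_max; rewrite /BB /= ltnn.
have [dJJ cJJ] := part _ J dJ.
have [dAA cAA] := part _ (@cell Y q) (fun i j x _ _ ci cj => cell_inj ci cj).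
have mU : measurable (\bigcup_(i < M) J i) by apply: bigcup_measurable => i _; exact: mJ.
have mJJ j : measurable (JJ j) by rewrite /JJ; case: ifP => _ //; exact: measurableC.
have mAA j : measurable (AA j).
  by rewrite /AA; case: ifP => _;
    [exact: measurable_cell|apply: measurableC; exact: measurable_cells].
have cc0 j : 0 <= cc j by rewrite /cc; case: ifP.
have ccJ j : cc j <= pr (mm_mu X) (JJ j).
  by rewrite /cc /JJ; case: ifP => jM; [exact: cJ|exact: pr_ge0].
have ccA j : cc j <= pr (mm_mu Y) (AA j).
  by rewrite /cc /AA; case: ifP => jM; [exact: cA|exact: pr_ge0].
have cc1 : \sum_j cc j < 1 by rewrite sumcc.
have [Q [Q1 Q2 Qc]] := partition_coupling mJJ mAA dJJ dAA cJJ cAA cc0 ccJ ccA cc1.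
have mh := measurable_lip1 lh.
pose H (z : mm_car X * mm_car Y) : (mm_car W * mm_car Y)%type := (h z.1, z.2).
have mH B : measurable B -> measurable (H @^-1` B).
  move=> mB; rewrite -[X in measurable X]setTI.
  have mh' : measurable_fun setT h by move=> _ B' mB'; rewrite setTI; exact: mh.
  have : measurable_fun setT H.
    by apply: measurable_fun_pair; [exact: measurableT_comp mh' measurable_fst|exact: measurable_snd].
  by apply.
have [Q' HQ'] := exists_pushforward Q mH.
pose p (j l : nat) : R := mm_dist (s j) (s l).
pose B j : set (mm_car W) := [set w | supd (emb w) (fun l : 'I_M => p j l) <= t].
have mB j : measurable (B j).
  rewrite -[B j]setCK; apply: measurableC; apply: measurable_dopen => w /=.
  rewrite /B /= => /negP; rewrite -ltNge => tw.
  exists (supd (emb w) (fun l : 'I_M => p j l) - t); first by rewrite subr_gt0.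
  move=> w'; rewrite /dball/= hE => ww' w't.
  by have := met_tri (@supd_metric M) (emb w') (emb w) (fun l : 'I_M => p j l); lra.
have hB j x : (j < M)%N -> J j x -> B j (h x).
  move=> jM Jx; rewrite /B/= eh; apply: supd_le => // l.
  by have := mcshane_near t0 fJ J_ex jM (ltn_ord l) Jx.
(* The distance vectors embed the first [M] dense points isometrically; the supremum is attained at
   coordinate [j]. *)
have pp i j : (i < M)%N -> (j < M)%N ->
    supd (fun l : 'I_M => p i l) (fun l : 'I_M => p j l) = mm_dist (s i) (s j).
  move=> iM jM; apply/eqP; rewrite eq_le; apply/andP; split.
    apply: supd_le; first exact: mm_ge0.
    by move=> l; exact: (met_dist (mm_metric Y)).
  apply: le_trans (supd_ge (Ordinal jM) _ _); rewrite /p /= mm_xx subr0.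
  exact: ler_norm.
pose S : set (mm_car W * mm_car Y) := \bigcup_(j < M) (B j `*` cell q j).
have mS : measurable S.
  apply: bigcup_measurable => j _; apply: measurableX => //; exact: measurable_cell.
exists W; first by apply/dominatedP; exists h.
apply: (@le_trans _ _ (maxe (@dis W Y S) (1 - Q' S)%E)).
  apply: ereal_inf_lbound; exists Q', S; split => //; split => E mE; rewrite HQ'.
    have -> : H @^-1` (E `*` setT) = (h @^-1` E) `*` setT by [].
    rewrite prE; last by apply: measurableX => //; exact: mh.
    by rewrite Q1 ?ph ?prE//; exact: mh.
  have -> : H @^-1` (setT `*` E) = setT `*` E by [].
  by rewrite prE ?Q2 ?prE//; exact: measurableX.
rewrite ge_max !le_max; apply/andP; split; apply/orP; [left|right].
  apply: ge_ereal_sup => _ [[w y] [i /= iM [Bi ci]] [[w' y'] [j /= jM [Bj cj]] <-]].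
  rewrite lee_fin hE /=.
  have := cell_dist ci; have := cell_dist cj; have := pp i j iM jM.
  rewrite /B /= in Bi Bj.
  have h1 := met_tri (@supd_metric M) (fun l : 'I_M => p i l) (emb w) (emb w').
  have h2 := met_tri (@supd_metric M) (fun l : 'I_M => p j l) (fun l : 'I_M => p i l) (emb w').
  have h3 := met_tri (@supd_metric M) (emb w) (fun l : 'I_M => p i l) (fun l : 'I_M => p j l).
  have h4 := met_tri (@supd_metric M) (emb w') (emb w) (fun l : 'I_M => p j l).
  move: h1 h2 h3 h4; rewrite (met_sym (@supd_metric M) (fun l : 'I_M => p j l) (emb w')).
  rewrite (met_sym (@supd_metric M) (fun l : 'I_M => p i l) (emb w)).
  have := mm_tri (s i) y y'; have := mm_tri (s j) (s i) y'.
  have := mm_tri y (s i) (s j); have := mm_tri y' y (s j).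
  rewrite (mm_sym y (s i)) (mm_sym y' (s j)) -/s.
  by move=> *; rewrite ler_norml; apply/andP; split; lra.
rewrite prE// -EFinB lee_fin lerD2l lerN2.
have -> : pr Q' S = pr Q (H @^-1` S) by rewrite /pr HQ'.
have mR j : measurable (J j `*` cell q j : set (mm_car X * mm_car Y)).
  by apply: measurableX => //; exact: measurable_cell.
have jj (j : 'I_M) : (widen_ord (leqnSn M) j < M)%N by rewrite /=.
apply: le_trans (_ : \sum_(j < M) pr Q (J j `*` cell q j) <= _).
  apply: ler_sum => j _; have := Qc (widen_ord (leqnSn M) j).
  by rewrite /cc /JJ /AA /= ltn_ord.
rewrite -pr_bigU ?index_enum_uniq//; last first.
  by move=> i j x [_ ci] [_ cj]; apply: ord_inj; exact: cell_inj ci cj.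
rewrite -(bigcup_mkord M (fun j => J j `*` cell q j)); apply: le_pr;
  [by apply: bigcup_measurable => j _|exact: mH|].
by move=> [x y] [j /= jM [/= Jx cy]]; exists j => //; split => //=; exact: hB.
Qed.

(** Internal subsets of the preimages of finitely many cells of [Y] give, at almost every index,
    pieces of [X n] that match these cells in mass and distances. So some space dominated by [X n],
    hence in [P], is box-close to [Y]. *)
Lemma pyr_full_sub (P : mmspace -> Prop) (X : nat -> mmspace) (Y : mmspace) : pyramid P ->
  (forall n, P (X n)) -> pyr (setT : set (loeb X)) Y -> P Y.
Proof.
move=> [_ boxP downP _] PX [F [N [mF [mN N0] lipF lawF]]]; apply: boxP => e e0.
suff [n [W WX bW]] : exists n, exists2 W, dominated W (X n) & (box W Y < e%:E)%E.
  by exists W; split => //; exact: downP (PX n) WX.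
(* Below, [e'] equals [16 q], against a distortion of at most [6 q] and unmatched mass of at most
   [4 q]. The bound [e' <= 1] keeps the matched mass positive, so that some piece is inhabited. *)
have [e' [e'0 e'e e'1]] := min_gt0 e0 (ltr01 : 0 < 1 :> R).
have [r' r'0 re] := half_gt0 e'0.
have [r r0 rr] := quarter_gt0 r'0; have [q q0 qr] := half_gt0 r0.
have [d [d0 dq d1]] := min_gt0 q0 (ltr01 : 0 < 1 :> R).
have [M HM] := cells_tight Y q0 q0.
have [dl dl0 mdl] : exists2 dl : R, 0 < dl & M%:R * dl <= q.
  exists (q / M.+1%:R); first by rewrite divr_gt0.
  by rewrite mulrCA ler_piMr ?(ltW q0)// ler_pdivrMr// mul1r ler_nat.
pose E j := (F @^-1` cell q j) `\` N.
have mE j : measurable (E j) by apply: measurableD => //; apply: mF; exact: measurable_cell.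
have prE' j : pr (loeb_prob X) (E j) = pr (mm_mu Y) (cell q j).
  have mFc : measurable (F @^-1` cell q j) by apply: mF; exact: measurable_cell.
  rewrite prD// [X in _ - X](_ : _ = 0); last first.
    by apply: (pr_null (B := N)) => //; exact: measurableI.
  by rewrite subr0 -(setTI (F @^-1` _)) lawF ?prT ?mul1r//; exact: measurable_cell.
pose J j := projT1 (cid (loeb_inner (mE j) dl0)).
have [mJ JE prJ] : [/\ forall j n, measurable (J j n), forall j, internal (J j) `<=` E j &
    forall j, pr (mm_mu Y) (cell q j) - dl <= pr (loeb_prob X) (internal (J j))].
  split=> j; have [m1 s1 p1] := projT2 (cid (loeb_inner (mE j) dl0)) => //.
  by move: p1; rewrite -/(J j); have := prE' j; lra.
have h2 : \forall n \near hyper, forall i j : 'I_M, i != j -> J i n `&` J j n = set0.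
  apply: hyper_forall_ord => i; apply: hyper_forall_ord => j.
  have [->|ij] := eqVneq i j; first by apply: filterE => n /eqP[].
  have : internal (fun n => J i n `&` J j n) = internal (fun n => set0).
    rewrite internal0 internalI; apply/seteqP; split=> // x [/JE[Ei _] /JE[Ej _]].
    by move: ij; rewrite (ord_inj (cell_inj Ei Ej)) eqxx.
  by move=> /internal_eq; apply: filterS.
have h3 : \forall n \near hyper, forall j : 'I_M,
    `|pr (mm_mu (X n)) (J j n) - pr (loeb_prob X) (internal (J j))| < dl.
  by apply: hyper_forall_ord => j; exact: loeb_internal.
have h4 : \forall n \near hyper, forall i j : 'I_M, forall x x', J i n x -> J j n x' ->
    mm_dist (mm_dense Y i) (mm_dense Y j) - (q + q) <= mm_dist x x'.
  apply: hyper_forall_ord => i; apply: hyper_forall_ord => j; apply: far_internal => x x'.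
  move=> /JE[Ei nx] /JE[Ej nx']; apply: lipF => //.
  have := cell_dist Ei; have := cell_dist Ej.
  have := mm_tri (F x) (mm_dense Y i) (mm_dense Y j).
  by have := mm_tri_r (F x') (F x) (mm_dense Y j); lra.
have [n [{}h2 [{}h3 {}h4]]] := hyper_ex (hyper_and h2 (hyper_and h3 h4)).
exists n.
have /choice[c0 Hc0] : forall j, exists x : R, [/\ 0 <= x,
    pr (mm_mu Y) (cell q j) - dl - dl <= x, x <= pr (mm_mu Y) (cell q j) &
    (j < M)%N -> x <= pr (mm_mu (X n)) (J j n)].
  move=> j; exists (Num.max 0 (pr (mm_mu Y) (cell q j) - dl - dl)).
  rewrite !le_max !ge_max !lexx orbT !pr_ge0; split => //; first by lra.
  move=> jM; have := h3 (Ordinal jM); have := prJ j.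
  by rewrite ltr_norml /= => ? /andP[? ?]; lra.
(* The factor makes the total strictly less than 1, as the coupling of the remaining masses
   requires. *)
pose c j := (1 - d) * c0 j.
have sumY : \sum_(j < M) pr (mm_mu Y) (cell q j) = pr (mm_mu Y) (\bigcup_(j < M) cell q j).
  rewrite bigcup_mkord pr_bigU ?index_enum_uniq//; first by move=> j; exact: measurable_cell.
  by move=> i j x ci cj; apply: ord_inj; exact: cell_inj ci cj.
have sum1 : \sum_(j < M) c0 j <= 1.
  apply: le_trans (_ : \sum_(j < M) pr (mm_mu Y) (cell q j) <= _).
    by apply: ler_sum => j _; have [] := Hc0 j.
  by rewrite sumY pr_le1//; exact: measurable_cells.
have sum2 : 1 - q - q - q <= \sum_(j < M) c0 j.
  have : \sum_(j < M) (pr (mm_mu Y) (cell q j) - dl - dl) <= \sum_(j < M) c0 j.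
    by apply: ler_sum => j _; have [] := Hc0 j.
  have : \sum_(j < M) dl <= q by rewrite sumr_const card_ord -mulr_natl.
  by rewrite !sumrB sumY; lra.
have sumc : \sum_(j < M) c j = (1 - d) * \sum_(j < M) c0 j by rewrite -mulr_sumr.
have c_lt1 : \sum_(j < M) c j < 1.
  rewrite sumc; apply: (@le_lt_trans _ _ (1 - d)); last lra.
  by rewrite ler_piMr// subr_ge0.
have c_ge : 1 - q - q - q - q <= \sum_(j < M) c j.
  rewrite sumc mulrBl mul1r.
  have : d * \sum_(j < M) c0 j <= d by rewrite ler_piMr// ltW.
  by lra.
have c_le j : c j <= c0 j.
  by rewrite /c mulrBl mul1r; have [H _ _ _] := Hc0 j; have := mulr_ge0 (ltW d0) H; lra.
have [|||||||||W WX bW] := @box_le_matching (X n) Y M (fun j => J j n) c q (q + q) q0.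
- by lra.
- by move=> j; exact: mJ.
- move=> i j x iM jM Ji Jj; apply/eqP/negPn/negP => ij.
  have /seteqP[/(_ x) H0 _] := h2 (Ordinal iM) (Ordinal jM) ij.
  by apply: H0.
- by move=> i j x x' iM jM; exact: (h4 (Ordinal iM) (Ordinal jM)).
- apply: contrapT => nJ; suff : \sum_(j < M) c j <= 0 by lra.
  apply: sumr_le0 => j _.
  have J0 : J j n = set0.
    by apply/seteqP; split=> // x Jx; apply: nJ; exists j; split => //; exists x.
  by have [_ _ _ /(_ (ltn_ord j))] := Hc0 j; rewrite J0 pr0; apply: le_trans; exact: c_le.
- by move=> j; have [? _ _ _] := Hc0 j; rewrite mulr_ge0// subr_ge0.
- by move=> j jM; apply: le_trans (c_le j) _; have [_ _ _] := Hc0 j; apply.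
- by move=> j jM; apply: le_trans (c_le j) _; have [] := Hc0 j.
- exact: c_lt1.
exists W => //; apply: le_lt_trans bW _.
by rewrite gt_max !lte_fin; apply/andP; split; lra.
Qed.

(** * Atoms and nonatomic parts *)

Section Atoms.
Context (disp : measure_display) (T : measurableType disp) (P : probability T R)
  (F : set (set T)).
Hypotheses (F_meas : forall A, F A -> measurable A) (FT : F setT)
  (FC : forall A, F A -> F (~` A))
  (FU : forall A : nat -> set T, (forall n, F (A n)) -> F (\bigcup_n A n)).

Definition atom (A : set T) : Prop :=
  [/\ F A, 0 < pr P A & forall B, F B -> B `<=` A -> pr P B = 0 \/ pr P B = pr P A].

Lemma sub_sigma0 : F set0.
Proof. by rewrite -setCT; exact: FC. Qed.

Lemma sub_sigmaU A B : F A -> F B -> F (A `|` B).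
Proof. by move=> FA FB; rewrite -bigcup2E; apply: FU => -[|[|n]] //=; exact: sub_sigma0. Qed.

Lemma sub_sigmaI A B : F A -> F B -> F (A `&` B).
Proof.
by move=> FA FB; rewrite -[A `&` B]setCK setCI; apply/FC/sub_sigmaU; exact: FC.
Qed.

Lemma sub_sigmaD A B : F A -> F B -> F (A `\` B).
Proof. by move=> FA FB; rewrite setDE; apply: sub_sigmaI => //; exact: FC. Qed.

Lemma nat_unbounded (a : R) : 0 < a -> ~ forall n : nat, n%:R * a <= 1.
Proof.
move=> a0 H; have [k /(_ k (leqnn k)) ka] := eps_small a0.
have := H k.+1; apply/negP; rewrite -ltNge -ltr_pdivrMl// mulr1; exact: ka.
Qed.

Section NonAtomic.
Variable C : set T.
Hypothesis noatom : forall B, atom B -> ~ B `<=` C.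

Let halve A : F A -> A `<=` C -> 0 < pr P A ->
  exists B, [/\ F B, B `<=` A, 0 < pr P B & pr P B + pr P B <= pr P A].
Proof.
move=> FA AC A0.
have [B [FB BA B0 BA']] : exists B, [/\ F B, B `<=` A, pr P B <> 0 & pr P B <> pr P A].
  apply: contrapT => nB; apply: (noatom _ AC); split => // B FB BA.
  have [|B0] := pselect (pr P B = 0); [by left|right].
  by apply: contrapT => BA'; apply: nB; exists B.
have mA := F_meas FA; have mB := F_meas FB.
have B0' : 0 < pr P B by rewrite lt_def pr_ge0 andbT; apply/eqP.
have AB : pr P (A `\` B) = pr P A - pr P B by rewrite pr_subD.
have ltBA : pr P B < pr P A.
  by rewrite lt_def (le_pr _ mB mA BA) andbT; apply/eqP => /esym.
have [h|h] := leP (pr P B + pr P B) (pr P A); first by exists B.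
by exists (A `\` B); rewrite AB; split; [exact: sub_sigmaD|move=> x []|lra|lra].
Qed.

Let small A k : F A -> A `<=` C -> 0 < pr P A ->
  exists B, [/\ F B, B `<=` A, 0 < pr P B & pr P B <= eps k].
Proof.
move=> FA AC A0; elim: k => [|k [B [FB BA B0 Bk]]].
  by exists A; split => //; rewrite /eps invr1; apply: pr_le1; exact: F_meas.
have [D [FD DB D0 Dk]] := halve FB (subset_trans BA AC) B0.
exists D; split => //; first exact: subset_trans DB BA.
suff : eps k <= eps k.+1 + eps k.+1 by lra.
rewrite -mulr2n -mulr_natl /eps ler_pdivlMr// mulrC ler_pdivrMr// -natrM ler_nat.
by rewrite mulSn mul1n !addSn !addnS !ltnS leq_addr.
Qed.

Let near_max (Q : set T -> Prop) : (forall D, Q D -> F D) -> Q set0 ->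
  exists2 D, Q D & forall D', Q D' -> pr P D' <= pr P D + pr P D.
Proof.
move=> QF Q0; pose S := [set r | exists2 D, Q D & r = pr P D].
have S0 : S 0 by exists set0 => //; rewrite pr0.
have hS : has_sup S.
  split; first by exists 0.
  by exists 1 => _ [D QD ->]; apply: pr_le1; exact/F_meas/QF.
have ubS D : Q D -> pr P D <= sup S by move=> QD; apply: sup_upper_bound => //; exists D.
have : 0 <= sup S by exact: sup_upper_bound.
rewrite le_eqVlt => /orP[/eqP s0|s0].
  by exists set0 => // D' /ubS; rewrite -s0 pr0 addr0.
have [h h0 hh] := half_gt0 s0.
have [_ [D QD ->] hD] := sup_adherent h0 hS.
by exists D => // D' /ubS; lra.
Qed.

(** Greedy exhaustion: each step adds a set of at least half the largest mass that does not
    overshoot [t]. If the union fell short of [t], a small set [E] of positive mass would stay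
    admissible at every step, each step would add at least half of its mass, and the total would be
    unbounded. *)
Lemma nonatomic_split A (t : R) : F A -> A `<=` C -> 0 <= t <= pr P A ->
  exists B, [/\ F B, B `<=` A & pr P B = t].
Proof.
move=> FA AC /andP[t0 tA].
pose Q B D := [/\ F D, D `<=` A `\` B & pr P B + pr P D <= t].
have step (B : set T) : exists D, pr P B <= t -> Q B D /\
    forall D', Q B D' -> pr P D' <= pr P D + pr P D.
  have [Bt|nBt] := pselect (pr P B <= t); last by exists set0.
  have [||D QD HD] := @near_max (Q B).
  - by move=> D [].
  - by split; [exact: sub_sigma0|exact: sub0set|rewrite pr0 addr0].
  - by exists D.
have {}[D HD] := choice step.
pose B := nat_rect (fun=> set T) set0 (fun _ B => B `|` D B).
have BP n : [/\ F (B n), B n `<=` A & pr P (B n) <= t].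
  elim: n => [|n [FB BA Bt]]; first by rewrite /= pr0; split => //; exact: sub_sigma0.
  have [[FD DA Dt] _] := HD _ Bt; split; first exact: sub_sigmaU.
    by move=> x [/BA//|/DA[]].
  by apply: le_trans (prU_le _ _ _) Dt; exact: F_meas.
have mB n : measurable (B n) by apply: F_meas; have [] := BP n.
have ndB m n : (m <= n)%N -> B m `<=` B n.
  move=> /subnK <-; elim: (n - m)%N => [|k IH]; first by rewrite add0n.
  by apply: subset_trans IH _; rewrite addSn; exact: subsetUl.
have FB : F (\bigcup_n B n) by apply: FU => n; have [] := BP n.
have BA : \bigcup_n B n `<=` A by move=> x [n _]; have [_ + _] := BP n; apply.
exists (\bigcup_n B n); split => //.
have Bt : pr P (\bigcup_n B n) <= t.
  apply/ler_addgt0Pr => e e0; have [N /(_ N (leqnn N))] := pr_cvg_up P mB ndB e0.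
  by have [_ _] := BP N; lra.
apply/eqP; rewrite eq_le Bt /= leNgt; apply/negP => Bt'.
have mU := F_meas FB; have mA := F_meas FA.
have AB : 0 < pr P (A `\` \bigcup_n B n) by rewrite pr_subD//; lra.
have d0 : 0 < t - pr P (\bigcup_n B n) by rewrite subr_gt0.
have [k /(_ k (leqnn k)) kd] := eps_small d0.
have [E [FE EA E0 Ek]] := small k (sub_sigmaD FA FB) (subset_trans (@subDsetl _ _ _) AC) AB.
have QE n : Q (B n) E.
  split => //; first by apply: subset_trans EA _; apply: setDS; exact: bigcup_sup.
  have : pr P (B n) <= pr P (\bigcup_n B n) by apply: le_pr => //; exact: bigcup_sup.
  by lra.
have [h h0 hE] := half_gt0 E0.
apply: (nat_unbounded h0) => n; apply: le_trans (_ : pr P (B n) <= _); last exact: pr_le1.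
elim: n => [|n IH]; first by rewrite mul0r pr_ge0.
have [_ _ Bnt] := BP n; have [[FD DA _] /(_ _ (QE n)) DE] := HD _ Bnt.
rewrite [B n.+1]/= prU//; first by rewrite -natr1 mulrDl mul1r; lra.
  exact: F_meas.
by apply/seteqP; split=> // x [Bx /DA[]].
Qed.

End NonAtomic.

Let atom_meet A B : atom A -> atom B -> pr P A <> pr P B -> pr P (A `&` B) = 0.
Proof.
move=> [FA A0 HA] [FB B0 HB] AB.
have [//|h1] := HA _ (sub_sigmaI FA FB) (@subIsetl _ _ _).
by have [//|h2] := HB _ (sub_sigmaI FA FB) (@subIsetr _ _ _); case: AB; rewrite -h1.
Qed.

(** Without a maximum there would be a sequence of atoms of strictly increasing mass. Atoms of
    different mass meet in null sets, so the total mass would be unbounded. *)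
Lemma max_atom (C : set T) : (exists2 A, atom A & A `<=` C) ->
  exists A, [/\ atom A, A `<=` C & forall B, atom B -> B `<=` C -> pr P B <= pr P A].
Proof.
move=> [A0 aA0 A0C]; apply: contrapT => nmax.
have step (A : {A | atom A /\ A `<=` C}) : exists B : {A | atom A /\ A `<=` C},
    pr P (sval A) < pr P (sval B).
  apply: contrapT => nB; apply: nmax; exists (sval A); have [aA AC] := svalP A; split => //.
  move=> B aB BC; rewrite leNgt; apply/negP => AB; apply: nB.
  by exists (exist _ B (conj aB BC)).
have [f Hf] := choice step.
pose A n := sval (iter n f (exist _ A0 (conj aA0 A0C))).
have aA n : atom (A n) by have [] := svalP (iter n f (exist _ A0 (conj aA0 A0C))).
have incr m n : (m < n)%N -> pr P (A m) < pr P (A n).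
  elim: n => // n IH; rewrite ltnS leq_eqVlt => /orP[/eqP ->|/IH h]; first exact: Hf.
  by apply: lt_trans h _; exact: Hf.
have mA n : measurable (A n) by apply: F_meas; have [] := aA n.
have A00 : 0 < pr P A0 by have [] := aA0.
have mU n : measurable (\big[setU/set0]_(i < n) A i) by exact: bigsetU_measurable.
apply: (nat_unbounded A00) => n.
apply: le_trans (_ : pr P (\big[setU/set0]_(i < n) A i) <= _); last exact: pr_le1.
elim: n => [|n IH]; first by rewrite mul0r pr_ge0.
have null : pr P (\big[setU/set0]_(i < n) A i `&` A n) = 0.
  rewrite big_distrl/=; apply/eqP; rewrite eq_le pr_ge0 andbT.
  apply: le_trans (pr_bigU_le _ _ _ _) _; first by move=> i; exact: measurableI.
  apply: sumr_le0 => i _; rewrite atom_meet//; apply/eqP; rewrite lt_eqF//; exact: incr.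
have A0n : pr P A0 <= pr P (A n).
  by case: n {IH null} => [|n]; rewrite ?lexx//; apply/ltW/(incr 0%N).
rewrite big_ord_recr/= -natr1 mulrDl mul1r.
have -> : \big[setU/set0]_(i < n) A i `|` A n =
    A n `|` (\big[setU/set0]_(i < n) A i `\` A n) by rewrite setUC setDE setUIr setUCr setIT.
have mUn := mU n; rewrite prU//; [|exact: measurableD|by rewrite setDE setICA setICr setI0].
by rewrite prD// null subr0; lra.
Qed.

(* When there are finitely many atoms, the sequence is padded with empty sets. *)
Lemma atomic_decomposition : exists C : nat -> set T, [/\
  forall n, F (C n),
  forall i j x, C i x -> C j x -> i = j,
  forall n, atom (C n) \/ (C n = set0 /\ C n.+1 = set0),
  forall n, pr P (C n.+1) <= pr P (C n) &
  forall B, atom B -> ~ B `<=` ~` \bigcup_n C n].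
Proof.
have pick (S : set T) : exists A, (exists2 A, atom A & A `<=` S) ->
    [/\ atom A, A `<=` S & forall B, atom B -> B `<=` S -> pr P B <= pr P A].
  have [/max_atom[A HA]|nA] := pselect (exists2 A, atom A & A `<=` S); first by exists A.
  by exists set0.
have [f Hf] := choice pick.
pose g (S : set T) : set T := if pselect (exists2 A, atom A & A `<=` S) then f S else set0.
have gP S : (exists2 A, atom A & A `<=` S) ->
    [/\ atom (g S), g S `<=` S & forall B, atom B -> B `<=` S -> pr P B <= pr P (g S)].
  by move=> h; rewrite /g; case: pselect => // h'; exact: Hf.
have g0 S : ~ (exists2 A, atom A & A `<=` S) -> g S = set0 by rewrite /g; case: pselect.
have gS S : g S `<=` S.
  have [/gP[]//|/g0 ->] := pselect (exists2 A, atom A & A `<=` S); exact: sub0set.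
(* [S n] is what remains after [n] atoms have been removed; the next one is an atom of largest mass
   inside it. *)
pose S := nat_rect (fun=> set T) setT (fun _ S => S `\` g S).
pose C n := g (S n).
have FCn n : F (C n).
  rewrite /C; have [/gP[[]]//|/g0 ->] := pselect (exists2 A, atom A & A `<=` S n).
  exact: sub_sigma0.
have SE n : S n.+1 = S n `\` C n by [].
have ndS m n : (m <= n)%N -> S n `<=` S m.
  move=> /subnK <-; elim: (n - m)%N => [|k IH]; first by rewrite add0n.
  by apply: subset_trans IH; rewrite addSn SE; exact: subDsetl.
have dC i j x : (i < j)%N -> C i x -> C j x -> False.
  by move=> ij Ci /gS/(ndS _ _ ij) => -[_ /(_ Ci)].
exists C; split => //.
- by move=> i j x Ci Cj; case: (ltngtP i j) => // ij; exfalso; [exact: dC ij Ci Cj|exact: dC ij Cj Ci].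
- move=> n; rewrite /C; have [/gP[h _ _]|nA] := pselect (exists2 A, atom A & A `<=` S n); first by left.
  right; split; first exact: g0.
  by apply: (g0 _); rewrite SE /C g0// setD0.
- move=> n; have [hn|nA] := pselect (exists2 A, atom A & A `<=` S n.+1); last first.
    by rewrite {1}/C g0// pr0 pr_ge0.
  have [A aA AS] := hn; have [aC CS _] := gP _ hn.
  have sub : S n.+1 `<=` S n by exact: ndS.
  have [_ _] := gP (S n) (ex_intro2 _ _ A aA (subset_trans AS sub)).
  by apply => //; exact: subset_trans CS sub.
- move=> B aB BC.
  have BS n : B `<=` S n.
    elim: n => [|n IH] //; rewrite SE => x Bx; split; first exact: IH.
    by move=> Cx; apply: (BC x Bx); exists n.
  have BCn n : pr P B <= pr P (C n).
    by have [_ _ h] := gP (S n) (ex_intro2 _ _ B aB (BS n)); exact: h.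
  have B0 : 0 < pr P B by case: aB.
  (* An atom avoiding every [C n] competed at each stage, so each [C n] has at least its mass;
     finite total mass forbids this. *)
  apply: (nat_unbounded B0) => n.
  apply: le_trans (_ : pr P (\big[setU/set0]_(i < n) C i) <= _); last first.
    by apply: pr_le1; apply: bigsetU_measurable => i _; exact: F_meas.
  rewrite pr_bigU ?index_enum_uniq//; last 2 first.
  + by move=> i; exact: F_meas.
  + move=> i j x Ci Cj; apply: ord_inj; case: (ltngtP i j) => // ij; exfalso;
      [exact: dC ij Ci Cj|exact: dC ij Cj Ci].
  apply: le_trans (_ : \sum_(i < n) pr P B <= _); first by rewrite sumr_const card_ord mulr_natl.
  by apply: ler_sum.
Qed.

End Atoms.

(** * Infinitely distant pieces *)

Section SeparatedSets.
Variable X : nat -> mmspace.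
Local Notation L := (loeb X).
Local Notation lam := (loeb_prob X).

(* [far r x y] for every real [r] says that the ultralimit distance of [x] and [y] is infinite. *)
Definition separated (A : set L) : Prop :=
  measurable A /\ exists N : set L, [/\ measurable N, pr lam N = 0 &
    forall x y, A x -> ~ N x -> ~ A y -> ~ N y -> forall r, far r x y].

Lemma separated_measurable A : separated A -> measurable A.
Proof. by case. Qed.

Lemma separatedT : separated setT.
Proof. by split => //; exists set0; split; [exact: measurable0|exact: pr0|move=> x y _ _ []]. Qed.

Lemma separatedC A : separated A -> separated (~` A).
Proof.
move=> [mA [N [mN N0 H]]]; split; first exact: measurableC.
exists N; split => // x y nA nx /contrapT Ay ny r; apply: far_sym; exact: H.
Qed.

Lemma separated_bigcup (A : nat -> set L) : (forall n, separated (A n)) ->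
  separated (\bigcup_n A n).
Proof.
move=> HA; have /choice[N HN] : forall n, exists N : set L, [/\ measurable N, pr lam N = 0 &
    forall x y, A n x -> ~ N x -> ~ A n y -> ~ N y -> forall r, far r x y].
  by move=> n; have [] := HA n.
split; first by apply: bigcupT_measurable => n; exact: separated_measurable.
exists (\bigcup_n N n); split.
- by apply: bigcupT_measurable => n; have [] := HN n.
- by apply: pr_bigcup_null => n; have [] := HN n.
- move=> x y [n _ Ax] nx nA ny r; have [_ _] := HN n; apply => //.
  + by move=> Nx; apply: nx; exists n.
  + by move=> Ay; apply: nA; exists n.
  + by move=> Ny; apply: ny; exists n.
Qed.

Lemma separated_family (A : nat -> set L) : (forall n, separated (A n)) ->
  exists N : set L, [/\ measurable N, pr lam N = 0 &
    forall n x y, A n x -> ~ N x -> ~ A n y -> ~ N y -> forall r, far r x y].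
Proof.
move=> HA; have /choice[N HN] : forall n, exists N : set L, [/\ measurable N, pr lam N = 0 &
    forall x y, A n x -> ~ N x -> ~ A n y -> ~ N y -> forall r, far r x y].
  by move=> n; have [] := HA n.
exists (\bigcup_n N n); split.
- by apply: bigcupT_measurable => n; have [] := HN n.
- by apply: pr_bigcup_null => n; have [] := HN n.
- move=> n x y Ax nx nA ny r; have [_ _] := HN n; apply => //.
  + by move=> Nx; apply: nx; exists n.
  + by move=> Ny; apply: ny; exists n.
Qed.

Local Notation satom := (atom lam separated).

(* [C] splits into infinitely distant pieces of arbitrarily prescribed masses, and maps that are
   constant on these pieces are 1-Lipschitz whatever the constants. *)
Lemma nonatomic_pyr (C : set L) (Y : mmspace) : separated C ->
  (forall B, satom B -> ~ B `<=` C) -> pyr C Y.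
Proof.
move=> sC noatom; have mC := separated_measurable sC.
apply: discrete_pyr => // e e0; have [M HM] := cells_tight Y e0 e0.
set c := pr lam C; have c0 : 0 <= c by exact: pr_ge0.
have c1 : c <= 1 by exact: pr_le1.
have mcell j : measurable (cell e j : set (mm_car Y)) by exact: measurable_cell.
have sumcell m : \sum_(j < m) pr (mm_mu Y) (cell e j) = pr (mm_mu Y) (\bigcup_(j < m) cell e j).
  rewrite bigcup_mkord pr_bigU ?index_enum_uniq//.
  by move=> i j x ci cj; apply: ord_inj; exact: cell_inj ci cj.
have [D [FD DC dD prD']] : exists D : nat -> set L, [/\ forall j, separated (D j),
    forall j, D j `<=` C, forall i j x, D i x -> D j x -> i = j &
    forall j, (j < M)%N -> pr lam (D j) = c * pr (mm_mu Y) (cell e j)].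
  (* The induction also carries that the pieces from [m] on are empty, so that the union of the
     sequence is the union of the pieces cut out so far. *)
  suff : forall m, exists D : nat -> set L, [/\ forall j, separated (D j),
    forall j, D j `<=` C, forall i j x, D i x -> D j x -> i = j,
    forall j, (j < m)%N -> pr lam (D j) = c * pr (mm_mu Y) (cell e j) &
    forall j, (m <= j)%N -> D j = set0].
    by move=> /(_ M) [D [h1 h2 h3 h4 _]]; exists D.
  elim=> [|m [D [sD DC dD prDm Dm]]].
    exists (fun=> set0); split => // j; last exact: sub0set.
    exact: (sub_sigma0 separatedT separatedC).
  have sU : separated (\bigcup_j D j) by exact: separated_bigcup.
  have sA : separated (C `\` \bigcup_j D j).
    by apply: (sub_sigmaD separatedT separatedC separated_bigcup).
  have mD j : measurable (D j) by exact: separated_measurable.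
  have UE : \bigcup_j D j = \big[setU/set0]_(j < m) D j.
    apply/seteqP; split=> [x [j _ Dj]|]; last exact: bigsetU_bigcup.
    rewrite -bigcup_mkord; exists j => //=; rewrite ltnNge; apply/negP => mj.
    by move: Dj; rewrite Dm.
  have prU' : pr lam (\bigcup_j D j) = c * pr (mm_mu Y) (\bigcup_(j < m) cell e j).
    rewrite UE pr_bigU ?index_enum_uniq//; last first.
      by move=> i j x Di Dj; apply: ord_inj; exact: dD Di Dj.
    by rewrite -sumcell mulr_sumr; apply: eq_bigr => j _; exact: prDm.
  have hA : 0 <= c * pr (mm_mu Y) (cell e m) <= pr lam (C `\` \bigcup_j D j).
    rewrite mulr_ge0 ?pr_ge0//=.
    have UC : \bigcup_j D j `<=` C by move=> x [j _ /DC].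
    rewrite (pr_subD lam mC (separated_measurable sU) UC).
    have := sumcell m.+1; rewrite big_ord_recr/= sumcell => E1.
    rewrite prU' -/c lerBrDl -mulrDr E1 ler_piMr//.
    by rewrite pr_le1//; exact: measurable_cells.
  have [B [sB BA prB]] := nonatomic_split separated_measurable separatedT separatedC
    separated_bigcup noatom sA (@subDsetl _ _ _) hA.
  exists (fun j => if j == m then B else D j); split.
  - by move=> j; case: ifP.
  - by move=> j; case: ifP => // _; apply: subset_trans BA _; exact: subDsetl.
  - move=> i j x; case: ifP => [/eqP ->|im]; case: ifP => [/eqP -> //|jm].
    + by move=> /BA[_ nU] Dj; exfalso; apply: nU; exists j.
    + by move=> Di /BA[_ nU]; exfalso; apply: nU; exists i.
    + exact: dD.
  - by move=> j; rewrite ltnS leq_eqVlt => /orP[/eqP ->|jm]; [rewrite eqxx|rewrite ltn_eqF// prDm].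
  - by move=> j mj; rewrite gtn_eqF// Dm// ltnW.
have [N [mN N0 HN]] := separated_family FD.
have mD j : measurable (D j) by exact: separated_measurable.
have prDN j : pr lam (D j `\` N) = pr lam (D j).
  rewrite prD// [X in _ - X](_ : _ = 0) ?subr0//.
  by apply: (pr_null (B := N)) => //; exact: measurableI.
have sumE (K : set (mm_car Y)) :
    \sum_(j < M | `[< K (mm_dense Y j) >]) pr lam (D j `\` N) =
    c * \sum_(j < M | `[< K (mm_dense Y j) >]) pr (mm_mu Y) (cell e j).
  by rewrite mulr_sumr; apply: eq_bigr => j _; rewrite prDN prD'.
exists M, (mm_dense Y), (fun j => D j `\` N); split.
- move=> j; split; first exact: measurableD.
  by move=> x [Dx _]; exact: DC Dx.
- by move=> i j x [Di _] [Dj _]; apply: (dD i j x).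
- under eq_bigr => j _ do rewrite prDN prD'//.
  rewrite -mulr_sumr sumcell.
  have := ler_wpM2l c0 (ltW HM); rewrite mulrBr mulr1 -/c.
  have ce : c * e <= e by rewrite ler_piMl// ltW.
  by lra.
- move=> i j x x' [Di nx] [Dj nx'].
  have [ij|ij] := eqVneq i j; last first.
    by apply: (HN i) => // Di'; move/eqP: ij; apply; exact: dD Di' Dj.
  apply: (@far_le _ 0); first by rewrite ij mm_xx; lra.
  by apply: filterE => n; exact: mm_ge0.
- move=> K mK; rewrite sumE -pr_bigU_cond ?index_enum_uniq//; last first.
    by move=> i j x ci cj; apply: ord_inj; exact: cell_inj ci cj.
  apply: le_trans (_ : c * pr (mm_mu Y) (thicken K e) <= _); last by rewrite lerDl ltW.
  apply: ler_wpM2l => //; apply: le_pr; [|exact: measurable_thicken|].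
    by apply: bigsetU_measurable => j _.
  rewrite (bigsetU_ord_cond _ (fun j => `[< K (mm_dense Y j) >]) (fun j => cell e j)).
  move=> y [j /= [jM /asboolP Kj] cj]; exists (mm_dense Y j) => //; rewrite /dball/=.
  exact: cell_dist cj.
Qed.

End SeparatedSets.

(** * Large observable diameter and splitting of atoms *)

Section SpreadOut.
Variables (Y : mmspace) (f : mm_car Y -> R).
Hypothesis lf : forall x x', `|f x - f x'| <= mm_dist x x'.
Local Notation mu := (mm_mu Y).
Local Notation below t := [set y | f y <= t].
Local Notation above t := [set y | t < f y].

Lemma measurable_above t : measurable (above t).
Proof.
apply: measurable_dopen => x /= tx; exists (f x - t); first by rewrite subr_gt0.
by move=> y; rewrite /dball/= => xy; have := lf x y; rewrite ler_norml => /andP[? ?]; lra.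
Qed.

Lemma setC_above t : ~` above t = below t.
Proof. by apply/seteqP; split=> x /=; rewrite leNgt => /negP. Qed.

Lemma measurable_below t : measurable (below t).
Proof. by rewrite -setC_above; apply: measurableC; exact: measurable_above. Qed.

Let pr_below t : pr mu (below t) = 1 - pr mu (above t).
Proof. by rewrite -setC_above prC//; exact: measurable_above. Qed.

Let le_below t t' : t <= t' -> pr mu (below t) <= pr mu (below t').
Proof.
move=> tt'; apply: le_pr; [exact: measurable_below|exact: measurable_below|].
by move=> y /= h; exact: le_trans h tt'.
Qed.

(** A quantile up to a unit step, found as the first integer step from a far left point at which the
    mass reaches [h]; this precision suffices and avoids discontinuities of the distribution
    function. *)
Let quantile (h : R) : 0 < h -> h + h <= 1 ->
  exists p : R, pr mu (below (p - 1)) < h /\ h <= pr mu (below p).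
Proof.
move=> h0 h1.
pose G n := below n%:R `&` above (- n%:R).
have mG n : measurable (G n).
  by apply: measurableI; [exact: measurable_below|exact: measurable_above].
have ndG m n : (m <= n)%N -> G m `<=` G n.
  move=> mn y [/= h2 h3]; have : (m%:R : R) <= n%:R by rewrite ler_nat.
  by split => /=; lra.
have [N /(_ N (leqnn N))] := pr_cvg_up mu mG ndG h0.
have -> : \bigcup_n G n = setT.
  apply/seteqP; split=> // y _; exists (Num.truncn `|f y|).+1 => //.
  have /andP[_] := truncn_itv (normr_ge0 (f y)); rewrite ltr_norml => /andP[? ?].
  by split => //=; apply: ltW.
rewrite prT => hG.
have h2 : pr mu (below (- N%:R)) < h.
  suff : pr mu (below (- N%:R)) <= pr mu (~` G N) by rewrite prC//; lra.
  apply: le_pr; [exact: measurable_below|exact: measurableC|].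
  by move=> y /= yN [_] /=; rewrite ltNge yN.
have h3 : h <= pr mu (below N%:R).
  have : pr mu (G N) <= pr mu (below N%:R).
    by apply: le_pr => //; [exact: measurable_below|move=> y []].
  lra.
have ex : exists i : nat, h <= pr mu (below (- N%:R + i%:R)).
  by exists (N + N)%N; rewrite natrD addrA addNr add0r.
have [i hi Hi] := ex_minnP ex.
case: i hi Hi => [|i] hi Hi; first by move: hi; rewrite addr0; lra.
exists (- N%:R + i.+1%:R); split => //.
have -> : - N%:R + i.+1%:R - 1 = - N%:R + i%:R :> R by rewrite -natr1; lra.
by rewrite ltNge; apply/negP => /Hi; rewrite ltnn.
Qed.

(** Starting at the quantile [p], take [k.+1] disjoint shells of width [k.+1]; one of them has mass
    at most [eps k]. If less than [h] lay above the last shell, the interval from [p - 1] to its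
    end, of length [1 + k.+1 ^ 2], would have mass more than [1 - kappa] and bound the partial
    diameter. *)
Lemma spread_out (h kappa : R) (k : nat) : 0 < h -> h + h = kappa -> kappa < 1 ->
  ((1 + k.+1%:R * k.+1%:R)%:E <
    partial_diam (pushforward mu (f : mm_car Y -> measurableTypeR R)) kappa)%E ->
  exists t : R, [/\ h <= pr mu (below t), h <= pr mu (above (t + k.+1%:R)) &
    pr mu (below (t + k.+1%:R) `&` above t) <= eps k].
Proof.
move=> h0 hk k1 H.
have interval a b : a <= b -> b - a <= 1 + k.+1%:R * k.+1%:R ->
    pr mu (below b `&` above a) < 1 - kappa.
  move=> ab ba; have mI : measurable (below b `&` above a).
    by apply: measurableI; [exact: measurable_below|exact: measurable_above].
  rewrite ltNge; apply/negP => hI; move: H; apply/negP; rewrite -leNgt.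
  apply: (@le_trans _ _ (diamR `]a, b]%classic)).
    apply: ereal_inf_lbound; exists `]a, b]%classic => //; split => //.
    rewrite /pushforward.
    have -> : f @^-1` `]a, b]%classic = below b `&` above a.
      apply/seteqP; split=> y; rewrite /preimage/= in_itv/=; first by move=> /andP[].
      by move=> [h2 h1]; apply/andP.
    by rewrite prE// lee_fin.
  apply: ge_ereal_sup => z [[x xI [y yI <-]]|->]; last by rewrite lee_fin; lra.
  move: xI yI; rewrite /= !in_itv/= => /andP[ax xb] /andP[ay yb].
  by rewrite lee_fin; apply: le_trans ba; rewrite ler_norml; apply/andP; split; lra.
have hh1 : h + h <= 1 by lra.
have [p [hp1 hp2]] := @quantile h h0 hh1.
have kk0 : 0 < k.+1%:R :> R by [].
have kkk : 0 < k.+1%:R * k.+1%:R :> R by rewrite mulr_gt0.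
pose s i := p + i%:R * k.+1%:R.
have s_last : h <= pr mu (above (s k.+1)).
  have ab : p - 1 <= s k.+1 by rewrite /s; lra.
  have ba : s k.+1 - (p - 1) <= 1 + k.+1%:R * k.+1%:R by rewrite /s; lra.
  have := interval (p - 1) (s k.+1) ab ba.
  have -> : pr mu (below (s k.+1) `&` above (p - 1)) =
      pr mu (below (s k.+1)) - pr mu (below (p - 1)).
    rewrite -pr_subD ?setDE -?setC_above ?setCK//; try exact: measurable_below.
    - by apply: measurableC; exact: measurable_above.
    - by apply: measurableC; exact: measurable_above.
    - by rewrite !setC_above => y /= yp; exact: le_trans yp ab.
  by rewrite (pr_below (s k.+1)); lra.
have s_le i : p <= s i by rewrite /s lerDl mulr_ge0.
have s_S i : s i.+1 = s i + k.+1%:R by rewrite /s -natr1 mulrDl mul1r addrA.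
pose shell i := below (s i.+1) `&` above (s i).
have mshell i : measurable (shell i).
  by apply: measurableI; [exact: measurable_below|exact: measurable_above].
have s_mono i j : (i <= j)%N -> s i <= s j.
  by move=> ij; rewrite /s lerD2l ler_pM2r// ler_nat.
have [i hi] : exists i : 'I_k.+1, pr mu (shell i) <= eps k.
  apply: contrapT => /forallNP nex.
  have : \sum_(i < k.+1) eps k < \sum_(i < k.+1) pr mu (shell i).
    apply: ltr_sum => [|i _]; first by apply/hasP; exists ord0; rewrite ?mem_index_enum.
    by rewrite ltNge; apply/negP; exact: nex.
  rewrite sumr_const card_ord -mulr_natl /eps divff// -pr_bigU ?index_enum_uniq//; last first.
    move=> i j y [/= h1' h2'] [/= h3 h4]; apply: ord_inj; case: (ltngtP i j) => // ij.
      have h5 : s i.+1 <= s j by exact: s_mono.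
      by have := lt_le_trans h4 (le_trans h1' h5); rewrite ltxx.
    have h5 : s j.+1 <= s i by exact: s_mono.
    by have := lt_le_trans h2' (le_trans h3 h5); rewrite ltxx.
  by apply/negP; rewrite -leNgt pr_le1//; apply: bigsetU_measurable => j _; exact: mshell.
exists (s i); split.
- exact: le_trans hp2 (le_below (s_le i)).
- apply: le_trans s_last _; rewrite -s_S.
  apply: le_pr; [exact: measurable_above|exact: measurable_above|].
  by move=> y /=; apply: le_lt_trans; exact: s_mono.
- by rewrite -s_S.
Qed.

End SpreadOut.

Section AtomObsDiam.
Variable X : nat -> mmspace.
Local Notation L := (loeb X).
Local Notation lam := (loeb_prob X).

(* If the observable diameter of [pyr C] is infinite, saturation yields an infinitely distant
   splitting of [C]. *)
Lemma atom_finite_obsdiam (C : set L) : atom lam (@separated X) C -> finite_obsdiam (pyr C).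
Proof.
move=> [[mC [NC [mNC NC0 farC]]] C0 atomC] kappa /andP[k0 k1].
rewrite ltNge; apply/negP; rewrite leye_eq => /eqP infinite.
have [h h0 hk] := half_gt0 k0.
set c := pr lam C in C0.
have [C' [mC' CC' C'C]] := loeb_internal_ae mC.
have mIC' : measurable (internal C' : set L) by exact: measurable_internal.
have prC' (A : set L) : measurable A -> A `<=` C -> pr lam A <= pr lam (A `&` internal C').
  move=> mA AC; apply: (@pr_eqD _ _ _ _ _ (C `\` internal C')) => //.
  - exact: measurableI.
  - exact: measurableD.
  - by move=> x [Ax /not_andP[/(_ (AC _ Ax))//|/contrapT]].
have cE : pr lam (internal C') <= c.
  by apply: (@pr_eqD _ _ _ _ _ (internal C' `\` C : set L)) => //; [exact: measurableD|
    move=> x [Cx /not_andP[//|/contrapT]]].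
have c0 : 0 <= c by exact: ltW.
have c1 : c <= 1 by exact: pr_le1.
(* Two subsets of [C' n] at distance at least [k.+1]. Each loses [eps k] to inner approximation and
   [eps k] to the passage to a finite index; the fifth [eps k] for the total is the mass of the
   shell between them. *)
pose Phi k n (t : set (mm_car (X n)) * set (mm_car (X n))) :=
  [/\ measurable t.1 /\ measurable t.2, t.1 `<=` C' n /\ t.2 `<=` C' n,
      c * h - (eps k + eps k) <= pr (mm_mu (X n)) t.1 /\
      c * h - (eps k + eps k) <= pr (mm_mu (X n)) t.2,
      c - (eps k + eps k + eps k + eps k + eps k) <=
        pr (mm_mu (X n)) t.1 + pr (mm_mu (X n)) t.2 &
      forall x y, t.1 x -> t.2 y -> k.+1%:R <= mm_dist x y].
have [k|t Ht] := @saturation (fun n => set (mm_car (X n)) * set (mm_car (X n)))%type Phi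
    (fun n => (set0, set0)).
  have [Y [f [N [pY lf H mf]]]] : exists Y (f : mm_car Y -> R) (_ : unit),
      [/\ pyr C Y, forall x x', `|f x - f x'| <= mm_dist x x',
      ((1 + k.+1%:R * k.+1%:R)%:E <
        partial_diam (pushforward (mm_mu Y) (f : mm_car Y -> measurableTypeR R)) kappa)%E & True].
    have : ((1 + k.+1%:R * k.+1%:R)%:E < obsdiamP (pyr C) kappa)%E by rewrite infinite ltry.
    move=> /ereal_sup_gt[_ [Y [pY ->]]] /ereal_sup_gt[_ [f [mf lf] <-]] h1.
    by exists Y, f, tt.
  have [F [N' [mF [mN' N'0] lipF lawF]]] := pY.
  have [s [hs1 hs2 hs3]] := spread_out lf h0 hk k1 H.
  pose A := (C `&` F @^-1` [set y | f y <= s]) `\` N'.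
  pose B := (C `&` F @^-1` [set y | s + k.+1%:R < f y]) `\` N'.
  have m1 : measurable (F @^-1` [set y | f y <= s]) by apply: mF; exact: measurable_below.
  have m2 : measurable (F @^-1` [set y | s + k.+1%:R < f y]) by apply: mF; exact: measurable_above.
  have mA : measurable A by apply: measurableD => //; exact: measurableI.
  have mB : measurable B by apply: measurableD => //; exact: measurableI.
  have prN (S : set L) : measurable S -> pr lam (S `\` N') = pr lam S.
    move=> mS; rewrite prD// [X in _ - X](_ : _ = 0) ?subr0//.
    by apply: (pr_null (B := N')) => //; exact: measurableI.
  have prA : pr lam A = c * pr (mm_mu Y) [set y | f y <= s].
    by rewrite prN ?lawF//; [exact: measurable_below|exact: measurableI].
  have prB : pr lam B = c * pr (mm_mu Y) [set y | s + k.+1%:R < f y].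
    by rewrite prN ?lawF//; [exact: measurable_above|exact: measurableI].
  have farAB x y : A x -> B y -> far k.+1%:R x y.
    move=> [[Cx /= fx] nx] [[Cy /= fy] ny]; apply: lipF => //.
    by have := lf (F x) (F y); rewrite ler_norml => /andP[? ?]; lra.
  have mAC : measurable (A `&` internal C') by exact: measurableI.
  have mBC : measurable (B `&` internal C') by exact: measurableI.
  have [J [mJ JA pJ]] := loeb_inner mAC (eps_gt0 k).
  have [K [mK KB pK]] := loeb_inner mBC (eps_gt0 k).
  have AC : A `<=` C by move=> x [[]].
  have BC : B `<=` C by move=> x [[]].
  have hA := prC' A mA AC; have hB := prC' B mB BC.
  have hAh : c * h <= pr lam A by rewrite prA ler_wpM2l.
  have hBh : c * h <= pr lam B by rewrite prB ler_wpM2l.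
  have hAB : c - eps k <= pr lam A + pr lam B.
    have mb := measurable_below lf s; have ma := measurable_above lf (s + k.+1%:R).
    have mab := measurableI _ _ (measurable_below lf (s + k.+1%:R)) (measurable_above lf s).
    have : 1 <= pr (mm_mu Y) [set y | f y <= s] + pr (mm_mu Y) [set y | s + k.+1%:R < f y] + eps k.
      rewrite -[leLHS](prT (mm_mu Y)); apply: le_trans (_ : pr (mm_mu Y)
        (([set y | f y <= s] `|` [set y | s + k.+1%:R < f y]) `|`
         ([set y | f y <= s + k.+1%:R] `&` [set y | s < f y])) <= _).
        apply: le_pr => //; first by do 2 apply: measurableU => //.
        move=> y _; have [h1|h1] := leP (f y) s; first by left; left.
        by have [h2|h2] := leP (f y) (s + k.+1%:R); [right|left; right].
      apply: le_trans (prU_le _ _ _) _ => //; first exact: measurableU.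
      by apply: lerD => //; exact: (prU_le (mm_mu Y) mb ma).
    move=> /(ler_wpM2l c0); rewrite mulr1 !mulrDr -prA -prB.
    have : c * eps k <= eps k by rewrite ler_piMl// ltW// eps_gt0.
    by lra.
  have h1 : \forall n \near hyper, J n `<=` C' n by apply/internal_subP => x /JA[].
  have h2 : \forall n \near hyper, K n `<=` C' n by apply/internal_subP => x /KB[].
  have h3 : \forall n \near hyper, forall x y, J n x -> K n y -> k.+1%:R <= mm_dist x y.
    by apply: far_internal => x y /JA[Ax _] /KB[By _]; exact: farAB.
  have h4 := loeb_internal mJ (eps_gt0 k).
  have h5 := loeb_internal mK (eps_gt0 k).
  apply: filterS (hyper_and (hyper_and h1 h2) (hyper_and h3 (hyper_and h4 h5))).
  move=> n [[{}h1 {}h2] [{}h3 [{}h4 {}h5]]]; exists (J n, K n) => j jk.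
  have jk' := le_eps jk; move: h4 h5; rewrite !ltr_norml => /andP[? ?] /andP[? ?].
  split=> /=; [by []|by []|by split; lra|by lra|].
  move=> x y Jx Ky; apply: le_trans (h3 x y Jx Ky); rewrite ler_nat.
  exact: leq_trans jk _.
pose A n := if `[< measurable (t n).1 >] then (t n).1 else set0.
pose B n := if `[< measurable (t n).2 >] then (t n).2 else set0.
have mA n : measurable (A n) by rewrite /A; case: ifP => // /asboolP.
have mB n : measurable (B n) by rewrite /B; case: ifP => // /asboolP.
have AB : \forall n \near hyper, A n = (t n).1 /\ B n = (t n).2.
  by apply: filterS (Ht 0%N) => n [[m1 m2] _ _ _ _]; rewrite /A /B !asboolT.
have mIA : measurable (internal A : set L) by exact: measurable_internal.
have mIB : measurable (internal B : set L) by exact: measurable_internal.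
have AC' : internal A `<=` internal C'.
  by apply/internal_subP; apply: filterS2 AB (Ht 0%N) => n [-> _] [_ []].
have BC' : internal B `<=` internal C'.
  by apply/internal_subP; apply: filterS2 AB (Ht 0%N) => n [_ ->] [_ []].
have farAB x y : internal A x -> internal B y -> forall r, far r x y.
  move=> Ax By r; pose k := (Num.truncn `|r|).
  have rk : r <= k.+1%:R.
    have /andP[_ h1] := truncn_itv (normr_ge0 r).
    exact: le_trans (ler_norm r) (ltW h1).
  rewrite /far; apply: filterS (hyper_and (hyper_and Ax By) (hyper_and AB (Ht k))).
  move=> n [[Axn Byn] [[E1 E2] [_ _ _ _ H]]]; apply: le_trans rk _; apply: H.
    by rewrite -E1.
  by rewrite -E2.
have close k : exists n, [/\ Phi k n (A n, B n),
    pr (mm_mu (X n)) (A n) <= pr lam (internal A) + eps k &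
    pr (mm_mu (X n)) (B n) <= pr lam (internal B) + eps k].
  have [n [[E1 E2] [H [h1 h2]]]] := hyper_ex (hyper_and AB (hyper_and (Ht k)
    (hyper_and (loeb_internal mA (eps_gt0 k)) (loeb_internal mB (eps_gt0 k))))).
  exists n; move: h1 h2; rewrite !ltr_norml => /andP[? ?] /andP[? ?]; split; [|lra|lra].
  by rewrite E1 E2 -surjective_pairing.
have ch : 0 < c * h by rewrite mulr_gt0.
have le_many (x : R) (m : nat) : (forall k, x <= eps k *+ m) -> x <= 0.
  move=> H; have m1 : 0 < m.+1%:R :> R by [].
  apply/ler_addgt0Pr => e e0; rewrite add0r.
  have [k /(_ k (leqnn k)) ke] := eps_small (divr_gt0 e0 m1).
  apply: le_trans (H k) _; rewrite -mulr_natl; move: ke; rewrite ltr_pdivlMr// mulrC => ke.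
  apply: le_trans (ltW ke); rewrite ler_wpM2r ?(ltW (eps_gt0 k))// ler_nat//.
have prA : c * h <= pr lam (internal A).
  rewrite -subr_le0; apply: (le_many _ 3%N) => k; rewrite !mulrS mulr0n.
  by have [n [[_ _ [/= ? _] _ _] ? _]] := close k; lra.
have prB : c * h <= pr lam (internal B).
  rewrite -subr_le0; apply: (le_many _ 3%N) => k; rewrite !mulrS mulr0n.
  by have [n [[_ _ [_ /= ?] _ _] _ ?]] := close k; lra.
have prAB : c <= pr lam (internal A) + pr lam (internal B).
  rewrite -subr_le0; apply: (le_many _ 7%N) => k; rewrite !mulrS mulr0n.
  by have [n [[_ _ _ /= ? _] ? ?]] := close k; lra.
have AB0 : internal A `&` internal B = set0.
  apply/seteqP; split=> // x [Ax Bx]; have [n] := hyper_ex (farAB x x Ax Bx 1).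
  by rewrite mm_xx ler10.
have prU' : pr lam (internal A `|` internal B : set L) = pr lam (internal A) + pr lam (internal B).
  exact: prU.
have mU : measurable (internal A `|` internal B : set L) by exact: measurableU.
have UC' : internal A `|` internal B `<=` internal C' by move=> x [/AC'|/BC'].
have leU : pr lam (internal A `|` internal B : set L) <= pr lam (internal C') by exact: le_pr.
have rest : pr lam (internal C' `\` (internal A `|` internal B) : set L) = 0.
  by apply/eqP; rewrite eq_le pr_ge0 andbT pr_subD//; lra.
pose N : set L := (NC `|` (C `\` internal C')) `|` (internal C' `\` (internal A `|` internal B)).
have mN : measurable N.
  apply: measurableU; first by apply: measurableU => //; exact: measurableD.
  exact: measurableD.
have N0 : pr lam N = 0.
  apply/eqP; rewrite eq_le pr_ge0 andbT; apply: le_trans (prU_le _ _ _) _.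
  - by apply: measurableU => //; exact: measurableD.
  - exact: measurableD.
  rewrite rest addr0; apply: le_trans (prU_le _ _ _) _ => //; first exact: measurableD.
  by rewrite NC0 CC' addr0.
(* Points outside [C] are infinitely far from [C] because [C] is separated; almost all of the rest
   of [C] lies in [internal B], which is infinitely far from [internal A]. *)
have sAC : separated (internal A `&` C : set L).
  split; first exact: measurableI.
  exists N; split => // x y [Ax Cx] nx nACy ny r.
  have nNCx : ~ NC x by move=> H; apply: nx; left; left.
  have nNCy : ~ NC y by move=> H; apply: ny; left; left.
  have [Cy|nCy] := pselect (C y); last exact: farC.
  have C'y : internal C' y by apply: contrapT => nC'y; apply: ny; left; right.
  have nAy : ~ internal A y by move=> Ay; apply: nACy.
  apply: farAB => //; apply: contrapT => nBy; apply: ny; right; split => //.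
  by move=> [].
have prAC : pr lam (internal A) <= pr lam (internal A `&` C : set L).
  apply: (@pr_eqD _ _ _ _ _ (internal C' `\` C : set L)) => //.
  - exact: measurableI.
  - exact: measurableD.
  - by move=> x [Ax /not_andP[/(_ (AC' _ Ax))//|/contrapT]].
have leA : pr lam (internal A `&` C : set L) <= pr lam (internal A).
  by apply: le_pr => //; exact: measurableI.
(* Mass 0 is excluded by [c * h > 0]; mass [c] is excluded because [internal B] also has mass at
   least [c * h] and the two together have mass at most [c]. *)
have [h1|h1] := atomC _ sAC (@subIsetr _ _ _); first by lra.
by rewrite -/c in h1; lra.
Qed.

End AtomObsDiam.

(** * Direct sums and the final decomposition *)

Lemma pr_bigcup_esum (disp : measure_display) (T : measurableType disp) (P : probability T R)
    (D : set nat) (G : nat -> set T) :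
  (forall i, measurable (G i)) -> (forall i j x, G i x -> G j x -> i = j) ->
  P (\bigcup_(i in D) G i) = \esum_(i in D) P (G i).
Proof.
move=> mG dG; rewrite measure_bigcup//.
  by rewrite nneseries_esum// set_mem_set.
by move=> i j _ _ [x [Gi Gj]]; exact: dG Gi Gj.
Qed.

(** An image of the whole space restricts on each piece to a component ([pyr_component]). Conversely
    maps on the pieces glue, since for points of different pieces the Lipschitz condition is
    void. *)
Lemma pyr_dsum (X : nat -> mmspace) (D : set nat) (w : nat -> R) (C : nat -> set (loeb X)) :
  (forall i, separated (C i)) -> (forall i j x, C i x -> C j x -> i = j) ->
  (forall i, D i -> w i = pr (loeb_prob X) (C i) /\ 0 < pr (loeb_prob X) (C i)) ->
  pr (loeb_prob X) (~` \bigcup_(i in D) C i) = 0 ->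
  forall Y, pyr (setT : set (loeb X)) Y <-> dsum D w (fun i => pyr (C i)) Y.
Proof.
move=> sC dC wC null Y; set lam := loeb_prob X in wC null *.
have mC i : measurable (C i) := separated_measurable (sC i).
have mU : measurable (\bigcup_(i in D) C i) by exact: bigcup_measurable.
have mnU : measurable (~` \bigcup_(i in D) C i) by exact: measurableC.
have splitC (A : set (loeb X)) : measurable A ->
    lam A = \esum_(i in D) lam (C i `&` A).
  move=> mA; rewrite -pr_bigcup_esum.
  - have mI : measurable (\bigcup_(i in D) (C i `&` A)).
      by apply: bigcup_measurable => i _; exact: measurableI.
    rewrite !prE//; congr (_%:E); apply/eqP; rewrite eq_le; apply/andP; split.
      apply: (@pr_eqD _ _ _ _ _ (~` \bigcup_(i in D) C i)) => //.
      by move=> x [Ax /contrapT[i Di Cx]]; exists i.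
    by apply: le_pr => // x [i _ []].
  - by move=> i; exact: measurableI.
  - by move=> i j x [Ci _] [Cj _]; exact: dC Ci Cj.
split.
- move=> [F [N [mF [mN N0] lipF lawF]]].
  have pick i : exists Zf : {Z : mmspace & mm_car Z -> mm_car Y}, D i ->
      [/\ pyr (C i) (projT1 Zf), @lip1 (projT1 Zf) Y (projT2 Zf) &
        forall B, measurable B -> pr lam (C i `&` F @^-1` B) =
          pr lam (C i) * pr (mm_mu (projT1 Zf)) (projT2 Zf @^-1` B)].
    have [Di|nD] := pselect (D i); last by exists (existT _ Y id).
    have lipC x y : (C i `\` N) x -> (C i `\` N) y ->
        forall r, r < mm_dist (F x) (F y) -> far r x y.
      by move=> [_ nx] [_ ny]; apply: lipF.
    have [Z [f [pZ lf pf]]] := pyr_component (mC i) (wC i Di).2 mF mN N0 lipC.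
    by exists (existT _ Z f).
  pose Zf i := projT1 (cid (pick i)).
  have ZfP i : D i -> _ := projT2 (cid (pick i)).
  exists (fun i => projT1 (Zf i)), (fun i => projT2 (Zf i)); split.
  + by move=> i /ZfP[].
  + move=> i /ZfP[_ lf _]; split => // _ B mB; rewrite setTI.
    exact: (measurable_lip1 lf).
  + move=> B mB; have -> : mm_mu Y B = lam (F @^-1` B).
      have mFB := mF _ mB; rewrite !prE//; congr (_%:E).
      by rewrite -(setTI (F @^-1` B)) lawF// prT mul1r.
    rewrite splitC; last exact: mF.
    apply: eq_esum => i Di; have [_ lf pf] := ZfP i Di.
    have mI : measurable (C i `&` F @^-1` B) by apply: measurableI => //; exact: mF.
    have mf := measurable_lip1 lf mB.
    by rewrite !prE// pf// (wC i Di).1 -EFinM.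
- move=> [Xs [f [pX lf muY]]].
  have pick i : exists FN : (loeb X -> mm_car (Xs i)) * set (loeb X), D i ->
      [/\ forall B, measurable B -> measurable (FN.1 @^-1` B),
        measurable FN.2 /\ pr lam FN.2 = 0,
        (forall x y, (C i `\` FN.2) x -> (C i `\` FN.2) y ->
          forall r, r < mm_dist (FN.1 x) (FN.1 y) -> far r x y) &
        forall B, measurable B ->
          pr lam (C i `&` FN.1 @^-1` B) = pr lam (C i) * pr (mm_mu (Xs i)) B].
    have [/pX[F [N H]]|nD] := pselect (D i); first by exists (F, N).
    by exists (fun=> point, set0).
  pose F i := (projT1 (cid (pick i))).1; pose N i := (projT1 (cid (pick i))).2.
  have FNP i : D i -> [/\ forall B, measurable B -> measurable (F i @^-1` B),
        measurable (N i) /\ pr lam (N i) = 0,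
        (forall x y, (C i `\` N i) x -> (C i `\` N i) y ->
          forall r, r < mm_dist (F i x) (F i y) -> far r x y) &
        forall B, measurable B ->
          pr lam (C i `&` F i @^-1` B) = pr lam (C i) * pr (mm_mu (Xs i)) B].
    exact: (projT2 (cid (pick i))).
  pose ind x := xget 0%N [set i | D i /\ C i x].
  pose U := \bigcup_(i in D) C i.
  (* Off the union of the pieces, a null set, the glued map takes an arbitrary constant value. *)
  pose G x := if pselect (U x) is left _ then f (ind x) (F (ind x) x) else mm_dense Y 0.
  have indE i x : D i -> C i x -> ind x = i.
    move=> Di Ci; rewrite /ind; case: xgetP => [j _ [_ Cj]|/(_ i)]; first exact: dC Cj Ci.
    by move=> /(_ (conj Di Ci)).
  have GE i x : D i -> C i x -> G x = f i (F i x).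
    by move=> Di Ci; rewrite /G; case: pselect => [h|[]]; [rewrite (indE i)|exists i].
  have GN x : ~ U x -> G x = mm_dense Y 0 by rewrite /G; case: pselect.
  have mCG i B : D i -> measurable B -> measurable (C i `&` G @^-1` B).
    move=> Di mB; have -> : C i `&` G @^-1` B = C i `&` F i @^-1` (f i @^-1` B).
      by apply/seteqP; split=> x [Ci]; rewrite /preimage/= (GE i).
    have [mF _ _ _] := FNP i Di.
    by apply: measurableI => //; apply: (mF _); exact: (measurable_lip1 (lf i Di).1).
  have mG B : measurable B -> measurable (G @^-1` B).
    move=> mB; have -> : G @^-1` B = (\bigcup_(i in D) (C i `&` G @^-1` B)) `|`
        (if `[< B (mm_dense Y 0) >] then ~` U else set0).
      apply/seteqP; split=> x.
        have [[i Di Ci]|nU] := pselect (U x); first by left; exists i.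
        by rewrite /preimage/= GN// => B0; right; rewrite asboolT.
      by move=> [[i _ []]//|]; case: ifP => // /asboolP B0 nU; rewrite /preimage/= GN.
    apply: measurableU; last by case: ifP.
    by apply: bigcup_measurable => i Di; exact: mCG.
  have [N1 [mN1 N10 farC]] := separated_family sC.
  pose N' i : set (loeb X) := if `[< D i >] then N i else set0.
  have mN' i : measurable (N' i).
    by rewrite /N'; case: ifP => // /asboolP /FNP[_ []].
  have N'0 i : pr lam (N' i) = 0.
    by rewrite /N'; case: ifP => [/asboolP /FNP[_ []]|]// _; exact: pr0.
  have mUN' : measurable (\bigcup_i N' i) by exact: bigcupT_measurable.
  exists G, ((~` U) `|` (N1 `|` \bigcup_i N' i)); split => //.
  + split; first by apply: measurableU => //; exact: measurableU.
    apply/eqP; rewrite eq_le pr_ge0 andbT; apply: le_trans (prU_le _ _ _) _ => //.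
      exact: measurableU.
    rewrite null add0r; apply: le_trans (prU_le _ _ _) _ => //.
    by rewrite N10 add0r pr_bigcup_null.
  + move=> x y [_ /not_orP[/contrapT[i Di Ci] /not_orP[nx nx']]].
    move=> [_ /not_orP[/contrapT[j Dj Cj] /not_orP[ny ny']]] r.
    have [ij|ij] := eqVneq i j; last first.
      move=> _; apply: (farC i) => // Ci'; move/eqP: ij; apply; exact: dC Ci' Cj.
    rewrite -{}ij in Cj *; rewrite (GE i x)// (GE i y)//.
    move=> /lt_le_trans/(_ ((lf i Di).1 _ _)); have [_ _ lip _] := FNP i Di.
    apply: lip; split => // Nz; [apply: nx'|apply: ny']; exists i => //; by rewrite /N' asboolT.
  + move=> B mB; rewrite setTI prT mul1r; apply: EFin_inj.
    have mGB := mG B mB; rewrite -!prE// splitC// muY//.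
    apply: eq_esum => i Di; have [mF _ _ lawF] := FNP i Di.
    have mfB : measurable (f i @^-1` B) by exact: (measurable_lip1 (lf i Di).1).
    have -> : C i `&` G @^-1` B = C i `&` F i @^-1` (f i @^-1` B).
      by apply/seteqP; split=> x [Ci]; rewrite /preimage/= (GE i).
    have mI : measurable (C i `&` F i @^-1` (f i @^-1` B)).
      by apply: measurableI => //; exact: (mF _ mfB).
    by rewrite !prE// lawF// (wC i Di).1 -EFinM.
Qed.

Lemma dsum_ext (D : set nat) (w w' : nat -> R) (Q Q' : nat -> mmspace -> Prop) (Y : mmspace) :
  (forall i, D i -> w i = w' i) -> (forall i Z, D i -> Q i Z -> Q' i Z) ->
  dsum D w Q Y -> dsum D w' Q' Y.
Proof.
move=> ww QQ [Xs [f [QX lf muY]]]; exists Xs, f; split => //.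
  by move=> i Di; apply: QQ => //; exact: QX.
by move=> B mB; rewrite muY//; apply: eq_esum => i Di; rewrite ww.
Qed.

(** Needed for the one-term sequence [(0)], which still asks for a pyramid at index 1. The image in
    the zero-dimensional space is a point, so its ultraproduct is a point and an atom. *)
Lemma exists_finite_obsdiam_pyramid (Y : mmspace) : exists Q, pyramid Q /\ finite_obsdiam Q.
Proof.
have g0 (l : 'I_0) (x x' : mm_car Y) : `|(0 : R) - 0| <= mm_dist x x'.
  by rewrite subrr normr0 mm_ge0.
have [W [_ [emb [_ _ dW _]]]] := @sup_image Y 0 (fun _ _ => 0) g0.
pose X (n : nat) := W.
have one (x y : loeb X) : x = y.
  apply: functional_extensionality_dep => n.
  have [W0 _ _] := mm_metric W; apply: (W0 (x n) (y n)).1.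
  by rewrite dW /supd big_ord0.
exists (pyr (setT : set (loeb X))); split; first by apply: pyr_pyramid => //; rewrite prT.
apply: atom_finite_obsdiam; split; [exact: separatedT|by rewrite prT|].
move=> B _ _; have [[x Bx]|nB] := pselect (exists x, B x).
  by right; congr pr; apply/seteqP; split=> // y _; rewrite (one y x).
left; rewrite (_ : B = set0) ?pr0//.
by apply/seteqP; split=> // x Bx; apply: nB; exists x.
Qed.

Theorem theorem1p2 :
  forall P : mmspace -> Prop, pyramid P ->
  exists (N : option nat) (a : nat -> R) (Ps : nat -> mmspace -> Prop),
    [/\ inA N a,
        (forall n, idx N n -> pyramid (Ps n) /\ finite_obsdiam (Ps n)) &
        (forall X : mmspace, P X <-> Xsum N a Ps X)].
Proof.
move=> P pyrP; have [X [PX Pfull]] := exists_dense_chain pyrP.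
have PE Y : P Y <-> pyr (setT : set (loeb X)) Y.
  by split; [exact: Pfull|exact: pyr_full_sub].
set lam := loeb_prob X.
have [C [sC dC atC decC restC]] := @atomic_decomposition _ _ lam (@separated X)
  (@separated_measurable X) (separatedT X) (@separatedC X) (@separated_bigcup X).
have mC n := separated_measurable (sC n).
have stop n m : C n = set0 -> (n <= m)%N -> C m = set0.
  move=> Cn /subnK <-; elim: (m - n)%N => [|k IH]; first by rewrite add0n.
  by have [[_ + _]|[]//] := atC (k + n)%N; rewrite IH pr0 ltxx.
(* Without atoms the whole space is nonatomic and every mm-space is an image of it; this is the case
   of the sequence [(0)]. *)
have [C0|C0] := pselect (C 0%N = set0).
  have [Q [pQ fQ]] := exists_finite_obsdiam_pyramid (X 0%N).
  have CE n : C n = set0 by exact: stop C0 (leq0n n).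
  have UC0 : \bigcup_n C n = set0 by rewrite bigcup0.
  exists (Some 1%N), (fun=> 0), (fun=> Q); split => //; first by left.
  move=> Y; split=> [_|_].
    by left; split => //; rewrite /norm1 esum1.
  apply/PE/nonatomic_pyr; first exact: separatedT.
  by move=> B /restC; rewrite UC0 setC0.
have at0 : atom lam (@separated X) (C 0%N) by have [//|[]] := atC 0%N.
(* The number of atoms, infinite if the padding never starts. Atoms are counted from 0 while
   sequences in [inA] are indexed from 1, hence the shift. *)
have [N [N0 idxN]] : exists N : option nat, N <> Some 0%N /\
    forall n, idx N n <-> exists k, n = k.+1 /\ atom lam (@separated X) (C k).
  have atE k : atom lam (@separated X) (C k) <-> C k <> set0.
    split=> [[_ + _] Ck|Ck]; first by rewrite Ck pr0 ltxx.
    by have [//|[]] := atC k.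
  have [h|h] := pselect (exists n, C n = set0).
    have h' : exists n, `[< C n = set0 >] by have [n hn] := h; exists n; exact/asboolP.
    have [m /asboolP Cm Hm] := ex_minnP h'.
    exists (Some m); split; first by move=> [m0]; apply: C0; rewrite -m0.
    move=> n; split=> [[n1 nm]|[k [-> /atE Ck]]].
      exists n.-1; rewrite prednK//; split => //; apply/atE => Cn.
      have := Hm n.-1; rewrite asboolT// => /(_ isT).
      by rewrite leqNgt prednK// nm.
    split => //; rewrite ltnNge; apply/negP => mk; apply: Ck; exact: stop Cm mk.
  exists None; split => // n; split=> [[n1 _]|[k [-> _]]]; last by split.
  by exists n.-1; rewrite prednK//; split => //; apply/atE => Cn; apply: h; exists n.-1.
pose U := \bigcup_n C n.
have mU : measurable U by exact: bigcupT_measurable.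
(* Index 0 is reserved for the nonatomic remainder, in agreement with the index 0 in [Xsum]. *)
pose C' n := if n is k.+1 then C k else ~` U.
have sC' n : separated (C' n).
  by case: n => [|n] //=; apply: separatedC; exact: separated_bigcup.
have mC' n := separated_measurable (sC' n).
have dC' i j x : C' i x -> C' j x -> i = j.
  case: i j => [|i] [|j] //=.
  - by move=> nU Cj; exfalso; apply: nU; exists j.
  - by move=> Ci nU; exfalso; apply: nU; exists i.
  - by move=> Ci Cj; rewrite (dC i j x).
have at' n : idx N n -> atom lam (@separated X) (C' n).
  by move=> /idxN[k [-> ak]].
have UE : \bigcup_(n in idx N) C' n = U.
  apply/seteqP; split=> x; first by move=> [n /idxN[k [-> _]] Ck]; exists k.
  move=> [k _ Ck]; exists k.+1 => //; apply/idxN; exists k; split => //.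
  by have [//|[C0' _]] := atC k; move: Ck; rewrite C0'.
pose a n := pr lam (C' n).
have a_pos n : idx N n -> 0 < a n by move=> /at'[].
have normE : norm1 N a = (pr lam U)%:E.
  rewrite /norm1 -prE// -UE pr_bigcup_esum//.
  by apply: eq_esum => n _; rewrite prE.
have rest0 : pr lam (C' 0%N) = 1 - pr lam U by rewrite /= prC.
have U_pos : 0 < pr lam U.
  have [_ h _] := at0; apply: lt_le_trans h _; apply: le_pr => //.
  exact: bigcup_sup.
exists N, a, (fun n => pyr (C' n)); split.
- right; split => //.
  + by move=> n /a_pos an; rewrite an pr_le1.
  + move=> n /idxN[k [-> _]] _; exact: decC.
  + by rewrite normE lee_fin pr_le1.
- move=> n Nn; have an := at' n Nn; split; last exact: atom_finite_obsdiam.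
  by apply: pyr_pyramid => //; exact: a_pos.
move=> Y; rewrite PE.
(* If the remainder is null, the atoms have total mass 1 and index 0 must not occur in the sum,
   whose weights have to be positive. *)
have [r0|r0] := eqVneq (pr lam (C' 0%N)) 0.
  have U1 : pr lam U = 1 by lra.
  have E := pyr_dsum (D := idx N) sC' dC' (w := a).
  have {}E : pyr (setT : set (loeb X)) Y <-> dsum (idx N) a (fun i => pyr (C' i)) Y.
    by apply: E => [i /a_pos//|]; rewrite UE.
  rewrite E; split=> [H|[[n0 _]|[[n01 _]|[_ H]]]] => //.
  + by right; right; rewrite normE U1.
  + by move: n0; rewrite normE U1 => -[/eqP]; rewrite oner_eq0.
  + by move: n01; rewrite normE U1 ltxx andbF.
have r_pos : 0 < pr lam (C' 0%N) by rewrite lt_def r0 pr_ge0.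
pose w n := if n == 0%N then 1 - fine (norm1 N a) else a n.
have wE n : w n = pr lam (C' n).
  by rewrite /w; case: eqP => [->|//]; rewrite normE rest0.
have E : pyr (setT : set (loeb X)) Y <->
    dsum ([set 0%N] `|` idx N) w (fun i => pyr (C' i)) Y.
  apply: pyr_dsum => //.
    by move=> i [->|/a_pos ai]; rewrite wE; split.
  rewrite bigcup_setU bigcup_set1 UE /= setCU setCK setICr; exact: pr0.
(* The remainder contains no atom, so its pyramid is all of [calX]. *)
have full Z : pyr (C' 0%N) Z by apply: nonatomic_pyr => //; exact: restC.
rewrite E; split=> [H|[[n0 _]|[[_ H]|[n1 _]]]].
- right; left; split; first by rewrite normE !lte_fin U_pos /=; lra.
  apply: dsum_ext H => // i Z; case: eqP => // i0 _ _; exact: I.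
- by move: n0; rewrite normE => -[U0]; move: U_pos; rewrite U0 ltxx.
- apply: dsum_ext H => // i Z; case: eqP => [-> _ _|//]; exact: full.
- by move: n1; rewrite normE => -[U1]; move: r_pos; rewrite rest0 U1 subrr ltxx.
Qed.
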